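(* Let $K\subset\mathbb{R}^n$ be a convex body and $p\in(0,n)$. Then $$\widehat{\rho_{R_pK}^{\,p}}=\frac{p}{n-p}\,\rho_{F_{n-p}K}^{\,n-p}\qquad\text{and}\qquad \widehat{\rho_{F_pK}^{\,p}}=\frac{p(2\pi)^n}{n-p}\,\rho_{R_{n-p}K}^{\,n-p}$$ in the sense of distributions. In particular: (1) The function $\rho_{R_pK}^{\,p}$ is a positive-definite distribution, i.e. $R_pK$ is a $p$-intersection body: $$R_pK=(2\pi)^{\frac{p-n}{p}}\,I_p(F_{n-p}K).$$ (2) The function $\rho_{F_pK}^{\,p}$ is a positive-definite distribution, i.e. $F_pK$ is a $p$-intersection star: $$F_pK=(2\pi)\,I_p(R_{n-p}K).$$
   Context: A convex body is a compact convex set with non-empty interior. A set $M\subset\mathbb{R}^n$ is star-shaped if $0\in M$ and $x\in M$ implies $[0,x]\subset M$; its radial function is $\rho_M(\theta)=\sup\{t>0:t\theta\in M\}\in[0,\infty]$ for $\theta\in\mathbb{S}^{n-1}$, extended to $z\in\mathbb{R}^n\setminus\{0\}$ by $\rho_M(z)=|z|^{-1}\rho_M(z/|z|)$. Star-shaped sets are specified by their radial functions. The covariogram of $K$ is $g_K(x)=\mathrm{Vol}_n(K\cap(K+x))$. For $p>0$ the radial $p$th mean body $R_pK$ is the star-shaped set with radial function $\rho_{R_pK}(\theta)=\left(p\int_0^\infty\frac{g_K(r\theta)}{\mathrm{Vol}_n(K)}r^{p-1}dr\right)^{1/p}$, $\theta\in\mathbb{S}^{n-1}$. Fourier transform: $\hat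 f(y)=\int_{\mathbb{R}^n}e^{-i\langle x,y\rangle}f(x)dx$ for integrable $f$; for a tempered distribution $T$, $\langle\hat T,\phi\rangle=\langle T,\hat\phi\rangle$ for all Schwartz $\phi$. A locally integrable function with power growth at infinity is identified with the distribution $\phi\mapsto\int f\phi$. A distribution $T$ is positive-definite if $\langle\hat T,\phi\rangle\ge0$ for every non-negative Schwartz function $\phi$. For $p>0$ the Fourier $p$th mean body $F_pK$ is the origin-symmetric star-shaped set (not necessarily compact) with radial function $\rho_{F_pK}(\theta)=\left(\frac{p}{\mathrm{Vol}_n(K)}\int_0^\infty|\widehat{\chi_K}(r\theta)|^2r^{p-1}dr\right)^{1/p}\in(0,\infty]$, $\theta\in\mathbb{S}^{n-1}$, with $\chi_K$ the indicator function of $K$. For $p\in(0,n)$ and origin-symmetric star-shaped sets $M,L\subset\mathbb{R}^n$, $L$ is called the $p$-intersection star of $M$, written $L=I_pM$, if $\rho_L^p=\frac{p}{(n-p)(2\pi)^p}\widehat{\rho_M^{\,n-p}}$ in the sense of distributions (radial functions may take the value $+\infty$). When $L$ is a star body (its radial function is finite, positive and continuous on $\mathbb{S}^{n-1}$) it is called a $p$-intersection body. *)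

(* Defs.v *)
From HB Require Import structures.
From mathcomp Require Import all_boot all_order all_algebra.
From mathcomp Require Import all_classical all_reals all_analysis.
From mathcomp Require Import complex.

Set Implicit Arguments.
Unset Strict Implicit.
Unset Printing Implicit Defensive.
Import Order.TTheory GRing.Theory Num.Theory.
Import numFieldNormedType.Exports.

Local Open Scope classical_set_scope.
Local Open Scope ring_scope.
Local Open Scope complex_scope.

(* 'rV[R]_n carries the sigma-algebra generated by the n coordinates, i.e. the
   Borel sets of R^n. *)
Fact rV_display : measure_display. Proof. by []. Qed.

Section measurable_rV.
Context {R : realType} (n : nat).

Let coor (i : 'I_n) (x : 'rV[R]_n) : measurableTypeR R := x ord0 i.

Let rV_set0 : g_sigma_preimage coor set0.
Proof. exact: sigma_algebra0. Qed.

Let rV_setC A : g_sigma_preimage coor A -> g_sigma_preimage coor (~` A).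
Proof. exact: sigma_algebraC. Qed.

Let rV_bigcup (F : (set 'rV[R]_n)^nat) : (forall i, g_sigma_preimage coor (F i)) ->
  g_sigma_preimage coor (\bigcup_i (F i)).
Proof. exact: sigma_algebra_bigcup. Qed.

HB.instance Definition _ := @isMeasurable.Build rV_display
  'rV[R]_n (g_sigma_preimage coor) rV_set0 rV_setC rV_bigcup.

Lemma measurable_coor (i : 'I_n) :
  measurable_fun [set: 'rV[R]_n] (fun x : 'rV[R]_n => x ord0 i : measurableTypeR R).
Proof.
move=> _ Y mY; rewrite setTI; apply: sub_sigma_algebra => /=.
rewrite -bigcup_seq/=; exists i => /=; first by rewrite mem_index_enum.
by exists Y => //; rewrite setTI.
Qed.

Lemma measurable_rVP d (T : measurableType d) (f : T -> 'rV[R]_n) :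
  (forall i, measurable_fun [set: T] (fun x => f x ord0 i : measurableTypeR R)) ->
  measurable_fun [set: T] f.
Proof.
move=> mf.
suff H : g_sigma_preimage (fun i => coor i \o f) `<=` measurable.
  move=> _ A mA; rewrite setTI; apply: H.
  by rewrite g_sigma_preimage_comp; exists A => //; rewrite setTI.
apply: smallest_sub; first exact: sigma_algebra_measurable.
rewrite -bigcup_seq; apply: bigcup_sub => i _.
by move=> A [B mB <-]; exact: mf.
Qed.

End measurable_rV.

Section lebesgue_step.
Context {R : realType} {n : nat}.

Definition cons_rV (p : measurableTypeR R * 'rV[R]_n) : 'rV[R]_(n.+1) :=
  row_mx p.1%:M p.2.

Lemma cons_rV0 a v : cons_rV (a, v) ord0 ord0 = a.
Proof.
transitivity ((a%:M : 'M[R]_1) ord0 ord0); last by rewrite mxE mulr1n.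
by rewrite -(row_mxEl a%:M v); congr (row_mx _ _ _ _); exact/val_inj.
Qed.

Lemma cons_rVS a v i : cons_rV (a, v) ord0 (lift ord0 i) = v ord0 i.
Proof.
by rewrite -(row_mxEr a%:M v); congr (row_mx _ _ _ _); exact/val_inj.
Qed.

Lemma measurable_cons_rV :
  measurable_fun [set: measurableTypeR R * 'rV[R]_n] cons_rV.
Proof.
apply: measurable_rVP => i; case: (unliftP ord0 i) => [j|] ->.
  apply: (eq_measurable_fun ((fun x : 'rV[R]_n => x ord0 j) \o snd)).
    by move=> [a v] _; rewrite cons_rVS.
  exact: (measurableT_comp (measurable_coor j) measurable_snd).
apply: (eq_measurable_fun fst); last exact: measurable_fst.
by move=> [a v] _; rewrite cons_rV0.
Qed.

Lemma measurable_rsub : measurable_fun [set: 'rV[R]_n.+1]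
  (fun x => @rsubmx R 1 1 n x : 'rV[R]_n).
Proof.
apply: measurable_rVP => i.
apply: (eq_measurable_fun (fun x : 'rV[R]_n.+1 => x ord0 (rshift 1 i))).
  by move=> p _; rewrite mxE.
exact: measurable_coor.
Qed.

Variable mu : {sigma_finite_measure set 'rV[R]_n -> \bar R}.

Definition lebesgue_step : set 'rV[R]_n.+1 -> \bar R :=
  pushforward (@lebesgue_measure R \x mu)%E cons_rV.

Let step0 : lebesgue_step set0 = 0%E.
Proof. by rewrite /lebesgue_step /pushforward preimage_set0 measure0. Qed.

Let step_ge0 A : (0 <= lebesgue_step A)%E.
Proof. by rewrite /lebesgue_step /pushforward; exact: measure_ge0. Qed.

Let step_sigma_additive : semi_sigma_additive lebesgue_step.
Proof.
have mc B : measurable B -> measurable (cons_rV @^-1` B).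
  by move=> mB; rewrite -[X in measurable X]setTI; exact: measurable_cons_rV.
move=> F mF tF mUF; rewrite /lebesgue_step /pushforward preimage_bigcup.
apply: measure_semi_sigma_additive => [k||].
- exact: mc.
- apply/trivIsetP => /= i j _ _ ij; rewrite -preimage_setI.
  by move/trivIsetP : tF => /(_ _ _ _ _ ij) ->//; rewrite preimage_set0.
- by rewrite -preimage_bigcup; exact: mc.
Qed.

HB.instance Definition _ := isMeasure.Build _ _ _
  lebesgue_step step0 step_ge0 step_sigma_additive.

Let step_sigma_finite : sigma_finite setT lebesgue_step.
Proof.
have /sigma_finiteP[F [TF ndF Foo]] := sigma_finiteT (@lebesgue_measure R).
have /sigma_finiteP[G [TG ndG Goo]] := sigma_finiteT mu.
pose h (x : 'rV[R]_n.+1) : measurableTypeR R * 'rV[R]_n :=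
  (x ord0 ord0, @rsubmx R 1 1 n x).
have mh : measurable_fun setT h.
  by apply/measurable_fun_pairP; split; [exact: measurable_coor|
    exact: measurable_rsub].
have hc p : h (cons_rV p) = p.
  by case: p => a v; rewrite /h cons_rV0 /cons_rV row_mxKr.
exists (fun k => h @^-1` (F k `*` G k)).
  apply/esym/seteqP; split => // x _.
  have [k1 _ F1] : (\bigcup_i F i) (h x).1 by rewrite -TF.
  have [k2 _ F2] : (\bigcup_i G i) (h x).2 by rewrite -TG.
  exists (maxn k1 k2) => //; split.
  - by apply: (subsetPset _ _ (ndF _ _ (leq_maxl k1 k2))).
  - by apply: (subsetPset _ _ (ndG _ _ (leq_maxr k1 k2))).
move=> k; have [? ?] := Foo k; have [? ?] := Goo k; split.
  by rewrite -[X in measurable X]setTI; apply: mh => //; exact: measurableX.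
rewrite /lebesgue_step /pushforward (_ : _ @^-1` _ = F k `*` G k).
  by rewrite product_measure1E// lte_mul_pinfty// ge0_fin_numE.
by rewrite -comp_preimage (_ : h \o cons_rV = id)//; apply/funext.
Qed.

HB.instance Definition _ := Measure_isSigmaFinite.Build _ _ _
  lebesgue_step step_sigma_finite.

End lebesgue_step.

(* Lebesgue measure on R^n (on Borel sets), see lebesgue_rV_box. *)
Fixpoint lebesgue_rV (R : realType) (n : nat) :
    {sigma_finite_measure set 'rV[R]_n -> \bar R} :=
  match n with
  | 0 => \d_(0 : 'rV[R]_0)
  | m.+1 => lebesgue_step (lebesgue_rV R m)
  end.

Lemma lebesgue_rV_box (R : realType) (n : nat)
    (A : 'I_n -> set (measurableTypeR R)) :
  (forall i, measurable (A i)) ->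
  lebesgue_rV R n [set x | forall i, A i (x ord0 i)] =
  (\prod_(i < n) (@lebesgue_measure R (A i)))%E.
Proof.
elim: n A => [A _|n IH A mA].
  rewrite big_ord0 /= diracE (_ : _ \in _)//.
  by apply/mem_set => -[].
rewrite big_ord_recl -(IH (fun i => A (lift ord0 i)))// -product_measure1E//.
- congr ((_ \x _)%E _); apply/seteqP; split => -[a v] /=.
    move=> h; split => [|i /=]; first by rewrite -(cons_rV0 a v).
    by rewrite -(cons_rVS a v).
  move=> [/= h0 h] i; case: (unliftP ord0 i) => [j|] ->.
    by rewrite cons_rVS.
  by rewrite cons_rV0.
- rewrite [X in measurable X](_ : _ = \bigcap_(i in [set: 'I_n])
      ((fun x : 'rV[R]_n => x ord0 i) @^-1` A (lift ord0 i))); last first.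
    by apply/seteqP; split => x h i //=; exact: h.
  apply: fin_bigcap_measurable => // i _.
  by rewrite -[X in measurable X]setTI; exact: measurable_coor.
Qed.

Section euclidean.
Context {R : realType} {n : nat}.
Implicit Types (x y : 'rV[R]_n) (M : set 'rV[R]_n).

Definition dotp x y : R := \sum_(i < n) x ord0 i * y ord0 i.

(* The library norm `|x| on 'rV[R]_n is the sup norm. *)
Definition enorm x : R := Num.sqrt (dotp x x).

Definition volume M : R := fine (lebesgue_rV R n M).

Definition convex_body M : Prop :=
  [/\ compact M, convex_set M & (interior M) !=set0].

Definition star_shaped M : Prop :=
  M 0 /\ forall x t, M x -> 0 <= t <= 1 -> M (t *: x).

Definition origin_symmetric M : Prop := forall x, M x -> M (- x).

Definition dilate (a : R) M : set 'rV[R]_n := [set a *: x | x in M].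

(* The value t = 0 implements sup set0 = 0, so that 0 <= radial_dir. *)
Definition radial_dir M x : \bar R :=
  ereal_sup [set t%:E | t in [set t | 0 <= t /\ M (t *: x)]].

(* Radial function extended to R^n \ {0} by homogeneity of degree -1;
   the value at 0 is the junk value 0. *)
Definition radial M x : \bar R :=
  ((enorm x)^-1%:E * radial_dir M ((enorm x)^-1 *: x))%E.

(* Star-shaped set with prescribed radial function on the unit sphere. *)
Definition star_of_radial (rho : 'rV[R]_n -> \bar R) : set 'rV[R]_n :=
  [set x | x = 0 \/ ((enorm x)%:E <= rho ((enorm x)^-1 *: x))%E].

Lemma enormZ (t : R) x : enorm (t *: x) = `|t| * enorm x.
Proof.
rewrite /enorm (_ : dotp _ _ = t ^+ 2 * dotp x x).
  by rewrite sqrtrM ?sqr_ge0// sqrtr_sqr.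
rewrite /dotp mulr_sumr; apply: eq_bigr => i _.
by rewrite !mxE expr2 mulrACA.
Qed.

Lemma enorm_eq0 x : enorm x = 0 -> x = 0.
Proof.
have dx i : true -> 0 <= x ord0 i * x ord0 i by rewrite -expr2 sqr_ge0.
move=> /eqP; rewrite sqrtr_eq0 => x0.
have /eqP : dotp x x = 0.
  by apply/eqP; rewrite eq_le x0/=; apply: sumr_ge0.
rewrite psumr_eq0// => /allP h; apply/rowP => i; rewrite mxE.
by have := h i (mem_index_enum _); rewrite /= mulf_eq0 orbb => /eqP.
Qed.

Lemma radial_star_of_radial (rho : 'rV[R]_n -> \bar R) x :
  (forall y, 0 <= rho y)%E -> x != 0 ->
  radial (star_of_radial rho) x =
  ((enorm x)^-1%:E * rho ((enorm x)^-1 *: x))%E.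
Proof.
move=> rho0 x0; rewrite /radial; congr (_ * _)%E.
have ex0 : 0 < enorm x.
  rewrite lt_neqAle sqrtr_ge0 andbT eq_sym.
  by apply: contra x0 => /eqP/enorm_eq0 ->.
set y := _ *: x.
have y1 : enorm y = 1.
  by rewrite enormZ ger0_norm ?invr_ge0 ?(ltW ex0)// mulVf ?gt_eqF.
clearbody y.
have H t : 0 <= t -> star_of_radial rho (t *: y) <-> (t%:E <= rho y)%E.
  move=> t0; rewrite /star_of_radial /= enormZ y1 mulr1 ger0_norm//.
  have [->|tn0] := eqVneq t 0.
    by rewrite scale0r; split => // _; left.
  rewrite scalerA mulVf// scale1r; split => [[/eqP|//]|]; last by right.
  rewrite scaler_eq0 (negbTE tn0)/= => /eqP y0.
  by move: y1; rewrite y0 /enorm /dotp big1 ?sqrtr0 => [/eqP|i _];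
    rewrite ?mxE ?mul0r// eq_sym oner_eq0.
apply/eqP; rewrite eq_le; apply/andP; split.
  by apply: ge_ereal_sup => _ [t [t0 /(H _ t0) ty] <-].
have := rho0 y; case E : (rho y) => [r| |] // r0.
  apply: ereal_sup_ubound; exists r => //; split; first by rewrite -lee_fin.
  by apply/H; rewrite -?lee_fin// E.
rewrite leye_eq; apply/eqP/eq_infty => r.
apply: (@le_trans _ _ (Num.max 0 r)%:E); first by rewrite lee_fin le_max lexx orbT.
apply: ereal_sup_ubound; exists (Num.max 0 r) => //.
have m0 : 0 <= Num.max 0 r by rewrite le_max lexx.
by split => //; apply/H => //; rewrite E leey.
Qed.

Definition radial_pow M (q : R) x : \bar R := (radial M x `^ q)%E.

Definition star_body M : Prop :=
  [/\ star_shaped M,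
      forall x, enorm x = 1 -> (0 < radial M x < +oo)%E &
      {within [set x | enorm x = 1], continuous (fun x => fine (radial M x))}].

End euclidean.

Section fourier.
Context {R : realType} {n : nat}.
Implicit Types (f : 'rV[R]_n -> \bar R) (phi psi : 'rV[R]_n -> R[i]).

Definition cintegral phi : R[i] :=
  \int[lebesgue_rV R n]_x complex.Re (phi x) +i* \int[lebesgue_rV R n]_x complex.Im (phi x).

Definition fourier phi (y : 'rV[R]_n) : R[i] :=
  cintegral (fun x => (cos (dotp x y) -i* sin (dotp x y)) * phi x).

Definition partials (s : seq 'I_n) (u : 'rV[R]_n -> R) : 'rV[R]_n -> R :=
  foldr (fun i g => 'D_(delta_mx ord0 i) g) u s.

Definition schwartz_real (u : 'rV[R]_n -> R) : Prop :=
  (forall s x, differentiable (partials s u) x) /\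
  (forall s (N : nat), exists C, forall x,
     (1 + enorm x) ^+ N * `|partials s u x| <= C).

Definition schwartz phi : Prop :=
  schwartz_real (fun x => complex.Re (phi x)) /\ schwartz_real (fun x => complex.Im (phi x)).

Definition functional : Type := ('rV[R]_n -> R[i]) -> R[i].

(* Linearity and continuity on the Schwartz space: |T phi| <= C B whenever B
   bounds the seminorms of phi of order at most N. *)
Definition tempered_distribution (T : functional) : Prop :=
  (forall (a : R[i]) phi psi, schwartz phi -> schwartz psi ->
     T (fun x => a * phi x + psi x) = a * T phi + T psi) /\
  (exists (N : nat) (C : R), forall phi (B : R), schwartz phi ->
     (forall s x, (size s <= N)%N ->
        (1 + enorm x) ^+ N * (`|partials s (fun x => complex.Re (phi x)) x| +
                              `|partials s (fun x => complex.Im (phi x)) x|) <= B) ->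
     Normc.normc (T phi) <= C * B).

Definition distr_eq (T U : functional) : Prop :=
  forall phi, schwartz phi -> T phi = U phi.

Definition distr_scale (c : R) (T : functional) : functional :=
  fun phi => c%:C * T phi.

Definition distr_fourier (T : functional) : functional :=
  fun phi => T (fourier phi).

(* On R[i], 0 <= z means that z is real and nonnegative. *)
Definition positive_definite (T : functional) : Prop :=
  tempered_distribution T /\
  forall phi, schwartz phi -> (forall x, 0 <= phi x) ->
    0 <= distr_fourier T phi.

(* Measurable, locally integrable and of power growth at infinity. The growth
   condition is in the mean: the functions considered here may be +oo along
   whole rays. It makes f * phi integrable for every Schwartz phi. *)
Definition tempered_fun f : Prop :=
  exists N : nat, (lebesgue_rV R n).-integrable setT
    (fun x => f x * ((1 + enorm x) ^- N)%:E)%E.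

Definition distr_of f : functional := fun phi =>
  fine (\int[lebesgue_rV R n]_x (f x * (complex.Re (phi x))%:E)%E) +i*
  fine (\int[lebesgue_rV R n]_x (f x * (complex.Im (phi x))%:E)%E).

End fourier.

Section bodies.
Context {R : realType} {n : nat}.
Implicit Types (K M L : set 'rV[R]_n) (p : R).

Definition covariogram K (x : 'rV[R]_n) : R :=
  volume (K `&` [set y + x | y in K]).

Definition radial_mean_body p K : set 'rV[R]_n := star_of_radial (fun theta =>
  (p%:E * \int[@lebesgue_measure R]_(r in `]0%R, +oo[)
     (covariogram K (r *: theta) / volume K * r `^ (p - 1))%:E) `^ p^-1)%E.

Definition fourier_mean_body p K : set 'rV[R]_n := star_of_radial (fun theta =>
  ((p / volume K)%:E * \int[@lebesgue_measure R]_(r in `]0%R, +oo[)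
     (Normc.normc (fourier (fun x => (\1_K x)%:C) (r *: theta)) ^+ 2
        * r `^ (p - 1))%:E) `^ p^-1)%E.

(* L = I_p M *)
Definition intersection_star p M L : Prop :=
  [/\ star_shaped M /\ origin_symmetric M,
      star_shaped L /\ origin_symmetric L,
      tempered_fun (radial_pow M (n%:R - p)),
      tempered_fun (radial_pow L p) &
      distr_eq (distr_of (radial_pow L p))
        (distr_scale (p / ((n%:R - p) * (2 * pi) `^ p))
           (distr_fourier (distr_of (radial_pow M (n%:R - p)))))].

Definition is_intersection_star p L : Prop := exists M, intersection_star p M L.

Definition is_intersection_body p L : Prop :=
  star_body L /\ is_intersection_star p L.

End bodies.

(* Main.v *)
(* Write mellin p G x for the integral of G (r x) r^(p-1) dr over (0, oo), which is
   homogeneous of degree -p; up to constants the p-th power of the radial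
   function of R_p K is mellin p g, with g the covariogram of K, and that of F_p K is
   mellin p h, with h = |FT(chi_K)|^2 = FT(g), by the Wiener-Khinchin identity.
   For a Schwartz function u, the substitution r -> 1/r and Fubini give
     int mellin p g * FT(u) = int_0^oo s^(-p-1) (int g (x / s) FT(u)(x) dx) ds
                            = int_0^oo s^(n-p-1) (int h (s y) u y dy) ds
                            = int mellin (n-p) h * u
   by Plancherel's multiplication formula at each scale s. Exchanging g and h uses
   Fourier inversion, since FT(h) = (2 pi)^n g; as g and h are even, only cosine
   transforms matter.
   Absolute convergence comes from the decay of u and FT(u), bounded by multiples of
   cauchy x = prod_i 1 / (1 + x_i^2), and from the boundedness and integrability of
   g and h. Nonnegativity of h and g then gives positive-definiteness. *)

From HB Require Import structures.
Require Import Defs.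
From mathcomp Require Import all_boot all_order all_algebra.
From mathcomp Require Import all_classical all_reals all_analysis.
From mathcomp Require Import measurable_realfun complex ring lra.
Import Order.TTheory GRing.Theory Num.Theory.
Import numFieldNormedType.Exports.
Local Open Scope classical_set_scope.
Local Open Scope ring_scope.

Set Implicit Arguments.
Unset Strict Implicit.
Unset Printing Implicit Defensive.

(** * Fubini and changes of variables *)

(** The triple integral over the scale s and over x and y does not converge absolutely: in absolute
    value it contains s^(n-p-1) over the whole half line. Hence the multiplication formula is proved
    at each fixed scale, where Fubini applies, and only then integrated in s. Convergence in s is
    where 0 < p < n enters: boundedness controls small radii, integrability large ones.
    Integrability of h is the delicate point; it is extracted from h >= 0 by Abel means. [laplace]
    and [cauchy] form an explicit Fourier pair of products over coordinates. This pair drives the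
    inversion formula and the Abel means, and reduces both to one-dimensional integrals. Radial
    functions may be infinite along rays, so [mellin] takes values in [\bar R], and finiteness is
    recovered almost everywhere. The duality is stated for an abstract pair (G, H) with a constant
    k. The triples (g, h, 1) and (h, g, (2 pi)^n) give the two transform formulas; the same triples
    at exponent n - p give the intersection stars, after the constants c, c' and d are matched. *)

Section affine_line.
Context {R : realType}.
Local Notation mu := (@lebesgue_measure R).
Implicit Types (f : measurableTypeR R -> \bar R) (a b : R).

Lemma measurable_affine a b : measurable_fun [set: measurableTypeR R]
  (fun x : measurableTypeR R => a * x + b : measurableTypeR R).
Proof. by apply: measurable_funD => //; exact: measurable_funM. Qed.

(** Uniqueness of Lebesgue measure: the right-hand side is a measure in [A] that gives each
    half-open interval its length. *)
Lemma lebesgue_measure_affine a b : 0 < a -> forall A, measurable A ->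
  mu A = (a%:E * mu ((fun x : measurableTypeR R => (a * x + b)%R : measurableTypeR R) @^-1` A))%E.
Proof.
move=> a0.
pose h (x : measurableTypeR R) := a * x + b : measurableTypeR R.
have mh : measurable_fun setT h by exact: measurable_affine.
pose m := mscale (NngNum (ltW a0)) (pushforward mu h).
move=> A mA; rewrite (lebesgue_measure_unique (mu := m mh))//.
move=> _ [[c d]] _ <-.
have hcd : h @^-1` `]c, d] = `](c - b) / a, (d - b) / a]%classic.
  apply/seteqP; split => x; rewrite /h /= !in_itv/= => /andP[? ?]; apply/andP; split.
  - by rewrite ltr_pdivrMr// mulrC ltrBlDr.
  - by rewrite ler_pdivlMr// mulrC lerBrDr.
  - by rewrite -ltrBlDr mulrC -ltr_pdivrMr.
  - by rewrite -lerBrDr mulrC -ler_pdivlMr.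
rewrite [RHS](_ : _ = (a%:E * mu (h @^-1` `]c, d]))%E)// hcd.
rewrite !lebesgue_measure_itv/= !lte_fin ltr_pM2r ?invr_gt0// ltrD2r.
case: ifPn => cd; last by rewrite mule0.
by rewrite -!EFinD -EFinM; congr (_%:E); field; rewrite gt_eqF.
Qed.

Lemma ge0_integral_affine f a b : a != 0 -> measurable_fun setT f ->
  (forall x, 0 <= f x)%E ->
  (\int[mu]_x f (a * x + b)%R = `|a|^-1%:E * \int[mu]_x f x)%E.
Proof.
have pos c d (f' : measurableTypeR R -> \bar R) : 0 < c -> measurable_fun setT f' -> (forall x, 0 <= f' x)%E ->
    (\int[mu]_x f' (c * x + d)%R = c^-1%:E * \int[mu]_x f' x)%E.
  move=> c0 mf f0.
  pose h (x : measurableTypeR R) := c * x + d : measurableTypeR R.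
  have mh : measurable_fun setT h by exact: measurable_affine.
  pose m := mscale (NngNum (ltW c0)) (pushforward mu h).
  have -> : (\int[mu]_x f' x = \int[m mh]_x f' x)%E.
    by apply: eq_measure_integral => A mA _; exact: (lebesgue_measure_affine d c0 mA).
  rewrite ge0_integral_mscale// ge0_integral_pushforward//=.
  by rewrite muleA -EFinM mulVf ?gt_eqF// mul1e.
move=> a0 mf f0; have [a0'|a0'] := ltP 0 a.
  by rewrite gtr0_norm// pos.
have {a0 a0'} a0 : a < 0 by rewrite lt_neqAle a0.
rewrite ltr0_norm//.
(* A negative slope is reduced to a positive one by reflecting [f], as Lebesgue measure is invariant
   under negation. *)
have -> : (\int[mu]_x f x = \int[mu]_x f (- x)%R)%E.
  transitivity (\int[pushforward mu (-%R : _ -> measurableTypeR R)]_x f x)%E.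
    by apply: eq_measure_integral => A mA _; exact/esym/lebesgue_measureN.
  by rewrite ge0_integral_pushforward.
rewrite -(pos _ (- b) (fun x => f (- x)%R)) ?oppr_gt0//.
  by apply: eq_integral => x _; congr f; lra.
by apply: measurableT_comp => //.
Qed.

End affine_line.

Section curried_tonelli.
Local Open Scope ereal_scope.
Context d1 d2 (T1 : measurableType d1) (T2 : measurableType d2) (R : realType).
Variable m1 : {sigma_finite_measure set T1 -> \bar R}.
Variable m2 : {sigma_finite_measure set T2 -> \bar R}.
Variable f : T1 -> T2 -> \bar R.
Hypothesis mf : measurable_fun setT (fun z : T1 * T2 => f z.1 z.2).
Hypothesis f0 : forall x y, 0 <= f x y.

Lemma measurable_tonelli1 : measurable_fun setT (fun x => \int[m2]_y f x y).
Proof.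
by apply: (measurable_fun_fubini_tonelli_F (m2 := m2) (fun z => f z.1 z.2)) => // -[].
Qed.

Lemma measurable_tonelli2 : measurable_fun setT (fun y => \int[m1]_x f x y).
Proof.
by apply: (measurable_fun_fubini_tonelli_G (m1 := m1) (fun z => f z.1 z.2)) => // -[].
Qed.

Lemma tonelli : \int[m1]_x \int[m2]_y f x y = \int[m2]_y \int[m1]_x f x y.
Proof.
by rewrite (fubini_tonelli (fun z : T1 * T2 => f z.1 z.2)) => // -[].
Qed.

End curried_tonelli.

Section dominated_fubini.
Context d1 d2 (T1 : measurableType d1) (T2 : measurableType d2) (R : realType).
Variable m1 : {sigma_finite_measure set T1 -> \bar R}.
Variable m2 : {sigma_finite_measure set T2 -> \bar R}.
Variables (f : T1 -> T2 -> R) (a : T1 -> R) (b : T2 -> R).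
Hypothesis mf : measurable_fun setT (fun z : T1 * T2 => f z.1 z.2).

(** The extended integral is the difference of the integrals of the positive and negative parts,
    each measurable by Tonelli. Since [fine] is measurable, the result also covers points where the
    integral diverges. *)
Lemma measurable_Rintegral1 : measurable_fun setT (fun x => \int[m2]_y f x y).
Proof.
apply: measurableT_comp => //.
have -> : (fun x => \int[m2]_y (f x y)%:E)%E =
    (fun x => \int[m2]_y ((EFin \o f x)^\+ y) - \int[m2]_y ((EFin \o f x)^\- y))%E.
  by apply/funext => x; rewrite integralE.
have mEf : measurable_fun setT (fun z : T1 * T2 => (f z.1 z.2)%:E) by exact/measurable_EFinP.
apply: emeasurable_funB.
- apply: (measurable_tonelli1 _ (f := fun x y => (EFin \o f x)^\+ y)%E) => //.
  by apply: (eq_measurable_fun _ _ (measurable_funepos mEf)) => z _; rewrite !funeposE.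
- apply: (measurable_tonelli1 _ (f := fun x y => (EFin \o f x)^\- y)%E) => //.
  by apply: (eq_measurable_fun _ _ (measurable_funeneg mEf)) => z _; rewrite !funenegE.
Qed.

Hypotheses (ia : m1.-integrable setT (EFin \o a)) (ib : m2.-integrable setT (EFin \o b)).
Hypothesis fab : forall x y, `|f x y| <= a x * b y.

Let mf1 x : measurable_fun setT (f x).
Proof. exact: (measurable_fun_pair2 x mf). Qed.

Let mf2 y : measurable_fun setT (f^~ y).
Proof. exact: (measurable_fun_pair1 y mf). Qed.

Lemma dominated_integrable1 x : m2.-integrable setT (EFin \o f x).
Proof.
apply: (le_integrable measurableT _ _ (integrableZl measurableT (a x) ib)).
  exact/measurable_EFinP.
by move=> y _ /=; rewrite lee_fin (le_trans (fab x y))// ler_norm.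
Qed.

Lemma dominated_integrable2 y : m1.-integrable setT (EFin \o f^~ y).
Proof.
apply: (le_integrable measurableT _ _ (integrableZl measurableT (b y) ia)).
  exact/measurable_EFinP.
by move=> x _ /=; rewrite lee_fin (le_trans (fab x y))// mulrC ler_norm.
Qed.

Lemma dominated_integrable_prod :
  (m1 \x m2)%E.-integrable setT (fun z : T1 * T2 => (f z.1 z.2)%:E).
Proof.
apply/integrable12ltyP => /=; first exact/measurable_EFinP.
(* The majorants may change sign, so their norms are used: [|f x y| <= |a x| |b y|]. *)
have ia' := integrable_norm ia.
have ib' := integrable_norm ib.
pose B := (\int[m2]_y `|b y|)%R.
apply: (@le_lt_trans _ _ (\int[m1]_x (`|a x| * B)%:E)%E).
  apply: ge0_le_integral => //=.
  - by move=> x _; apply: integral_ge0.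
  - apply: (measurable_tonelli1 _ (f := fun x y => `|f x y|%:E)%E) => //.
      exact/measurable_EFinP/measurableT_comp.
  - apply/measurable_EFinP/measurable_funM => //.
    by have /measurable_int/measurable_EFinP := ia'.
  - move=> x _; rewrite EFinM /B /Rintegral fineK ?integrable_fin_num//.
    rewrite -ge0_integralZl_EFin//; last by have /measurable_int := ib'.
    apply: ge0_le_integral => //.
    + exact/measurable_EFinP/measurableT_comp.
    + apply/measurable_EFinP/measurable_funM => //.
      by have /measurable_int/measurable_EFinP := ib'.
    + by move=> y _; rewrite -EFinM lee_fin -normrM (le_trans (fab x y))// ler_norm.
have := integrableZr measurableT B ia'.
by move=> /integrable_lty; apply.
Qed.

Lemma Rfubini : \int[m1]_x \int[m2]_y f x y = \int[m2]_y \int[m1]_x f x y.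
Proof.
congr fine; transitivity (\int[m1]_x \int[m2]_y (f x y)%:E)%E.
  apply: eq_integral => x _; rewrite /Rintegral fineK// integrable_fin_num//.
  exact: dominated_integrable1.
rewrite (Fubini dominated_integrable_prod)/=; apply: eq_integral => y _.
rewrite /Rintegral fineK// integrable_fin_num//; exact: dominated_integrable2.
Qed.

End dominated_fubini.

Section iterated.
Context {R : realType}.
Local Notation mu := (@lebesgue_measure R).

Lemma ge0_integral_rVS n (f : 'rV[R]_n.+1 -> \bar R) :
  measurable_fun setT f -> (forall x, 0 <= f x)%E ->
  (\int[lebesgue_rV R n.+1]_x f x =
   \int[mu]_a \int[lebesgue_rV R n]_v f (cons_rV (a, v)))%E.
Proof.
move=> mf f0; rewrite /= /lebesgue_step ge0_integral_pushforward//; last exact: measurable_cons_rV.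
rewrite preimage_setT (fubini_tonelli1 (f \o cons_rV))//.
  by apply: measurableT_comp => //; exact: measurable_cons_rV.
by move=> x; exact: f0.
Qed.

Lemma cons_rV_affine n (c a : R) (v : 'rV[R]_n) (b : 'rV[R]_n.+1) :
  c *: cons_rV (a, v) + b =
  cons_rV (c * a + b ord0 ord0, c *: v + (\row_i b ord0 (lift ord0 i)))%R.
Proof.
apply/rowP => i; rewrite -[0]/(ord0 : 'I_1).
have -> : (c *: cons_rV (a, v) + b) ord0 i = c * cons_rV (a, v) ord0 i + b ord0 i.
  by rewrite mxE [X in X + _]mxE.
case: (unliftP ord0 i) => [j|] ->; last by rewrite !cons_rV0.
by rewrite !cons_rVS !mxE.
Qed.

Lemma measurable_rV_affine n (c : R) (b : 'rV[R]_n) :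
  measurable_fun setT (fun x : 'rV[R]_n => c *: x + b).
Proof.
apply: measurable_rVP => i.
apply: (eq_measurable_fun (fun x : 'rV[R]_n => c * x ord0 i + b ord0 i)).
  by move=> x _; rewrite !mxE.
exact: (measurableT_comp (measurable_affine _ _) (measurable_coor i)).
Qed.

(** Induction on the dimension: each coordinate contributes one factor [|c|^-1] through the
    one-dimensional substitution. *)
Lemma ge0_integral_rV_affine n (f : 'rV[R]_n -> \bar R) (c : R) (b : 'rV[R]_n) :
  c != 0 -> measurable_fun setT f -> (forall x, 0 <= f x)%E ->
  (\int[lebesgue_rV R n]_x f (c *: x + b)%R =
   (`|c| ^- n)%:E * \int[lebesgue_rV R n]_x f x)%E.
Proof.
move=> c0; elim: n f b => [f b mf f0|n IH f b mf f0].
  rewrite expr0 invr1 mul1e; apply: eq_integral => x _; congr f.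
  by apply/rowP => -[].
have mfc : measurable_fun setT (f \o cons_rV).
  by apply: measurableT_comp => //; exact: measurable_cons_rV.
rewrite !ge0_integral_rVS//; last first.
  by apply: measurableT_comp => //; exact: measurable_rV_affine.
under eq_integral.
  move=> a _; under eq_integral do rewrite cons_rV_affine.
  rewrite (IH (fun v => f (cons_rV (c * a + b ord0 ord0, v)))%R)//; last first.
    exact: (measurableT_comp mfc (pair1_measurable _)).
  over.
have mF : measurable_fun setT (fun a => \int[lebesgue_rV R n]_v f (cons_rV (a, v)))%E.
  apply: (measurable_tonelli1 _ (f := fun a v => f (cons_rV (a, v)))) => //.
have F0 a : (0 <= \int[lebesgue_rV R n]_v f (cons_rV (a, v)))%E.
  by apply: integral_ge0 => v _; exact: f0.
rewrite ge0_integralZl_EFin; last first.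
- by rewrite invr_ge0 exprn_ge0.
- exact: (measurableT_comp mF (measurable_affine _ _)).
- by move=> a _; exact: F0.
- exact: measurableT.
rewrite (ge0_integral_affine _ c0 mF F0).
by rewrite muleA -EFinM exprSr invfM mulrC.
Qed.

End iterated.

(** Covers [+oo - +oo], where both sides are [-oo]. This lets the signed change of variables hold
    for every measurable function. *)
Lemma gt0_muleBr (R : realDomainType) (k : R) (x y : \bar R) : 0 < k ->
  (0 <= x -> 0 <= y -> k%:E * (x - y) = k%:E * x - k%:E * y)%E.
Proof.
move=> k0; have k0' : (0 < k%:E)%E by rewrite lte_fin.
case: x y => [r| |] [s| |] // _ _.
- by rewrite muleBr.
- by rewrite muleBr.
- by rewrite addye// gt0_muley// addye.
- by rewrite /= gt0_muley//= gt0_muleNy.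
Qed.

Section affine_signed.
Context {R : realType} (n : nat).
Local Notation lam := (lebesgue_rV R n).
Implicit Types (f : 'rV[R]_n -> \bar R) (u : 'rV[R]_n -> R) (b : 'rV[R]_n).

Lemma integral_rV_affine f (c : R) b : c != 0 -> measurable_fun setT f ->
  (\int[lam]_x f (c *: x + b)%R = (`|c| ^- n)%:E * \int[lam]_x f x)%E.
Proof.
move=> c0 mf; rewrite [LHS]integralE [in RHS]integralE.
have fp : (fun x => f (c *: x + b)%R)^\+%E = fun x => (f^\+%E (c *: x + b)).
  by apply/funext => x; rewrite !funeposE.
have fn : (fun x => f (c *: x + b)%R)^\-%E = fun x => (f^\-%E (c *: x + b)).
  by apply/funext => x; rewrite !funenegE.
rewrite fp fn !ge0_integral_rV_affine//; last 2 first.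
- exact: measurable_funeneg.
- exact: measurable_funepos.
by rewrite -gt0_muleBr// ?integral_ge0// invr_gt0 exprn_gt0// normr_gt0.
Qed.

Lemma integrable_rV_affine f (c : R) b : c != 0 ->
  lam.-integrable setT f -> lam.-integrable setT (fun x => f (c *: x + b)).
Proof.
move=> c0 /integrableP[mf foo]; apply/integrableP; split.
  by apply: measurableT_comp => //; exact: measurable_rV_affine.
rewrite (ge0_integral_rV_affine (f := fun x => `|f x|%E))//; last exact: measurableT_comp.
by rewrite lte_mul_pinfty// lee_fin invr_ge0 exprn_ge0.
Qed.

Lemma Rintegral_rV_affine u (c : R) b : c != 0 -> measurable_fun setT u ->
  \int[lam]_x u (c *: x + b) = `|c| ^- n * \int[lam]_x u x.
Proof.
move=> c0 mu; rewrite /Rintegral (integral_rV_affine (f := EFin \o u))//.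
  case: (\int[lam]_x (u x)%:E)%E => [r| |]//=.
    by rewrite gt0_muley ?mulr0// lte_fin invr_gt0 exprn_gt0// normr_gt0.
  by rewrite gt0_muleNy ?mulr0// lte_fin invr_gt0 exprn_gt0// normr_gt0.
exact/measurable_EFinP.
Qed.

End affine_signed.

Section measurable_rV_ops.
Context d (T : measurableType d) {R : realType} (n : nat).
Implicit Types (f g : T -> 'rV[R]_n).

Lemma measurable_coorT f i : measurable_fun setT f ->
  measurable_fun setT (fun x => f x ord0 i : measurableTypeR R).
Proof. by move=> mf; exact: (measurableT_comp (measurable_coor i) mf). Qed.

Lemma measurable_rV_scale (r : T -> R) f : measurable_fun setT r ->
  measurable_fun setT f -> measurable_fun setT (fun x => r x *: f x).
Proof.
move=> mr mf; apply: measurable_rVP => i.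
apply: (eq_measurable_fun (fun x => r x * f x ord0 i)).
  by move=> x _; rewrite mxE.
by apply: measurable_funM => //; exact: measurable_coorT.
Qed.

Lemma measurable_rV_add f g : measurable_fun setT f ->
  measurable_fun setT g -> measurable_fun setT (fun x => f x + g x).
Proof.
move=> mf mg; apply: measurable_rVP => i.
apply: (eq_measurable_fun (fun x => f x ord0 i + g x ord0 i)).
  by move=> x _; rewrite mxE.
by apply: measurable_funD; exact: measurable_coorT.
Qed.

Lemma measurable_bigsum (I : Type) (s : seq I) (h : I -> T -> R) :
  (forall i, measurable_fun setT (h i)) ->
  measurable_fun setT (fun x => \sum_(i <- s) h i x).
Proof.
move=> mh; elim: s => [|i s IH].
  by under eq_fun do rewrite big_nil; exact: measurable_cst.
by under eq_fun do rewrite big_cons; exact: measurable_funD.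
Qed.

Lemma measurable_bigprod (I : Type) (s : seq I) (h : I -> T -> R) :
  (forall i, measurable_fun setT (h i)) ->
  measurable_fun setT (fun x => \prod_(i <- s) h i x).
Proof.
move=> mh; elim: s => [|i s IH].
  by under eq_fun do rewrite big_nil; exact: measurable_cst.
by under eq_fun do rewrite big_cons; exact: measurable_funM.
Qed.

Lemma measurable_dotp f g : measurable_fun setT f -> measurable_fun setT g ->
  measurable_fun setT (fun x => dotp (f x) (g x)).
Proof.
by move=> mf mg; apply: measurable_bigsum => i; apply: measurable_funM; exact: measurable_coorT.
Qed.

End measurable_rV_ops.

Section continuous_measurable.
Context {R : realType} (n : nat).

Lemma rat_approx (x : 'rV[R]_n) (e : R) : 0 < e ->
  exists q : 'rV[rat]_n, forall i, `|x ord0 i - ratr (q ord0 i)| < e.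
Proof.
move=> e0.
have H i : exists q : rat, `|x ord0 i - ratr q| < e.
  have /rat_in_itvoo[q] : x ord0 i - e < x ord0 i + e by lra.
  rewrite in_itv/= => /andP[? ?]; exists q; rewrite ltr_norml; apply/andP; split; lra.
exists (\row_i xchoose (H i)) => i; rewrite mxE.
exact: (xchooseP (H i)).
Qed.

(** Measurability refers to the sigma-algebra of the coordinates, so an open set is written as the
    countable union of the sup-norm boxes inside it with rational centre and radius
    [1 / (k + 1)]. *)
Lemma open_measurable_rV (A : set 'rV[R]_n) : open A -> measurable A.
Proof.
move=> oA.
pose B (p : 'rV[rat]_n * nat) : set 'rV[R]_n :=
  [set x | forall i, `|x ord0 i - ratr (p.1 ord0 i)| < p.2.+1%:R^-1].
have mB p : measurable (B p).
  rewrite (_ : B p = \bigcap_(i in [set: 'I_n])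
      ((fun x : 'rV[R]_n => x ord0 i) @^-1` (ball (ratr (p.1 ord0 i) : R) p.2.+1%:R^-1))); last first.
    apply/seteqP; split => x h i //=; first by move=> _; rewrite /ball/= distrC; exact: h.
    by move: (h i I); rewrite /ball/= distrC.
  apply: fin_bigcap_measurable => // i _; rewrite -[X in measurable X]setTI.
  by apply: measurable_coor => //; exact: measurable_ball.
rewrite (_ : A = \bigcup_p (if `[< B p `<=` A >] then B p else set0)); last first.
  apply/seteqP; split => [x Ax|x [p _]]; last by case: asboolP => // pA; exact: pA.
  have /nbhs_ballP[e /= e0 eA] := open_nbhs_nbhs (conj oA Ax).
  have [k ke] : exists k, k.+1%:R^-1 < e / 2.
    have [k hk] := ltr_add_invr (y := 0) (x := e / 2) (divr_gt0 e0 (ltr0n _ 2)).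
    by exists k; rewrite add0r in hk.
  have k1 : 0 < k.+1%:R^-1 :> R by rewrite invr_gt0.
  have [q xq] := rat_approx x k1.
  exists (q, k) => //; rewrite asboolT// => y yq; apply: eA; split=> // i j; rewrite (ord1 i) -[0]/(ord0 : 'I_1) /ball/=.
  apply: (le_lt_trans (ler_distD (ratr (q ord0 j)) _ _)).
  rewrite (splitr e) ltrD//; apply: (lt_trans _ ke) => //.
  by rewrite distrC; exact: yq.
by apply: countable_bigcupT_measurable => // p; case: ifP.
Qed.

Lemma continuous_measurable_rV (u : 'rV[R]_n -> R) : continuous u -> measurable_fun setT u.
Proof.
move=> cu; apply: (measurability _ (RGenOpens.measurableE R)) => //.
move=> _ [_ [a [b ->] <-]]; rewrite setTI; apply: open_measurable_rV.
by apply: open_comp => [x _|]; [exact: cu|exact: interval_open].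
Qed.

End continuous_measurable.

(** * Cosine transforms and Fourier inversion *)

Section kernels_line.
Context {R : realType}.
Local Notation mu := (@lebesgue_measure R).

Lemma integral_oneDsqrV : (\int[mu]_x ((1 + x ^+ 2)^-1)%:E = (pi : R)%:E)%E.
Proof.
rewrite (ge0_symfun_integralT (f := fun x : R => (1 + x ^+ 2)^-1)).
- rewrite -set_itvcy; have := @integral0y_oneDsqr R; rewrite /oneDsqr => ->.
  by rewrite -EFinM; congr EFin; field.
- by move=> x; rewrite invr_ge0 addr_ge0// sqr_ge0.
- exact: continuous_oneDsqrV.
- by move=> x /=; rewrite sqrrN.
Qed.

Lemma continuous_oneDcos (w : R) : continuous (fun x : R => 1 + cos (w * x)).
Proof.
move=> x; apply: cvgD; first exact: cvg_cst.
apply: (continuous_comp (f := fun x => w * x)); last exact: continuous_cos.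
by apply: cvgM; [exact: cvg_cst|exact: cvg_id].
Qed.

Lemma continuous_expRNnorm : continuous (fun x : R => expR (- `|x|)).
Proof.
move=> x; apply: (continuous_comp (f := fun x : R => - `|x|)); last exact: continuous_expR.
by apply: cvgN; exact: norm_continuous.
Qed.

(** Adding 1 to the cosine makes the integrand nonnegative, so the fundamental theorem of calculus
    on a half line applies to the explicit primitive [F]. *)
Lemma integral0y_oneDcos_expRN (w : R) :
  (\int[mu]_(x in `[0%R, +oo[) ((1 + cos (w * x)) * expR (- x))%:E =
   (1 + (1 + w ^+ 2)^-1)%:E)%E.
Proof.
pose F (x : R) := - expR (- x) + expR (- x) * (w * sin (w * x) - cos (w * x)) / (1 + w ^+ 2).
have w0 : 1 + w ^+ 2 != 0 by rewrite gt_eqF// ltr_pwDl// sqr_ge0.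
have dF (x : R) : is_derive x 1 F ((1 + cos (w * x)) * expR (- x)).
  apply: is_derive_eq; rewrite /GRing.scale /=.
  by field.
have cf : continuous (fun x : R => (1 + cos (w * x)) * expR (- x)).
  move=> x; apply: cvgM; first exact: continuous_oneDcos.
  apply: (continuous_comp (f := fun x => - x)); last exact: continuous_expR.
  exact: cvgN.
rewrite (ge0_continuous_FTC2y (F := F) (l := 0)).
- rewrite /F mulr0 sin0 cos0 mulr0 oppr0 expR0 -EFinB; congr EFin.
  by field.
- by move=> x _; rewrite mulr_ge0 ?expR_ge0// -lerBlDl sub0r; exact: cos_geN1.
- by apply: continuous_subspaceT.
- apply/cvgrPdist_le => /= e e0.
  have := @cvgr_expR R; move/cvgrPdist_le => /(_ (e / (2 + `|w|))).
  have k0 : 0 < 2 + `|w| by rewrite ltr_pwDl.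
  move=> /(_ (divr_gt0 e0 k0)); apply: filterS => x.
  rewrite !sub0r !normrN (ger0_norm (expR_ge0 _)) ler_pdivlMr// => h.
  apply: (le_trans _ h); have -> : F x = expR (- x) * (-1 + (w * sin (w * x) - cos (w * x)) / (1 + w ^+ 2)).
    by rewrite /F; field.
  rewrite normrM (ger0_norm (expR_ge0 _)) ler_wpM2l ?expR_ge0//.
  rewrite (le_trans (ler_normD _ _))// normrN normr1 -addrA lerD2l.
  rewrite normrM normfV (ger0_norm (_ : 0 <= 1 + w ^+ 2)) ?addr_ge0 ?sqr_ge0//.
  rewrite ler_pdivrMr ?ltr_pwDl ?sqr_ge0//.
  apply: (@le_trans _ _ (1 + `|w|)); last by rewrite ler_peMr ?addr_ge0// lerDl sqr_ge0.
  rewrite (le_trans (ler_normB _ _))// addrC lerD ?cos_max// normrM.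
  by rewrite ler_piMr// sin_max.
- by move=> x _; apply: ex_derive.
- apply: cvg_at_right_filter; apply: differentiable_continuous.
  exact/derivable1_diffP/ex_derive.
- by move=> x _; rewrite derive1E derive_val.
Qed.

Lemma integral_oneDcos_expRNnorm (w : R) :
  (\int[mu]_x ((1 + cos (w * x)) * expR (- `|x|))%:E = (2 * (1 + (1 + w ^+ 2)^-1))%:E)%E.
Proof.
rewrite (ge0_symfun_integralT (f := fun x : R => (1 + cos (w * x)) * expR (- `|x|))).
- rewrite -set_itvcy EFinM -integral0y_oneDcos_expRN; congr (_ * _)%E.
  by apply: eq_integral => x; rewrite inE/= in_itv/= andbT => x0; rewrite ger0_norm.
- by move=> x; rewrite mulr_ge0 ?expR_ge0// -lerBlDl sub0r; exact: cos_geN1.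
- by move=> x; apply: cvgM; [exact: continuous_oneDcos|exact: continuous_expRNnorm].
- by move=> x /=; rewrite mulrN cosN normrN.
Qed.

(** Dominated by the case [w = 0] of the preceding integral, whose value is finite. *)
Lemma integrable_expRNnorm : mu.-integrable setT (EFin \o (fun x : R => expR (- `|x|))).
Proof.
have me : measurable_fun setT (fun x : R => expR (- `|x|)).
  by apply: measurableT_comp => //; exact: measurable_funN.
apply/integrableP; split; first exact/measurable_EFinP.
apply: (@le_lt_trans _ _ (\int[mu]_x ((1 + cos (0 * x)) * expR (- `|x|))%:E)%E).
  apply: ge0_le_integral => //.
  - by apply/measurable_EFinP; exact: measurableT_comp.
  - apply/measurable_EFinP; apply: measurable_funM => //.
    by under eq_fun do rewrite mul0r cos0; exact: measurable_cst.
  - move=> x _ /=; rewrite lee_fin mul0r cos0 ger0_norm ?expR_ge0//.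
    by rewrite ler_peMl ?expR_ge0// lerDl.
by rewrite integral_oneDcos_expRNnorm ltry.
Qed.

Lemma measurable_cosMl (w : R) : measurable_fun setT (fun x : measurableTypeR R => cos (w * x)).
Proof.
apply: (measurableT_comp (f := @cos R)); last exact: measurable_funM.
by apply: continuous_measurable_fun; exact: continuous_cos.
Qed.

(** The integral with [1 + cos] at [w = 0] gives 2 for the mass of [expR (- |x|)]; subtracting this
    mass at a general [w] leaves the cosine part. *)
Lemma Rintegral_cos_expRNnorm (w : R) :
  \int[mu]_x (cos (w * x) * expR (- `|x|)) = 2 / (1 + w ^+ 2).
Proof.
have ie := integrable_expRNnorm.
have ic w' : mu.-integrable setT (EFin \o (fun x : R => cos (w' * x) * expR (- `|x|))).
  apply: (le_integrable measurableT _ _ ie).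
    apply/measurable_EFinP/measurable_funM; first exact: measurable_cosMl.
    by have /measurable_int/measurable_EFinP := ie.
  by move=> x _ /=; rewrite lee_fin normrM ler_piMl// cos_max.
have sum w' : \int[mu]_x expR (- `|x|) + \int[mu]_x (cos (w' * x) * expR (- `|x|)) =
    2 * (1 + (1 + w' ^+ 2)^-1).
  rewrite -RintegralD// -[RHS]/(fine (_ %:E)) -integral_oneDcos_expRNnorm /Rintegral.
  by congr fine; apply: eq_integral => x _; rewrite mulrDl mul1r.
have s0 : \int[mu]_x expR (- `|x|) = 2.
  have := sum 0.
  under [X in _ + X]eq_Rintegral do rewrite mul0r cos0 mul1r.
  by rewrite expr0n/= addr0 invr1; lra.
by have := sum w; rewrite s0 mulrDr mulr1 => /addrI.
Qed.

End kernels_line.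

Section kernels_space.
Context {R : realType}.
Local Notation mu := (@lebesgue_measure R).
Local Notation lam n := (lebesgue_rV R n).

Lemma Rintegral_rVS n (f : 'rV[R]_n.+1 -> R) (a : measurableTypeR R -> R) (b : 'rV[R]_n -> R) :
  measurable_fun setT f ->
  mu.-integrable setT (EFin \o a) -> (lam n).-integrable setT (EFin \o b) ->
  (forall s v, `|f (cons_rV (s, v))| <= a s * b v) ->
  \int[lam n.+1]_x f x = \int[mu]_s \int[lam n]_v f (cons_rV (s, v)).
Proof.
move=> mf ia ib fab.
have mfc : measurable_fun setT (fun z : measurableTypeR R * 'rV[R]_n => f (cons_rV (z.1, z.2))).
  have := measurableT_comp mf (@measurable_cons_rV R n).
  by apply: eq_measurable_fun => -[].
have iprod := dominated_integrable_prod mfc ia ib fab.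
rewrite /Rintegral /= /lebesgue_step.
rewrite (integral_pushforward (f := EFin \o f) (@measurable_cons_rV R n)) //; last exact/measurable_EFinP.
rewrite preimage_setT; congr fine.
transitivity (\int[(mu \x lam n)%E]_z (f (cons_rV (z.1, z.2)))%:E)%E.
  by apply: eq_integral => -[].
rewrite -(integral12_prod_meas1 iprod); apply: eq_integral => s _ /=.
rewrite fineK// integrable_fin_num//.
exact: (dominated_integrable1 mfc ib fab).
Qed.

(** Positive and negative parts have equal integrals by reflection. If both are [+oo], the
    difference is [-oo], which [fine] sends to 0 as well. *)
Lemma fine_integral_odd n (f : 'rV[R]_n -> \bar R) : measurable_fun setT f ->
  (forall x, f (- x)%R = - f x)%E -> fine (\int[lam n]_x f x)%E = 0.
Proof.
move=> mf fN.
have n10 : -1 != 0 :> R by rewrite oppr_eq0 oner_eq0.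
have pn : (\int[lam n]_x f^\+ x = \int[lam n]_x f^\- x)%E.
  have := ge0_integral_rV_affine 0 n10 (measurable_funepos mf) (funepos_ge0 f).
  rewrite normrN1 expr1n invr1 mul1e => <-; apply: eq_integral => x _.
  by rewrite addr0 scaleN1r funeposE funenegE fN.
by rewrite integralE pn; case: (\int[lam n]_x f^\- x)%E => //= r; rewrite subrr.
Qed.

Lemma Rintegral_odd n (u : 'rV[R]_n -> R) : measurable_fun setT u ->
  (forall x, u (- x) = - u x) -> \int[lam n]_x u x = 0.
Proof.
move=> mu uN; apply: fine_integral_odd; first exact/measurable_EFinP.
by move=> x; rewrite uN.
Qed.

Definition prod_rV (phi : R -> R) n (x : 'rV[R]_n) := \prod_(i < n) phi (x ord0 i).

Arguments prod_rV phi {n} x.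

Lemma prod_rVS phi n a (v : 'rV[R]_n) :
  prod_rV phi (cons_rV (a, v)) = phi a * prod_rV phi v.
Proof.
rewrite /prod_rV big_ord_recl cons_rV0; congr (_ * _).
by apply: eq_bigr => i _; rewrite cons_rVS.
Qed.

Lemma prod_rV_ge0 phi n (x : 'rV[R]_n) : (forall t, 0 <= phi t) -> 0 <= prod_rV phi x.
Proof. by move=> p0; apply: prodr_ge0. Qed.

Lemma prod_rV_gt0 phi n (x : 'rV[R]_n) : (forall t, 0 < phi t) -> 0 < prod_rV phi x.
Proof. by move=> p0; apply: prodr_gt0. Qed.

Lemma prod_rV_le1 phi n (x : 'rV[R]_n) : (forall t, 0 <= phi t <= 1) -> prod_rV phi x <= 1.
Proof. by move=> p0; apply: prodr_ile1. Qed.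

Lemma measurable_prod_rV (phi : R -> R) n : measurable_fun setT phi ->
  measurable_fun setT (prod_rV phi : 'rV[R]_n -> R).
Proof.
move=> mphi; apply: measurable_bigprod => i.
exact: (measurableT_comp mphi (measurable_coor i)).
Qed.

Lemma integral_prod_rV (phi : R -> R) n I : measurable_fun setT phi -> (forall t, 0 <= phi t) ->
  (\int[mu]_t (phi t)%:E = I%:E)%E -> (\int[lam n]_x (prod_rV phi x)%:E = (I ^+ n)%:E)%E.
Proof.
move=> mphi phi0 phiI; elim: n => [|n IH].
  rewrite /= integral_dirac//; last by apply/measurable_EFinP; exact: measurable_prod_rV.
  by rewrite diracT mul1e /prod_rV big_ord0 expr0.
rewrite ge0_integral_rVS//; last 2 first.
- by apply/measurable_EFinP; exact: measurable_prod_rV.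
- by move=> x; rewrite lee_fin prod_rV_ge0.
under eq_integral.
  move=> a _; under eq_integral do rewrite prod_rVS EFinM.
  rewrite ge0_integralZl_EFin//; last 2 first.
  - by move=> x _; rewrite lee_fin prod_rV_ge0.
  - by apply/measurable_EFinP; exact: measurable_prod_rV.
  rewrite IH; over.
rewrite ge0_integralZr//; last 3 first.
- exact/measurable_EFinP.
- by move=> t _; rewrite lee_fin.
- by rewrite -IH; apply: integral_ge0 => x _; rewrite lee_fin prod_rV_ge0.
by rewrite phiI -EFinM exprS.
Qed.

Lemma integrable_prod_rV (phi : R -> R) n I : measurable_fun setT phi -> (forall t, 0 <= phi t) ->
  (\int[mu]_t (phi t)%:E = I%:E)%E ->
  (lam n).-integrable setT (EFin \o (prod_rV phi : 'rV[R]_n -> R)).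
Proof.
move=> mphi phi0 phiI; apply/integrableP; split; first by apply/measurable_EFinP; exact: measurable_prod_rV.
under eq_integral do rewrite gee0_abs ?lee_fin ?prod_rV_ge0//.
by rewrite (integral_prod_rV _ mphi phi0 phiI) ltry.
Qed.

Definition cauchy1 (t : R) := (1 + t ^+ 2)^-1.
(** The universal majorant. A product over coordinates, rather than a radial weight, makes its mass
    [pi ^+ n] and makes it, up to [2 ^+ n], the cosine transform of [laplace]. *)
Definition cauchy n : 'rV[R]_n -> R := prod_rV cauchy1.
Definition laplace n : 'rV[R]_n -> R := prod_rV (fun t => expR (- `|t|)).

Lemma cauchy1_gt0 t : 0 < cauchy1 t.
Proof. by rewrite invr_gt0 ltr_pwDl// sqr_ge0. Qed.

Lemma cauchy1_le1 t : cauchy1 t <= 1.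
Proof. by rewrite invf_le1 ?ltr_pwDl// ?sqr_ge0// lerDl sqr_ge0. Qed.

Lemma measurable_cauchy1 : measurable_fun setT cauchy1.
Proof. by apply: continuous_measurable_fun; exact: continuous_oneDsqrV. Qed.

Lemma cauchy_gt0 n (x : 'rV[R]_n) : 0 < cauchy x.
Proof. by apply: prod_rV_gt0 => t; exact: cauchy1_gt0. Qed.

Lemma cauchy_le1 n (x : 'rV[R]_n) : cauchy x <= 1.
Proof. by apply: prod_rV_le1 => t; rewrite ltW ?cauchy1_gt0//= cauchy1_le1. Qed.

Lemma measurable_cauchy n : measurable_fun setT (@cauchy n).
Proof. by apply: measurable_prod_rV; exact: measurable_cauchy1. Qed.

Lemma integral_cauchy n : (\int[lam n]_x (cauchy x)%:E = (pi ^+ n)%:E)%E.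
Proof.
apply: integral_prod_rV; last exact: integral_oneDsqrV.
  exact: measurable_cauchy1.
by move=> t; rewrite ltW// cauchy1_gt0.
Qed.

Lemma integrable_cauchy n : (lam n).-integrable setT (EFin \o @cauchy n).
Proof.
apply: integrable_prod_rV; last exact: integral_oneDsqrV.
  exact: measurable_cauchy1.
by move=> t; rewrite ltW// cauchy1_gt0.
Qed.

Lemma measurable_expRNnorm : measurable_fun setT (fun t : R => expR (- `|t|)).
Proof. by apply: continuous_measurable_fun; exact: continuous_expRNnorm. Qed.

Lemma integrable_laplace n : (lam n).-integrable setT (EFin \o @laplace n).
Proof.
apply: (@integrable_prod_rV _ n (\int[mu]_t (expR (- `|t|)))).
- exact: measurable_expRNnorm.
- by move=> t; exact: expR_ge0.
- by rewrite fineK// integrable_fin_num//; exact: integrable_expRNnorm.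
Qed.

Lemma laplace_gt0 n (x : 'rV[R]_n) : 0 < laplace x.
Proof. by apply: prod_rV_gt0 => t; exact: expR_gt0. Qed.

Lemma laplace_le1 n (x : 'rV[R]_n) : laplace x <= 1.
Proof. by apply: prod_rV_le1 => t; rewrite expR_ge0//= -expR0 ler_expR oppr_le0. Qed.

Lemma measurable_laplace n : measurable_fun setT (@laplace n).
Proof. by apply: measurable_prod_rV; exact: measurable_expRNnorm. Qed.

Lemma measurable_cos : measurable_fun setT (@cos R).
Proof. by apply: continuous_measurable_fun; exact: continuous_cos. Qed.

Lemma measurable_sin : measurable_fun setT (@sin R).
Proof. by apply: continuous_measurable_fun; exact: continuous_sin. Qed.

(** For real [u] the Fourier transform is [cosT u - i sinT u], so these two real transforms carry
    all the analysis. *)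
Definition cosT n (u : 'rV[R]_n -> R) (x : 'rV[R]_n) : R := \int[lam n]_y (cos (dotp x y) * u y).
Definition sinT n (u : 'rV[R]_n -> R) (x : 'rV[R]_n) : R := \int[lam n]_y (sin (dotp x y) * u y).

Lemma dotp_cons n (x : 'rV[R]_n.+1) a (v : 'rV[R]_n) : dotp x (cons_rV (a, v)) =
  x ord0 ord0 * a + dotp (\row_i x ord0 (lift ord0 i)) v.
Proof.
rewrite /dotp big_ord_recl cons_rV0; congr (_ + _).
by apply: eq_bigr => i _; rewrite cons_rVS mxE.
Qed.

Lemma dotpC n (x y : 'rV[R]_n) : dotp x y = dotp y x.
Proof. by apply: eq_bigr => i _; rewrite mulrC. Qed.

Lemma dotpDr n (x y z : 'rV[R]_n) : dotp x (y + z) = dotp x y + dotp x z.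
Proof. by rewrite /dotp -big_split/=; apply: eq_bigr => i _; rewrite mxE mulrDr. Qed.

Lemma dotpZr n a (x y : 'rV[R]_n) : dotp x (a *: y) = a * dotp x y.
Proof. by rewrite /dotp mulr_sumr; apply: eq_bigr => i _; rewrite mxE mulrCA. Qed.

Lemma dotpZl n a (x y : 'rV[R]_n) : dotp (a *: x) y = a * dotp x y.
Proof. by rewrite dotpC dotpZr dotpC. Qed.

Lemma dotpNr n (x y : 'rV[R]_n) : dotp x (- y) = - dotp x y.
Proof. by rewrite -scaleN1r dotpZr mulN1r. Qed.

Lemma measurable_cos_dotp n (x : 'rV[R]_n) : measurable_fun setT (fun y => cos (dotp x y)).
Proof. by apply: (measurableT_comp measurable_cos); exact: measurable_dotp. Qed.

Lemma measurable_sin_dotp n (x : 'rV[R]_n) : measurable_fun setT (fun y => sin (dotp x y)).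
Proof. by apply: (measurableT_comp measurable_sin); exact: measurable_dotp. Qed.

Lemma integrable_bddM n (f u : 'rV[R]_n -> R) : measurable_fun setT f ->
  (forall x, `|f x| <= 1) -> (lam n).-integrable setT (EFin \o u) ->
  (lam n).-integrable setT (fun x => (f x * u x)%:E).
Proof.
move=> mf f1 iu; apply: (le_integrable measurableT _ _ iu).
  apply/measurable_EFinP/measurable_funM => //.
  by have /measurable_int/measurable_EFinP := iu.
by move=> x _ /=; rewrite lee_fin normrM ler_piMl.
Qed.

Lemma laplaceN n (x : 'rV[R]_n) : laplace (- x) = laplace x.
Proof. by apply: eq_bigr => i _; rewrite mxE normrN. Qed.

Lemma laplaceS n a (v : 'rV[R]_n) : laplace (cons_rV (a, v)) = expR (- `|a|) * laplace v.
Proof. exact: prod_rVS. Qed.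

(** The first coordinate is split off by the addition formula for the cosine. The sine term vanishes
    because [laplace] is even, and each coordinate contributes [2 / (1 + x_i ^+ 2)]. *)
Lemma cosT_laplace n (x : 'rV[R]_n) : cosT (@laplace n) x = 2 ^+ n * cauchy x.
Proof.
elim: n x => [x|n IH x].
  rewrite /cosT /Rintegral /= integral_dirac//; last first.
    apply/measurable_EFinP/measurable_funM; first exact: measurable_cos_dotp.
    exact: measurable_laplace.
  by rewrite diracT mul1e /= /dotp big_ord0 cos0 /cauchy /laplace /prod_rV !big_ord0.
have il := @integrable_laplace n.
rewrite /cosT (Rintegral_rVS (a := fun t => expR (- `|t|)) (b := @laplace n))//; last 3 first.
- apply: measurable_funM; first exact: measurable_cos_dotp.
  exact: measurable_laplace.
- exact: integrable_expRNnorm.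
- move=> s v; rewrite normrM laplaceS.
  rewrite (ger0_norm (_ : 0 <= _ * laplace v)) ?mulr_ge0 ?expR_ge0 ?(ltW (laplace_gt0 _))//.
  by rewrite ler_piMl ?mulr_ge0 ?expR_ge0 ?(ltW (laplace_gt0 _))// cos_max.
pose x' : 'rV[R]_n := \row_i x ord0 (lift ord0 i).
under eq_Rintegral.
  move=> s _; rewrite (_ : \int[_]_v _ = cos (x ord0 ord0 * s) * expR (- `|s|) * cosT (@laplace n) x').
    over.
  transitivity (\int[lam n]_v (cos (x ord0 ord0 * s) * expR (- `|s|) * (cos (dotp x' v) * laplace v) -
     sin (x ord0 ord0 * s) * expR (- `|s|) * (sin (dotp x' v) * laplace v))).
    apply: eq_Rintegral => v _; rewrite dotp_cons cosD laplaceS.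
    by rewrite -/x'; ring.
  have ic : (lam n).-integrable setT (fun v => (cos (dotp x' v) * laplace v)%:E).
    by apply: integrable_bddM => //; [exact: measurable_cos_dotp|move=> ?; exact: cos_max].
  have is_ : (lam n).-integrable setT (fun v => (sin (dotp x' v) * laplace v)%:E).
    by apply: integrable_bddM => //; [exact: measurable_sin_dotp|move=> ?; exact: sin_max].
  rewrite RintegralB//; last 2 first.
  - exact: (integrableZl measurableT _ ic).
  - exact: (integrableZl measurableT _ is_).
  rewrite RintegralZl// RintegralZl//.
  rewrite [X in _ - _ * X](Rintegral_odd _) ?mulr0 ?subr0//.
  - by have /measurable_int/measurable_EFinP := is_.
  - by move=> v; rewrite dotpNr sinN laplaceN mulNr.
rewrite RintegralZr//; last first.
  apply: (le_integrable measurableT _ _ (integrable_expRNnorm (R := R))).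
    apply/measurable_EFinP/measurable_funM; first exact: measurable_cosMl.
    exact: measurable_expRNnorm.
  by move=> s _ /=; rewrite lee_fin normrM ler_piMl// cos_max.
rewrite Rintegral_cos_expRNnorm IH [2 ^+ n.+1]exprS mulrACA; congr (_ * _).
rewrite /cauchy [in RHS]/prod_rV big_ord_recl; congr (_ * _).
by apply: eq_bigr => i _; rewrite mxE.
Qed.

End kernels_space.

(** Convergence is asked almost everywhere only: for the continuity of the covariogram, the
    integrands may fail to converge on a translate of the boundary of K. *)
Lemma Rintegral_dominated_cvg d (T : measurableType d) (R : realType)
    (m : {measure set T -> \bar R}) (f_ : nat -> T -> R) (f g : T -> R) :
  (forall k, measurable_fun setT (f_ k)) -> measurable_fun setT f ->
  {ae m, forall x, f_ ^~ x @ \oo --> f x} -> m.-integrable setT (EFin \o g) ->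
  (forall k x, `|f_ k x| <= g x) ->
  \int[m]_x f_ k x @[k --> \oo] --> \int[m]_x f x.
Proof.
move=> mf_ mf ff ig fg.
have [] := @dominated_convergence _ _ _ m _ measurableT (fun k => EFin \o f_ k)
  (EFin \o f) (EFin \o g).
- by move=> k; exact/measurable_EFinP.
- exact/measurable_EFinP.
- move: ff; apply: filterS => x fx _.
  by apply: cvg_EFin; [exact: nearW|exact: fx].
- exact: ig.
- by apply: aeW => x k _ /=; rewrite lee_fin.
move=> intf _ cvgf; apply: fine_cvg.
by rewrite /Rintegral fineK ?integrable_fin_num.
Qed.

(** * Fourier inversion by damping with the Laplace kernel *)

Section inversion.
Context {R : realType} (n : nat).
Local Notation lam := (lebesgue_rV R n).
Implicit Types (u : 'rV[R]_n -> R) (x y z : 'rV[R]_n).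

Lemma cvg_invS : (k.+1%:R^-1 : R) @[k --> \oo] --> (0 : R).
Proof. exact: cvg_harmonic. Qed.

Lemma laplace_cvg1 x : laplace (k.+1%:R^-1 *: x) @[k --> \oo] --> (1 : R).
Proof.
have -> : (fun k => laplace (k.+1%:R^-1 *: x)) =
    (fun k => expR (- (k.+1%:R^-1 * \sum_(i < n) `|x ord0 i|))).
  apply/funext => k; rewrite /laplace /prod_rV -expR_sum; congr expR.
  rewrite mulr_sumr -sumrN; apply: eq_bigr => i _.
  by rewrite mxE normrM ger0_norm ?invr_ge0.
rewrite [X in _ --> X](_ : _ = expR (- 0)); last by rewrite oppr0 expR0.
apply: continuous_cvg; first exact: continuous_expR.
apply: cvgN.
rewrite -[X in _ --> X](mul0r (\sum_(i < n) `|x ord0 i|)).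
by apply: cvgMl; exact: cvg_invS.
Qed.

Lemma measurable_cosT u : measurable_fun setT u -> measurable_fun setT (cosT u).
Proof.
move=> mu; apply: (measurable_Rintegral1 _ (f := fun x y => cos (dotp x y) * u y)).
apply: measurable_funM; last exact: measurableT_comp.
by apply: (measurableT_comp measurable_cos); exact: measurable_dotp.
Qed.

Lemma measurable_sinT u : measurable_fun setT u -> measurable_fun setT (sinT u).
Proof.
move=> mu; apply: (measurable_Rintegral1 _ (f := fun x y => sin (dotp x y) * u y)).
apply: measurable_funM; last exact: measurableT_comp.
by apply: (measurableT_comp measurable_sin); exact: measurable_dotp.
Qed.

Lemma integrable_laplaceZ (e : R) : 0 < e -> lam.-integrable setT (fun x => (laplace (e *: x))%:E).
Proof.
move=> e0; have := integrable_rV_affine 0 (lt0r_neq0 e0) (@integrable_laplace R n).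
by apply: eq_integrable => // x _ /=; rewrite addr0.
Qed.

Lemma measurable_rVZ (e : R) : measurable_fun setT (fun x : 'rV[R]_n => e *: x).
Proof. by apply: measurable_rV_scale. Qed.

Lemma cosT_laplaceZ (e : R) z : 0 < e ->
  \int[lam]_x (cos (dotp z x) * laplace (e *: x)) = e ^- n * (2 ^+ n * cauchy (e^-1 *: z)).
Proof.
move=> e0; rewrite -cosT_laplace.
rewrite -[in e ^- n](gtr0_norm e0) -(Rintegral_rV_affine 0 (lt0r_neq0 e0)); last first.
  apply: measurable_funM; first exact: measurable_cos_dotp.
  exact: measurable_laplace.
apply: eq_Rintegral => x _; rewrite addr0 dotpZr dotpZl.
by rewrite mulrA divff ?mul1r// lt0r_neq0.
Qed.

Section inversion_proof.
Variables (u : 'rV[R]_n -> R) (c c' : R).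
Hypotheses (cu : continuous u) (uc : forall x, `|u x| <= c * cauchy x).
Hypothesis (Cuc : forall x, `|cosT u x| <= c' * cauchy x).

Let mu : measurable_fun setT u. Proof. exact: continuous_measurable_rV. Qed.

Let e k : R := k.+1%:R^-1.
Let e0 k : 0 < e k. Proof. by rewrite invr_gt0. Qed.

Let c0 : 0 <= c.
Proof.
have := le_trans (normr_ge0 _) (uc 0).
by rewrite pmulr_lge0// cauchy_gt0.
Qed.

Let c'0 : 0 <= c'.
Proof.
have := le_trans (normr_ge0 _) (Cuc 0).
by rewrite pmulr_lge0// cauchy_gt0.
Qed.

Let icW (b : R) : lam.-integrable setT (EFin \o (fun x => b * cauchy x)).
Proof. exact: (integrableZl measurableT b (@integrable_cauchy R n)). Qed.

Let iu : lam.-integrable setT (EFin \o u).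
Proof.
apply: (le_integrable measurableT _ _ (icW c)); first exact/measurable_EFinP.
by move=> x _ /=; rewrite lee_fin (le_trans (uc x))// ler_norm.
Qed.

(** Abel mean of the inversion integral, damped by [laplace] at scale [1 / (k + 1)]. Its limit is
    computed twice: by removing the damping, and by Fubini as a smoothing of [u] with a Cauchy
    kernel. *)
Let J z k := \int[lam]_x (cos (dotp z x) * laplace (e k *: x) * cosT u x).

Let J_cvg z : J z k @[k --> \oo] --> cosT (cosT u) z.
Proof.
apply: (@Rintegral_dominated_cvg _ _ _ _ _ _ (fun x => c' * cauchy x)).
- move=> k; apply: measurable_funM; last exact: measurable_cosT.
  apply: measurable_funM; first exact: measurable_cos_dotp.
  exact: (measurableT_comp (@measurable_laplace R n) (measurable_rVZ _)).
- by apply: measurable_funM; [exact: measurable_cos_dotp|exact: measurable_cosT].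
- apply: aeW => x; apply: cvgMl; rewrite -[X in _ --> X]mulr1.
  by apply: cvgMr; exact: laplace_cvg1.
- exact: icW.
- move=> k x; rewrite !normrM (le_trans _ (Cuc x))// ler_piMl// mulr_ile1// ?cos_max//.
  by rewrite ger0_norm ?laplace_le1// ltW// laplace_gt0.
Qed.

(** The substitution [y = - s z + s e_k w] rescales the Cauchy kernel of width [e_k] to width 1. The
    sign [s] treats the shifts [z + y] and [z - y] together. *)
Let scaled z (s : R) k : s * s = 1 ->
  \int[lam]_y (u y * ((e k) ^- n * (2 ^+ n * cauchy ((e k)^-1 *: (z + s *: y))))) =
  2 ^+ n * \int[lam]_w (cauchy w * u (- s *: z + (s * e k) *: w)).
Proof.
move=> ss; have s0 : s != 0 by apply/eqP => s0; move: ss; rewrite s0 mul0r => /eqP; rewrite eq_sym oner_eq0.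
have n1s : `|s| = 1.
  by apply/eqP; rewrite -(pexpr_eq1 (n := 2))// -normrX expr2 ss normr1.
have c1 : s * e k != 0 by rewrite mulf_neq0// lt0r_neq0.
have mF : measurable_fun setT (fun y => u y * (2 ^+ n * cauchy ((e k)^-1 *: (z + s *: y)))).
  apply: measurable_funM => //; apply: measurable_funM => //.
  apply: (measurableT_comp (@measurable_cauchy R n)).
  apply: (measurableT_comp (measurable_rVZ _)).
  by apply: measurable_rV_add => //; exact: measurable_rVZ.
have := Rintegral_rV_affine (- s *: z) c1 mF.
rewrite normrM n1s mul1r gtr0_norm// => H.
transitivity ((e k) ^- n * \int[lam]_y (u y * (2 ^+ n * cauchy ((e k)^-1 *: (z + s *: y))))).
  rewrite -RintegralZl//; first by apply: eq_Rintegral => y _; rewrite mulrCA.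
  have i2 : lam.-integrable setT (EFin \o (fun y => 2 ^+ n * u y)).
    exact: (integrableZl measurableT _ iu).
  apply: (le_integrable measurableT _ _ i2); first exact/measurable_EFinP.
  move=> y _ /=; rewrite lee_fin mulrCA !normrM ler_wpM2l// ler_piMr//.
  by rewrite ger0_norm ?cauchy_le1// ltW// cauchy_gt0.
rewrite -H -RintegralZl//; last first.
  apply: (le_integrable measurableT _ _ (icW c)).
    apply/measurable_EFinP; apply: measurable_funM; first exact: measurable_cauchy.
    apply: (measurableT_comp mu); apply: measurable_rV_add => //; exact: measurable_rVZ.
  move=> y _ /=; rewrite lee_fin !normrM mulrC ler_wpM2r//.
  by rewrite (ger0_norm c0) (le_trans (uc _))// ler_piMr// cauchy_le1.
apply: eq_Rintegral => w _; rewrite addrC mulrCA; congr (_ * _); rewrite mulrC; congr (_ * _).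
have -> : z + s *: (- s *: z + (s * e k) *: w) = e k *: w.
  by rewrite scalerDr !scalerA mulrN ss scaleN1r addrA subrr add0r mulrA ss mul1r.
by rewrite scalerA mulVf ?scale1r// lt0r_neq0.
Qed.

(** Fubini, then [cos (z.x) cos (x.y)] as half the sum of [cos (x.(z + y))] and [cos (x.(z - y))]:
    each term is a transform of the damping factor, hence a Cauchy kernel centred at [- z] or
    [z]. *)
Let JE z k : J z k = 2 ^+ n / 2 *
  (\int[lam]_w (cauchy w * u (- z + e k *: w)) + \int[lam]_w (cauchy w * u (z - e k *: w))).
Proof.
pose F x y := cos (dotp z x) * laplace (e k *: x) * (cos (dotp x y) * u y).
have mF : measurable_fun setT (fun w : 'rV[R]_n * 'rV[R]_n => F w.1 w.2).
  apply: measurable_funM; apply: measurable_funM.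
  - by apply: (measurableT_comp (measurable_cos_dotp z)).
  - apply: (measurableT_comp (@measurable_laplace R n)).
    by apply: (measurableT_comp (measurable_rVZ _)).
  - by apply: (measurableT_comp measurable_cos); exact: measurable_dotp.
  - exact: measurableT_comp.
have le1 x : `|laplace (e k *: x)| = laplace (e k *: x) by rewrite ger0_norm// ltW// laplace_gt0.
transitivity (\int[lam]_x \int[lam]_y F x y).
  apply: eq_Rintegral => x _; rewrite /F -RintegralZl//.
  by apply: integrable_bddM => //; [exact: measurable_cos_dotp|move=> y; exact: cos_max].
rewrite (Rfubini mF (integrable_laplaceZ (e0 k)) (icW c)); last first.
  move=> x y; rewrite /F !normrM le1 ler_pM//.
  - by rewrite mulr_ge0// ltW// laplace_gt0.
  - by rewrite ler_piMl ?cos_max// ltW// laplace_gt0.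
  - by rewrite (le_trans _ (uc y))// ler_piMl// cos_max.
pose P (t : 'rV[R]_n) := (e k) ^- n * (2 ^+ n * cauchy ((e k)^-1 *: t)).
have iP t : lam.-integrable setT (fun x => (cos (dotp t x) * laplace (e k *: x))%:E).
  apply: integrable_bddM => //; first exact: measurable_cos_dotp.
    by move=> ?; exact: cos_max.
  exact: integrable_laplaceZ.
have inner y : \int[lam]_x F x y = 2^-1 * (u y * P (z + 1 *: y) + u y * P (z + -1 *: y)).
  rewrite /P -!cosT_laplaceZ// -mulrDr mulrA.
  pose f (t x : 'rV[R]_n) := cos (dotp t x) * laplace (e k *: x).
  transitivity (\int[lam]_x (2^-1 * u y * (f (z + 1 *: y) x + f (z + -1 *: y) x))).
    apply: eq_Rintegral => x _; rewrite /F /f scale1r scaleN1r !(dotpC _ x) !dotpDr dotpNr.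
    by rewrite !cosD cosN sinN; field.
  rewrite RintegralZl//; last exact: (integrableD measurableT (iP _) (iP _)).
  rewrite RintegralD//; exact: iP.
have iuP s : lam.-integrable setT (EFin \o (fun y => u y * P (z + s *: y))).
  have i2 : lam.-integrable setT (EFin \o (fun y => (e k ^- n * 2 ^+ n) * u y)).
    exact: (integrableZl measurableT _ iu).
  apply: (le_integrable measurableT _ _ i2).
    apply/measurable_EFinP; apply: measurable_funM => //; apply: measurable_funM => //.
    apply: measurable_funM => //; apply: (measurableT_comp (@measurable_cauchy R n)).
    apply: (measurableT_comp (measurable_rVZ _)).
    by apply: measurable_rV_add => //; exact: measurable_rVZ.
  move=> y _ /=; rewrite lee_fin /P mulrC mulrA !normrM -mulrA ler_wpM2l ?mulr_ge0//.
  by rewrite ler_piMl// ger0_norm ?cauchy_le1// ltW// cauchy_gt0.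
under eq_Rintegral do rewrite inner.
rewrite RintegralZl//; last exact: (integrableD measurableT (iuP 1) (iuP (-1))).
rewrite RintegralD// !scaled; last 2 first.
- by rewrite mulrNN mulr1.
- by rewrite mulr1.
rewrite -mulrDr mulrA (mulrC 2^-1) opprK scale1r scaleN1r mul1r mulN1r.
by congr (_ * (_ + _)); apply: eq_Rintegral => w _; rewrite scaleNr.
Qed.

(** [cauchy] is an approximate identity of mass [pi ^+ n]. The sign [s] serves the two arguments
    [- z + e w] and [z - e w] appearing in [JE]. *)
Let limit z (s : R) (s1 : `|s| <= 1) :
  \int[lam]_w (cauchy w * u (z + (s * e k) *: w)) @[k --> \oo] --> pi ^+ n * u z.
Proof.
have -> : pi ^+ n * u z = \int[lam]_w (cauchy w * u z).
  rewrite RintegralZr//; last exact: integrable_cauchy.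
  by rewrite /Rintegral integral_cauchy.
apply: (@Rintegral_dominated_cvg _ _ _ _ _ _ (fun x => c * cauchy x)).
- move=> k; apply: measurable_funM; first exact: measurable_cauchy.
  apply: (measurableT_comp mu); apply: measurable_rV_add => //; exact: measurable_rVZ.
- by apply: measurable_funM => //; exact: measurable_cauchy.
- apply: aeW => w; apply: cvgMr; apply: continuous_cvg; first exact: cu.
  rewrite -[X in _ --> X]addr0; apply: cvgD; first exact: cvg_cst.
  rewrite -(scale0r w); apply: cvgZl.
  by rewrite -(mulr0 s); apply: cvgMr; exact: cvg_invS.
- exact: icW.
- move=> k w; rewrite normrM mulrC (ger0_norm (ltW (cauchy_gt0 w))) ler_wpM2r ?(ltW (cauchy_gt0 _))//.
  by rewrite (le_trans (uc _))// ler_piMr// cauchy_le1.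
Qed.

(** Both limits of [J z k] agree. A double cosine transform sees only the even part of [u], whence
    the average of [u z] and [u (- z)]. *)
Lemma fourier_inversion z : cosT (cosT u) z = (2 * pi) ^+ n * ((u z + u (- z)) / 2).
Proof.
rewrite -(cvg_lim (@Rhausdorff R) (@J_cvg z)); apply: cvg_lim; first exact: Rhausdorff.
under eq_fun do rewrite JE.
have -> : (2 * pi) ^+ n * ((u z + u (- z)) / 2) =
    2 ^+ n / 2 * (pi ^+ n * u (- z) + pi ^+ n * u z) by rewrite exprMn; field.
apply: cvgMr; apply: cvgD.
  have := @limit (- z) 1; rewrite normr1 => /(_ (lexx _)).
  by under eq_fun do under eq_Rintegral do rewrite mul1r.
have := @limit z (-1); rewrite normrN1 => /(_ (lexx _)).
by under eq_fun do under eq_Rintegral do rewrite mulN1r scaleNr.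
Qed.

End inversion_proof.
End inversion.

(** * Transforms of Schwartz functions *)

Section schwartz_decay.
Context {R : realType} (n : nat).
Local Notation lam := (lebesgue_rV R n).
Implicit Types (u : 'rV[R]_n -> R) (x y z : 'rV[R]_n) (i : 'I_n).

(** Restricts the derivative to steps [1 / (k + 1)], the form that dominated convergence along a
    sequence can use. *)
Lemma difference_quotient_cvg (V : normedModType R) (f : V -> R) (a v : V) : derivable f a v ->
  k.+1%:R * (f (a + k.+1%:R^-1 *: v) - f a) @[k --> \oo] --> 'D_v f a.
Proof.
move=> df.
have h0 : (k.+1%:R^-1 : R) @[k --> \oo] --> (0 : R)^'.
  move=> A; rewrite /dnbhs /within/= => A0.
  have hA : \forall k \near \oo, (harmonic k : R) != 0 -> A (harmonic k).
    exact: (@cvg_harmonic R _ A0).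
  have : \forall k \near \oo, A (harmonic k).
    by apply: filterS hA => k; apply; exact: lt0r_neq0 (harmonic_gt0 k).
  by [].
have /= := cvg_comp _ _ h0 df.
apply: cvg_trans; apply: near_eq_cvg; apply: nearW => k /=.
by rewrite invrK (addrC a).
Qed.

Lemma norm_cosB (a b : R) : `|cos a - cos b| <= `|a - b|.
Proof.
wlog ab : a b / a <= b.
  by move=> H; have [/H//|/ltW/H] := leP a b; rewrite distrC (distrC a).
have cc : {within `[a, b], continuous (@cos R)}.
  by apply: continuous_subspaceT; exact: continuous_cos.
have [c _ cE] := @MVT_segment R cos (fun t => - sin t) a b ab _ cc.
by rewrite distrC (distrC a) cE normrM normrN ler_piMl// sin_max.
Qed.

Lemma cauchy_shift y z : (forall i, `|z ord0 i| <= 1) -> cauchy (y + z) <= 3 ^+ n * cauchy y.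
Proof.
move=> z1; have -> : 3 ^+ n = \prod_(i < n) 3 :> R by rewrite prodr_const card_ord.
rewrite /cauchy /prod_rV -big_split/=.
apply: ler_prod => i _; rewrite ltW ?cauchy1_gt0//= mxE /cauchy1.
rewrite ler_pdivlMr ?ltr_pwDl ?sqr_ge0// mulrC ler_pdivrMr ?ltr_pwDl ?sqr_ge0//.
have := z1 i; rewrite ler_norml => /andP[b0 b1].
move: (y ord0 i) (z ord0 i) b0 b1 => a b b0 b1.
(* The constant 3 comes from [3 (1 + (a + b)^2) - (1 + a^2) = (a + 2 b)^2 + (a + b)^2 + 2 (1 -
   b^2)]. *)
have := sqr_ge0 (a + 2 * b); have := sqr_ge0 (a + b).
have : 0 <= (1 - b) * (1 + b) by rewrite mulr_ge0; lra.
nra.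
Qed.

Lemma coord_le_enorm x i : `|x ord0 i| <= enorm x.
Proof.
rewrite -sqrtr_sqr ler_sqrt; last first.
  by apply: sumr_ge0 => j _; rewrite -expr2 sqr_ge0.
rewrite /dotp (bigD1 i)//= expr2 lerDl.
by apply: sumr_ge0 => j _; rewrite -expr2 sqr_ge0.
Qed.

Lemma enorm_ge0 x : 0 <= enorm x. Proof. exact: sqrtr_ge0. Qed.

(** Each factor satisfies [1 + x_i ^+ 2 <= (1 + enorm x) ^+ 2], so a Schwartz seminorm with weight
    of order [2 n] yields a bound by [cauchy]. *)
Lemma cauchy_ge x : (1 + enorm x) ^- (2 * n) <= cauchy x.
Proof.
have -> : (1 + enorm x) ^- (2 * n) = \prod_(i < n) ((1 + enorm x) ^+ 2)^-1.
  by rewrite prodr_const card_ord exprVn -exprM.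
apply: ler_prod => i _; rewrite invr_ge0 exprn_ge0 ?addr_ge0 ?enorm_ge0//=.
rewrite /cauchy1 lef_pV2 ?posrE ?exprn_gt0 ?ltr_pwDl ?sqr_ge0 ?enorm_ge0//.
have := coord_le_enorm x i; have := enorm_ge0 x; rewrite -(real_normK (num_real (x ord0 i))).
have := normr_ge0 (x ord0 i); move: `|_| (enorm x) => a b; nra.
Qed.

Lemma partials_cat (s t : seq 'I_n) u : partials s (partials t u) = partials (s ++ t) u.
Proof. by rewrite /partials foldr_cat. Qed.

Lemma schwartz_partials t u : schwartz_real u -> schwartz_real (partials t u).
Proof.
move=> [du bu]; split=> [s x|s N]; first by rewrite partials_cat.
by have [C hC] := bu (s ++ t) N; exists C => x; rewrite partials_cat.
Qed.

Lemma schwartz_bound u : schwartz_real u -> exists c, forall x, `|u x| <= c * cauchy x.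
Proof.
move=> [_ bu]; have [C hC] := bu [::] (2 * n)%N; exists C => x.
have k0 : 0 < (1 + enorm x) ^+ (2 * n) by rewrite exprn_gt0// ltr_pwDl ?enorm_ge0.
have C0 : 0 <= C by apply: le_trans (hC x); rewrite mulr_ge0// ltW.
apply: (@le_trans _ _ (C * (1 + enorm x) ^- (2 * n))).
  by rewrite ler_pdivlMr// mulrC; exact: hC.
by rewrite ler_wpM2l// cauchy_ge.
Qed.

Lemma schwartz_continuous u : schwartz_real u -> continuous u.
Proof. by move=> [du _] x; apply: differentiable_continuous; exact: (du [::]). Qed.

Lemma schwartz_integrable u : schwartz_real u -> lam.-integrable setT (EFin \o u).
Proof.
move=> su; have [c uc] := schwartz_bound su.
apply: (le_integrable measurableT _ _ (integrableZl measurableT c (@integrable_cauchy R n))).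
  apply/measurable_EFinP; apply: continuous_measurable_rV.
  exact: schwartz_continuous.
by move=> x _ /=; rewrite lee_fin (le_trans (uc x))// ler_norm.
Qed.

Section integration_by_parts.
Variables (u : 'rV[R]_n -> R) (i : 'I_n) (c c' : R).
Let v : 'rV[R]_n := delta_mx ord0 i.
Hypothesis du : forall y, derivable u y v.
Hypotheses (mu : measurable_fun setT u) (mDu : measurable_fun setT ('D_v u)).
Hypotheses (uc : forall y, `|u y| <= c * cauchy y)
  (Duc : forall y, `|'D_v u y| <= c' * cauchy y).

Let c'0 : 0 <= c'.
Proof.
have := le_trans (normr_ge0 _) (Duc 0).
by rewrite pmulr_lge0// cauchy_gt0.
Qed.

Let icW (b : R) : lam.-integrable setT (EFin \o (fun x => b * cauchy x)).
Proof. exact: (integrableZl measurableT b (@integrable_cauchy R n)). Qed.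

Let iu : lam.-integrable setT (EFin \o u).
Proof.
apply: (le_integrable measurableT _ _ (icW c)); first exact/measurable_EFinP.
by move=> x _ /=; rewrite lee_fin (le_trans (uc x))// ler_norm.
Qed.

Let line_derive y (t : R) : is_derive t 1 (fun s => u (y + s *: v)) ('D_v u (y + t *: v)).
Proof.
have E : (fun h : R => h^-1 *: (((fun s => u (y + s *: v)) \o shift t) (h *: 1) - u (y + t *: v))) =
    (fun h : R => h^-1 *: ((u \o shift (y + t *: v)) (h *: v) - u (y + t *: v))).
  apply/funext => h /=; congr (_ *: (u _ - _)).
  by rewrite [h *: 1]mulr1 scalerDl addrCA addrA.
split; first by rewrite /derivable E; exact: du.
by rewrite /derive E.
Qed.

(** By the mean value theorem the quotient is the derivative at a point shifted by at most 1 along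
    one axis; [cauchy_shift] makes the bound uniform in [k]. *)
Let quotient_le y k : `|k.+1%:R * (u (y + k.+1%:R^-1 *: v) - u y)| <= 3 ^+ n * c' * cauchy y.
Proof.
have k1 : 0 <= k.+1%:R^-1 :> R by rewrite invr_ge0.
have cw : {within `[0, k.+1%:R^-1 : R], continuous (fun s : R => u (y + s *: v))}.
  apply: continuous_subspaceT => s; apply: differentiable_continuous.
  by apply/derivable1_diffP; have [] := line_derive y s.
have [s] := @MVT_segment R (fun s => u (y + s *: v)) (fun t => 'D_v u (y + t *: v)) _ _ k1
  (fun t _ => line_derive y t) cw.
rewrite in_itv/= scale0r addr0 subr0 => /andP[s0 sk] ->.
rewrite mulrCA divff ?pnatr_eq0// mulr1 (le_trans (Duc _))// -mulrA mulrCA ler_wpM2l//.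
apply: cauchy_shift => j; rewrite !mxE eqxx/= normrM ger0_norm//.
apply: mulr_ile1 => //.
  by rewrite (le_trans sk)// invf_le1// ler1n.
by case: (j == i); rewrite ?normr1 ?normr0.
Qed.

(** Integration by parts through difference quotients: translation invariance moves the quotient
    from [u] onto the cosine, and dominated convergence is applied on both sides. The phase [w]
    gives the rule for cosines at 0 and for sines at [- (pi / 2)]. *)
Lemma phase_by_parts (w : R) x :
  \int[lam]_y (cos (dotp x y + w) * 'D_v u y) = x ord0 i * \int[lam]_y (sin (dotp x y + w) * u y).
Proof.
have mdot : measurable_fun setT (fun y => dotp x y + w).
  by apply: measurable_funD => //; exact: measurable_dotp.
have mcos : measurable_fun setT (fun y => cos (dotp x y + w)).
  exact: (measurableT_comp measurable_cos).
have msin : measurable_fun setT (fun y => sin (dotp x y + w)).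
  exact: (measurableT_comp measurable_sin).
have dxv : dotp x v = x ord0 i.
  rewrite /dotp (bigD1 i)//= mxE !eqxx mulr1 big1 ?addr0// => j /negbTE ji.
  by rewrite mxE ji andbF mulr0.
pose J k := \int[lam]_y (cos (dotp x y + w) * (k.+1%:R * (u (y + k.+1%:R^-1 *: v) - u y))).
have mus k : measurable_fun setT (fun y => u (y + k.+1%:R^-1 *: v)).
  by apply: (measurableT_comp mu); apply: measurable_rV_add.
have lim1 : J k @[k --> \oo] --> \int[lam]_y (cos (dotp x y + w) * 'D_v u y).
  apply: (@Rintegral_dominated_cvg _ _ _ _ _ _ (fun x => 3 ^+ n * c' * cauchy x)).
  - move=> k; apply: measurable_funM => //; apply: measurable_funM => //.
    exact: measurable_funB.
  - exact: measurable_funM.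
  - by apply: aeW => y; apply: cvgMr; exact: difference_quotient_cvg.
  - exact: icW.
  - by move=> k y; rewrite normrM (le_trans _ (quotient_le y k))// ler_piMl// cos_max.
have ibu (f : 'rV[R]_n -> R) g : measurable_fun setT f -> (forall y, `|f y| <= 1) ->
    lam.-integrable setT (EFin \o g) -> lam.-integrable setT (EFin \o (fun y => f y * g y)).
  by move=> mf f1 ig; exact: integrable_bddM.
have JE k : J k = \int[lam]_y (k.+1%:R * (cos (dotp x y + w - k.+1%:R^-1 * x ord0 i) - cos (dotp x y + w)) * u y).
  have ius : lam.-integrable setT (EFin \o (fun y => u (y + k.+1%:R^-1 *: v))).
    have := integrable_rV_affine (k.+1%:R^-1 *: v) (oner_neq0 R) iu.
    by apply: eq_integrable => // y _ /=; rewrite scale1r.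
  have mc' : measurable_fun setT (fun y => cos (dotp x y + w - k.+1%:R^-1 * x ord0 i)).
    by apply: (measurableT_comp measurable_cos); exact: measurable_funB.
  have i1 : lam.-integrable setT (EFin \o (fun y => cos (dotp x y + w) * u (y + k.+1%:R^-1 *: v))).
    by apply: ibu => // y; exact: cos_max.
  have i2 : lam.-integrable setT (EFin \o (fun y => cos (dotp x y + w) * u y)).
    by apply: ibu => // y; exact: cos_max.
  have i3 : lam.-integrable setT (EFin \o (fun y => cos (dotp x y + w - k.+1%:R^-1 * x ord0 i) * u y)).
    by apply: ibu => // y; exact: cos_max.
  transitivity (k.+1%:R * (\int[lam]_y (cos (dotp x y + w) * u (y + k.+1%:R^-1 *: v)) -
      \int[lam]_y (cos (dotp x y + w) * u y))).
    rewrite -RintegralB// -RintegralZl//; last exact: (integrableB measurableT i1 i2).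
    by apply: eq_Rintegral => y _; ring.
  have -> : \int[lam]_y (cos (dotp x y + w) * u (y + k.+1%:R^-1 *: v)) =
      \int[lam]_y (cos (dotp x y + w - k.+1%:R^-1 * x ord0 i) * u y).
    have mm : measurable_fun setT (fun y => cos (dotp x y + w - k.+1%:R^-1 * x ord0 i) * u y).
      exact: measurable_funM.
    have := Rintegral_rV_affine (k.+1%:R^-1 *: v) (oner_neq0 R) mm.
    rewrite normr1 expr1n invr1 mul1r => <-; apply: eq_Rintegral => y _.
    rewrite scale1r dotpDr dotpZr dxv; congr (cos _ * _).
    by ring.
  rewrite -RintegralB// -RintegralZl//; last exact: (integrableB measurableT i3 i2).
  by apply: eq_Rintegral => y _; ring.
rewrite -(cvg_lim (@Rhausdorff R) lim1); apply: cvg_lim; first exact: Rhausdorff.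
under eq_fun do rewrite JE.
rewrite -RintegralZl//; last by apply: ibu => // y; exact: sin_max.
apply: (@Rintegral_dominated_cvg _ _ _ _ _ _ (fun y => `|x ord0 i| * c * cauchy y)).
- move=> k; apply: measurable_funM => //; apply: measurable_funM => //.
  apply: measurable_funB => //.
  by apply: (measurableT_comp measurable_cos); exact: measurable_funB.
- by apply: measurable_funM => //; exact: measurable_funM.
- apply: aeW => y; rewrite mulrA; apply: cvgMl.
  pose f (t : R) := cos (dotp x y + w - t * x ord0 i).
  have df : is_derive (0 : R) (1 : R) f (x ord0 i * sin (dotp x y + w)).
    apply: is_derive_eq; rewrite /GRing.scale/= mul0r subr0; ring.
  have [df1 df2] := df.
  have := difference_quotient_cvg df1; rewrite df2.
  apply: cvg_trans; apply: near_eq_cvg; apply: nearW => k /=.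
  by rewrite /f add0r mul0r subr0 [_ *: 1]mulr1.
- exact: icW.
- move=> k y; rewrite normrM -mulrA ler_pM// normrM.
  have k0 : (0 : R) < k.+1%:R by [].
  rewrite (ger0_norm (ltW k0)) -ler_pdivlMl//.
  apply: (le_trans (norm_cosB _ _)).
  by rewrite addrAC subrr sub0r normrN normrM ger0_norm// invr_ge0.
Qed.

End integration_by_parts.

Lemma cosT_partial u i x : schwartz_real u ->
  cosT (partials [:: i] u) x = x ord0 i * sinT u x.
Proof.
move=> su; have [c uc] := schwartz_bound su.
have sd := schwartz_partials [:: i] su; have [c' Duc] := schwartz_bound sd.
have du y : derivable u y (delta_mx ord0 i) by apply: diff_derivable; exact: su.1 [::] y.
have mu := continuous_measurable_rV (schwartz_continuous su).
have mDu := continuous_measurable_rV (schwartz_continuous sd).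
have := phase_by_parts du mu mDu uc Duc 0 x.
by under eq_Rintegral do rewrite addr0; under [in RHS]eq_Rintegral do rewrite addr0.
Qed.

Lemma sinT_partial u i x : schwartz_real u ->
  sinT (partials [:: i] u) x = - x ord0 i * cosT u x.
Proof.
move=> su; have [c uc] := schwartz_bound su.
have sd := schwartz_partials [:: i] su; have [c' Duc] := schwartz_bound sd.
have du y : derivable u y (delta_mx ord0 i) by apply: diff_derivable; exact: su.1 [::] y.
have mu := continuous_measurable_rV (schwartz_continuous su).
have mDu := continuous_measurable_rV (schwartz_continuous sd).
have cs (t : R) : cos (t - pi / 2) = sin t.
  by rewrite cosD cosN sinN cos_pihalf sin_pihalf mulr0 add0r mulrN1 opprK.
have sc (t : R) : sin (t - pi / 2) = - cos t.
  by rewrite sinD cosN sinN cos_pihalf sin_pihalf mulr0 add0r mulrN1.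
have := phase_by_parts du mu mDu uc Duc (- (pi / 2)) x.
under eq_Rintegral do rewrite cs; under [in RHS]eq_Rintegral do rewrite sc mulNr -mulN1r.
rewrite RintegralZl//; first by move=> E; transitivity (x ord0 i * (-1 * cosT u x)); [exact: E|ring].
apply: integrable_bddM; first exact: measurable_cos_dotp.
  by move=> y; exact: cos_max.
exact: schwartz_integrable.
Qed.

Lemma transform_bound u : schwartz_real u -> exists C, forall x,
  `|cosT u x| <= C /\ `|sinT u x| <= C.
Proof.
move=> su; have iu := schwartz_integrable su; exists (\int[lam]_y `|u y|) => x.
have H (f : 'rV[R]_n -> R) : measurable_fun setT f -> (forall y, `|f y| <= 1) ->
    `|\int[lam]_y (f y * u y)| <= \int[lam]_y `|u y|.
  move=> mf f1; have iF := integrable_bddM mf f1 iu.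
  apply: (le_trans (le_normr_Rintegral measurableT iF)).
  apply: le_Rintegral => //; [exact: (integrable_norm iF)|exact: (integrable_norm iu)|].
  by move=> y _; rewrite normrM ler_piMl.
split; apply: H; first exact: measurable_cos_dotp.
- by move=> y; exact: cos_max.
- exact: measurable_sin_dotp.
- by move=> y; exact: sin_max.
Qed.

(** Two derivatives in direction i multiply both transforms by [- x_i ^+ 2]. Adding the bounds for
    [u] and for its second derivative thus gains one factor [1 + x_i ^+ 2]; the induction runs over
    a list of coordinates with [u] arbitrary, and the full list yields [cauchy]. *)
Lemma schwartz_transform_decay u : schwartz_real u -> exists c, forall x,
  `|cosT u x| <= c * cauchy x /\ `|sinT u x| <= c * cauchy x.
Proof.
suff H (l : seq 'I_n) : forall u, schwartz_real u -> exists C, forall x,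
    \prod_(i <- l) (1 + x ord0 i ^+ 2) * `|cosT u x| <= C /\
    \prod_(i <- l) (1 + x ord0 i ^+ 2) * `|sinT u x| <= C.
  move=> su; have [C hC] := H (index_enum _) u su; exists C => x.
  have P0 : 0 < \prod_(i < n) (1 + x ord0 i ^+ 2).
    by apply: prodr_gt0 => i _; rewrite ltr_pwDl// sqr_ge0.
  have -> : cauchy x = (\prod_(i < n) (1 + x ord0 i ^+ 2))^-1 by rewrite -prodfV.
  by have [h1 h2] := hC x; rewrite !ler_pdivlMr// !(mulrC `|_|).
elim: l => [|i l IH] {}u su.
  by have [C hC] := transform_bound su; exists C => x; rewrite big_nil !mul1r.
have sd := schwartz_partials [:: i] su; have sdd := schwartz_partials [:: i] sd.
have [C1 h1] := IH u su; have [C2 h2] := IH _ sdd; exists (C1 + C2) => x.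
have P0 : 0 <= \prod_(j <- l) (1 + x ord0 j ^+ 2).
  by apply: prodr_ge0 => j _; rewrite addr_ge0// sqr_ge0.
have [a1 b1] := h1 x; have [a2 b2] := h2 x.
move: a2 b2; rewrite cosT_partial// sinT_partial// sinT_partial// cosT_partial//.
have E (t : R) : `|x ord0 i * (- x ord0 i * t)| = x ord0 i ^+ 2 * `|t|.
  by rewrite !normrM normrN mulrA -normrM -expr2 ger0_norm// sqr_ge0.
have E' (t : R) : `|- x ord0 i * (x ord0 i * t)| = x ord0 i ^+ 2 * `|t|.
  by rewrite !normrM normrN mulrA -normrM -expr2 ger0_norm// sqr_ge0.
rewrite E E' big_cons => a2 b2; split.
  by rewrite [_ * `|_|](_ : _ = \prod_(j <- l) (1 + x ord0 j ^+ 2) * `|cosT u x| +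
    \prod_(j <- l) (1 + x ord0 j ^+ 2) * (x ord0 i ^+ 2 * `|cosT u x|)); [exact: lerD|ring].
by rewrite [_ * `|_|](_ : _ = \prod_(j <- l) (1 + x ord0 j ^+ 2) * `|sinT u x| +
    \prod_(j <- l) (1 + x ord0 j ^+ 2) * (x ord0 i ^+ 2 * `|sinT u x|)); [exact: lerD|ring].
Qed.

End schwartz_decay.

(** * Radial integrals and their duality *)

Section inversion_line.
Context {R : realType}.
Local Notation mu := (@lebesgue_measure R).
Local Notation D := (`]0%R, +oo[%classic : set R).
Local Notation I := (`]0%R, 1%R]%classic : set R).

Let D1 (s : R) : 0 < s -> \1_D s = 1 :> R.
Proof. by move=> s0; rewrite indicE mem_set//= in_itv/= andbT. Qed.

Let D0 (s : R) : s <= 0 -> \1_D s = 0 :> R.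
Proof. by move=> s0; rewrite indicE memNset//= in_itv/= andbT; apply/negP; rewrite -leNgt. Qed.

Let I0 (s : R) : s <= 0 -> \1_I s = 0 :> R.
Proof. by move=> s0; rewrite indicE memNset//= in_itv/= => /andP[]; rewrite ltNge s0. Qed.

Let mI : measurable_fun setT (fun t : measurableTypeR R => \1_I t : R).
Proof. by apply: measurable_indic; exact: measurable_itv. Qed.

Let mD : measurable_fun setT (fun t : measurableTypeR R => \1_D t : R).
Proof. by apply: measurable_indic; exact: measurable_itv. Qed.

Let intI : (\int[mu]_t (\1_I t)%:E = 1)%E.
Proof.
rewrite integral_indic// setIT [LHS]lebesgue_measure_itv/= lte_fin ltr01.
by rewrite -EFinB subr0.
Qed.

Lemma measurable_invr : measurable_fun setT (fun t : measurableTypeR R => t^-1 : R).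
Proof.
have -> : (fun t : R => t^-1) = (fun t : R => if t == 0 then 0 else if 0 <= t then t `^ (-1) else - ((- t) `^ (-1))).
  apply/funext => t; case: eqVneq => [->|t0]; first by rewrite invr0.
  case: ifPn => [t1|]; first by rewrite powR_inv1.
  rewrite -ltNge => t1; rewrite powR_inv1; last by rewrite oppr_ge0 ltW.
  by rewrite invrN opprK.
apply: measurable_fun_ifT; [|exact: measurable_cst|apply: measurable_fun_ifT].
- by apply: measurable_fun_eqr => //.
- by apply: measurable_fun_ler.
- exact: measurable_powR.
- apply: measurable_funN.
  apply: (measurableT_comp (f := fun t : R => t `^ (-1)) (g := fun t : measurableTypeR R => - t)) => //.
  exact: oppr_measurable.
Qed.

(** Obtained from Tonelli and linear substitutions. Since the integral of [\1_I (s * t)] in [t] is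
    [1 / s], the left side is the double integral of [h]. Rescaling [s] by [t] turns [h] into [k],
    where [F] has argument [t / s]; rescaling [t] by [s] then leaves the integral of [F] times the
    mass 1 of [\1_I]. *)
Lemma ge0_integral_inversion (F : measurableTypeR R -> \bar R) :
  measurable_fun setT F -> (forall r, 0 <= F r)%E ->
  (\int[mu]_(s in D) ((s ^- 2)%:E * F s^-1%R) = \int[mu]_(r in D) F r)%E.
Proof.
move=> mF F0.
have DE (f : measurableTypeR R -> \bar R) : (\int[mu]_(s in D) f s = \int[mu]_s ((\1_D s)%:E * f s))%E.
  rewrite integral_mkcond; apply: eq_integral => s _; rewrite patchE indicE.
  by case: (s \in D); rewrite ?mul1e ?mul0e.
rewrite !DE.
pose h (s t : measurableTypeR R) := ((\1_D s * \1_I (s * t) * s^-1)%:E * F s^-1%R)%E.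
pose k (s t : measurableTypeR R) := ((\1_I s * s^-1 * \1_D t)%:E * F (t / s)%R)%E.
have h0 s t : (0 <= h s t)%E.
  rewrite mule_ge0// lee_fin; have [s0|s0] := ltP 0 s.
    by rewrite D1// mul1r mulr_ge0 ?invr_ge0 ?(ltW s0)// indicE.
  by rewrite D0// !mul0r.
have k0 s t : (0 <= k s t)%E.
  rewrite mule_ge0// lee_fin; have [s0|s0] := ltP 0 s.
    by rewrite mulr_ge0// ?indicE// mulr_ge0 ?indicE// invr_ge0 ltW.
  by rewrite I0// !mul0r.
have mh : measurable_fun setT (fun z : measurableTypeR R * measurableTypeR R => h z.1 z.2).
  apply: emeasurable_funM; last first.
    by apply: (measurableT_comp mF); apply: (measurableT_comp measurable_invr).
  apply/measurable_EFinP; apply: measurable_funM; last exact: (measurableT_comp measurable_invr).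
  apply: measurable_funM; first exact: (measurableT_comp mD).
  by apply: (measurableT_comp mI); exact: measurable_funM.
have mk : measurable_fun setT (fun z : measurableTypeR R * measurableTypeR R => k z.1 z.2).
  apply: emeasurable_funM; last first.
    apply: (measurableT_comp mF); apply: measurable_funM => //.
    exact: (measurableT_comp measurable_invr).
  apply/measurable_EFinP; apply: measurable_funM; last exact: (measurableT_comp mD).
  apply: measurable_funM; first exact: (measurableT_comp mI).
  exact: (measurableT_comp measurable_invr).
transitivity (\int[mu]_s \int[mu]_t h s t)%E.
  apply: eq_integral => s _; have [s0|s0] := ltP 0 s; last first.
    rewrite D0// mul0e; apply/esym/integral0_eq => t _.
    by rewrite /h D0// !mul0r mul0e.
  have sn : s != 0 by rewrite gt_eqF.
  rewrite D1// mul1e; transitivity (\int[mu]_t (((s^-1)%:E * F s^-1%R) * (\1_I (s * t + 0)%R)%:E))%E.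
    rewrite ge0_integralZl//.
    - rewrite (ge0_integral_affine (f := fun t => (\1_I t)%:E) 0 sn)//; last exact/measurable_EFinP.
      rewrite intI mule1 gtr0_norm// [RHS]muleC muleA -EFinM.
      by congr (_%:E * _)%E; rewrite expr2 invfM.
    - apply/measurable_EFinP; apply: (measurableT_comp mI); exact: measurable_affine.
    - by rewrite mule_ge0// lee_fin invr_ge0 ltW.
  apply: eq_integral => t _; rewrite /h D1// mul1r addr0 muleAC -EFinM.
  by rewrite [s^-1 * _]mulrC.
rewrite tonelli//.
transitivity (\int[mu]_t \int[mu]_s k s t)%E.
  apply: eq_integral => t _; have [t0|t0] := ltP 0 t; last first.
    rewrite !integral0_eq// => s _.
      by rewrite /k D0// mulr0 mul0e.
    rewrite /h; have [s0|s0] := ltP 0 s; last by rewrite D0// !mul0r mul0e.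
    by rewrite I0 ?mulr0 ?mul0r ?mul0e// pmulr_rle0.
  have tn : t != 0 by rewrite gt_eqF.
  transitivity (t%:E * \int[mu]_s k (t * s + 0)%R t)%E.
    rewrite -ge0_integralZl_EFin ?(ltW t0)//; last first.
      apply: (measurableT_comp (measurable_fun_pair1 t mk)); exact: measurable_affine.
    apply: eq_integral => s _; rewrite /h /k addr0 (D1 t0) mulr1.
    have [s0|s0] := ltP 0 s; last first.
      have ts : t * s <= 0 by rewrite pmulr_rle0.
      by rewrite (D0 s0) (I0 ts) !mul0r !mul0e mule0.
    have sn : s != 0 by rewrite gt_eqF.
    rewrite (D1 s0) mul1r muleA -EFinM (mulrC s t).
    have -> : t * (\1_I (t * s) / (t * s)) = \1_I (t * s) / s.
      by rewrite invfM mulrCA (mulrA t) divff// mul1r.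
    have -> : t / (t * s) = s^-1 by rewrite invfM mulrA divff// mul1r.
    by [].
  rewrite (ge0_integral_affine (f := fun s => k s t) 0 tn)//; last exact: (measurable_fun_pair1 t mk).
  by rewrite muleA -EFinM gtr0_norm// divff// mul1e.
rewrite -tonelli//.
transitivity (\int[mu]_s ((\1_I s)%:E * \int[mu]_t ((\1_D t)%:E * F t)))%E; last first.
  rewrite ge0_integralZr//; last 2 first.
  - exact/measurable_EFinP.
  - by apply: integral_ge0 => t _; rewrite mule_ge0.
  by rewrite intI mul1e.
apply: eq_integral => s _; have [s0|s0] := ltP 0 s; last first.
  by rewrite I0// mul0e integral0_eq// => t _; rewrite /k I0// !mul0r mul0e.
have mDF : measurable_fun setT (fun t => (\1_D t)%:E * F t)%E.
  by apply: emeasurable_funM => //; exact/measurable_EFinP.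
have sn : s^-1 != 0 by rewrite invr_eq0 gt_eqF.
transitivity ((\1_I s * s^-1)%:E * \int[mu]_t ((\1_D (s^-1 * t + 0)%R)%:E * F (s^-1 * t + 0)%R))%E.
  rewrite -ge0_integralZl_EFin//.
  - apply: eq_integral => t _; rewrite /k addr0 EFinM -muleA (mulrC t); congr (_ * (_ * _))%E.
    have [t0|t0] := ltP 0 t; first by rewrite !D1// mulr_gt0 ?invr_gt0.
    by rewrite !D0// pmulr_rle0// invr_gt0.
  - by move=> t _; rewrite mule_ge0.
  - apply: (measurableT_comp mDF); exact: measurable_affine.
  - by rewrite mulr_ge0 ?indicE// invr_ge0 ltW.
rewrite (ge0_integral_affine (f := fun t => ((\1_D t)%:E * F t)%E) 0 sn)//; last first.
  by move=> t; rewrite mule_ge0.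
rewrite muleA -EFinM gtr0_norm ?invr_gt0// invrK -mulrA mulVf ?mulr1//.
by rewrite gt_eqF.
Qed.

End inversion_line.

Section mellin.
Context {R : realType} (n : nat).
Local Notation mu := (@lebesgue_measure R).
Local Notation lam := (lebesgue_rV R n).
Local Notation D := (`]0%R, +oo[%classic : set R).
Implicit Types (G H u : 'rV[R]_n -> R) (p : R).

(** Values lie in [\bar R] because the integral may diverge along some rays. *)
Definition mellin p G (x : 'rV[R]_n) : \bar R :=
  (\int[mu]_(r in D) (G (r *: x) * r `^ (p - 1))%:E)%E.

(** The measure r^(p-1) dr of the half line, extended by zero so that Fubini and affine
    substitutions on the whole line apply. *)
Definition power_density p (r : R) : R := \1_D r * r `^ (p - 1).

Lemma integral_half_line (f : measurableTypeR R -> R) :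
  (\int[mu]_(r in D) (f r)%:E = \int[mu]_r (\1_D r * f r)%:E)%E.
Proof.
rewrite integral_mkcond; apply: eq_integral => r _; rewrite patchE indicE.
by case: (r \in D); rewrite ?mul1r ?mul0r.
Qed.

Lemma mellinE p G x : mellin p G x = (\int[mu]_r (power_density p r * G (r *: x))%:E)%E.
Proof.
rewrite /mellin integral_half_line; apply: eq_integral => r _.
by rewrite /power_density mulrAC mulrA.
Qed.

Lemma power_density_ge0 p r : 0 <= power_density p r.
Proof. by rewrite mulr_ge0 ?powR_ge0// indicE. Qed.

Lemma measurable_power_density p : measurable_fun setT (power_density p : measurableTypeR R -> R).
Proof.
apply: measurable_funM; first by apply: measurable_indic; exact: measurable_itv.
exact: measurable_powR.
Qed.

Lemma half_lineP (r : R) : r \in D -> 0 < r.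
Proof. by rewrite inE/= in_itv/= andbT. Qed.

(** The substitution [r = 1 / s] exposes [G (x / s)], the dilation that the multiplication formula
    pairs with [H (s y)]. *)
Lemma mellin_inv p G x : measurable_fun setT G -> (forall x, 0 <= G x) ->
  mellin p G x = (\int[mu]_s (power_density (- p) s * G (s^-1 *: x))%:E)%E.
Proof.
move=> mG G0; rewrite /mellin -ge0_integral_inversion; last 2 first.
- apply/measurable_EFinP; apply: measurable_funM; last exact: measurable_powR.
  by apply: (measurableT_comp mG); apply: measurable_rV_scale.
- by move=> r; rewrite lee_fin mulr_ge0 ?powR_ge0.
transitivity (\int[mu]_(s in D) (s `^ (- p - 1) * G (s^-1 *: x))%:E)%E.
  apply: eq_integral => s /half_lineP s0; rewrite -EFinM; congr EFin.
  rewrite mulrCA mulrC; congr (_ * _).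
  rewrite -[s^-1]powR_inv1 ?(ltW s0)// -powRrM -(powR_invn 2) ?(ltW s0)// -powRD; last first.
    by apply/implyP => _; exact: lt0r_neq0.
  by congr (_ `^ _); ring.
rewrite integral_half_line; apply: eq_integral => s _.
by rewrite /power_density mulrA.
Qed.

Lemma measurable_mellin_kernel p G : measurable_fun setT G ->
  measurable_fun setT (fun z : 'rV[R]_n * measurableTypeR R => power_density p z.2 * G (z.2 *: z.1)).
Proof.
move=> mG; apply: measurable_funM.
  by apply: (measurableT_comp (measurable_power_density p)).
by apply: (measurableT_comp mG); apply: measurable_rV_scale.
Qed.

Lemma measurable_mellin p G : measurable_fun setT G -> (forall x, 0 <= G x) ->
  measurable_fun setT (mellin p G).
Proof.
move=> mG G0; rewrite (_ : mellin p G = fun x => (\int[mu]_r (power_density p r * G (r *: x))%:E)%E); last first.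
  by apply/funext => x; rewrite mellinE.
apply: (measurable_tonelli1 mu (f := fun (x : 'rV[R]_n) (r : measurableTypeR R) => (power_density p r * G (r *: x))%:E)).
  by apply/measurable_EFinP; exact: measurable_mellin_kernel.
by move=> x r; rewrite lee_fin mulr_ge0 ?power_density_ge0.
Qed.

Lemma mellin_ge0 p G x : (forall x, 0 <= G x) -> (0 <= mellin p G x)%E.
Proof.
by move=> G0; apply: integral_ge0 => r _; rewrite lee_fin mulr_ge0 ?powR_ge0.
Qed.

Lemma mellinN p G x : (forall x, G (- x) = G x) -> mellin p G (- x) = mellin p G x.
Proof. by move=> GN; apply: eq_integral => r _; rewrite scalerN GN. Qed.

Lemma integral1y_powR q : 0 < q ->
  (\int[mu]_(r in `[1%R, +oo[) (r `^ (- q - 1))%:E = (q^-1)%:E)%E.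
Proof.
move=> q0; pose F (r : R) := - q^-1 * r `^ (- q).
have dF (r : R) : 0 < r -> is_derive r 1 F (r `^ (- q - 1)).
  move=> r0; have dp := is_derive1_powR (- q) r0.
  have -> : F = (fun t : R => (- q^-1) *: (t `^ (- q))) by [].
  apply: is_derive_eq; rewrite /GRing.scale/=.
  by rewrite mulrA mulrNN mulVf ?mul1r// gt_eqF.
have cF (r : R) : 0 < r -> {for r, continuous F}.
  move=> r0; apply: differentiable_continuous; apply/derivable1_diffP.
  by have [] := dF _ r0.
have cf (r : R) : 0 < r -> {for r, continuous (fun r : R => r `^ (- q - 1))}.
  move=> r0; apply: differentiable_continuous; apply/derivable1_diffP.
  by apply: derivable_powR; rewrite in_itv/= r0.
rewrite (ge0_continuous_FTC2y (F := F) (l := 0)).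
- by rewrite /F powR1 mulr1 -EFinB sub0r opprK.
- by move=> r _; exact: powR_ge0.
- apply/continuous_within_itvcyP; split.
    by move=> r; rewrite in_itv/= andbT => r1; apply: cf; exact: lt_trans r1.
  by apply: cvg_at_right_filter; exact: cf.
- rewrite /F -[X in _ --> X](mulr0 (- q^-1)); apply: cvgMr.
  apply/cvgrPdist_le => /= e e0; near=> r.
  have r0 : 0 < r by [].
  rewrite sub0r normrN ger0_norm ?powR_ge0// powRN -[leRHS]invrK lef_pV2 ?posrE ?invr_gt0 ?powR_gt0//.
  rewrite -[leLHS]powRr1 ?invr_ge0 ?(ltW e0)// -[X in _ `^ X](mulVf (lt0r_neq0 q0)) powRrM.
  apply: ge0_ler_powR; rewrite ?nnegrE ?powR_ge0 ?(ltW q0) ?(ltW r0)//.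
- by move=> r r1; have [] := dF _ (lt_trans ltr01 r1).
- by apply: cvg_at_right_filter; exact: cF.
- move=> r; rewrite in_itv/= andbT => r1; rewrite derive1E.
  by have [_ ->] := dF _ (lt_trans ltr01 r1).
Unshelve. all: by end_near. Qed.

(** Inversion carries the possible singularity at 0 to infinity, where the tail integral is already
    known. *)
Lemma integral01_powR p : 0 < p ->
  (\int[mu]_(r in D) (\1_(`]0%R, 1%R] : set R) r * r `^ (p - 1))%:E = (p^-1)%:E)%E.
Proof.
move=> p0; rewrite -ge0_integral_inversion; last 2 first.
- apply/measurable_EFinP; apply: measurable_funM; last exact: measurable_powR.
  by apply: measurable_indic; exact: measurable_itv.
- by move=> r; rewrite lee_fin mulr_ge0 ?powR_ge0// indicE.
rewrite -(integral1y_powR p0) [RHS]integral_mkcond [LHS]integral_mkcond.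
apply: eq_integral => s _; rewrite !patchE !mem_setE !in_itv/= !andbT.
have [s0|s0] := ltP 0 s; last by rewrite ifN// -ltNge (le_lt_trans s0).
rewrite indicE mem_setE in_itv/= invr_gt0 s0/= invf_le1//.
case: ifPn => s1; last by rewrite mul0r mule0.
rewrite mul1r -EFinM; congr EFin.
rewrite -[s^-1]powR_inv1 ?(ltW s0)// -powRrM -(powR_invn 2) ?(ltW s0)// -powRD; last first.
  by apply/implyP => _; exact: lt0r_neq0.
by congr (_ `^ _); ring.
Qed.

Section integrability.
Variables (p : R) (G : 'rV[R]_n -> R) (A : R).
Hypotheses (p_gt0 : 0 < p) (p_ltn : p < n%:R).
Hypotheses (mG : measurable_fun setT G) (G0 : forall x, 0 <= G x) (GA : forall x, G x <= A).
Hypothesis iG : lam.-integrable setT (EFin \o G).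

(** Tonelli, then a split at [r = 1]. For [r <= 1], [G <= A] and the mass of [cauchy] leave r^(p-1),
    integrable at 0 as [0 < p]. For [r > 1], [cauchy <= 1] and scaling by [r ^- n] leave r^(p-n-1),
    integrable at infinity as [p < n]. *)
Lemma mellin_cauchy_lty : (\int[lam]_x (mellin p G x * (cauchy x)%:E) < +oo)%E.
Proof.
have A0 : 0 <= A by exact: le_trans (GA 0).
have cauchy0 (x : 'rV[R]_n) : 0 <= cauchy x by rewrite ltW// cauchy_gt0.
pose f (x : 'rV[R]_n) (r : measurableTypeR R) := (power_density p r * G (r *: x) * cauchy x)%:E.
have f0 x r : (0 <= f x r)%E by rewrite lee_fin mulr_ge0// mulr_ge0// power_density_ge0.
have mf : measurable_fun setT (fun z : 'rV[R]_n * measurableTypeR R => f z.1 z.2).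
  apply/measurable_EFinP; apply: measurable_funM; first exact: measurable_mellin_kernel.
  by apply: (measurableT_comp (@measurable_cauchy R n)).
have -> : (\int[lam]_x (mellin p G x * (cauchy x)%:E) = \int[lam]_x \int[mu]_r f x r)%E.
  apply: eq_integral => x _; rewrite mellinE -ge0_integralZr//.
  - apply/measurable_EFinP; exact: (measurable_fun_pair2 x (measurable_mellin_kernel p mG)).
  - by move=> r _; rewrite lee_fin mulr_ge0 ?power_density_ge0.
  - by rewrite lee_fin.
rewrite tonelli//.
pose B := \int[lam]_x G x.
have BE : (\int[lam]_x (G x)%:E = B%:E)%E by rewrite /B /Rintegral fineK// integrable_fin_num.
have B0 : 0 <= B by apply: Rintegral_ge0.
pose k (r : measurableTypeR R) := ((A * pi ^+ n)%:E * (\1_D r * (\1_(`]0%R, 1%R] : set R) r * r `^ (p - 1)))%:E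
  + B%:E * (\1_(`[1%R, +oo[ : set R) r * r `^ (p - n%:R - 1))%:E)%E.
have m1 : measurable_fun setT (fun r : measurableTypeR R => \1_D r * (\1_(`]0%R, 1%R] : set R) r * r `^ (p - 1))).
  apply: measurable_funM; first by apply: measurable_indic; exact: measurable_itv.
  apply: measurable_funM; last exact: measurable_powR.
  by apply: measurable_indic; exact: measurable_itv.
have m2 : measurable_fun setT (fun r : measurableTypeR R => \1_(`[1%R, +oo[ : set R) r * r `^ (p - n%:R - 1)).
  apply: measurable_funM; last exact: measurable_powR.
  by apply: measurable_indic; exact: measurable_itv.
have pi0 : 0 <= pi ^+ n :> R by rewrite exprn_ge0// pi_ge0.
have k0 r : (0 <= k r)%E.
  by rewrite adde_ge0// -EFinM lee_fin !mulr_ge0 ?powR_ge0 ?indicE.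
have mk : measurable_fun setT k.
  apply: emeasurable_funD; apply: emeasurable_funM => //; exact/measurable_EFinP.
apply: (@le_lt_trans _ _ (\int[mu]_r k r)%E).
  apply: ge0_le_integral => //.
  - by move=> r _; apply: integral_ge0.
  - exact: measurable_tonelli2.
  move=> r _; have [r0|r0] := ltP 0 r; last first.
    rewrite integral0_eq//; move=> x _; rewrite /f /power_density indicE memNset ?mul0r//=.
    by rewrite in_itv/= andbT; apply/negP; rewrite -leNgt.
  have wE : power_density p r = r `^ (p - 1).
    by rewrite /power_density indicE mem_set ?mul1r//= in_itv/= r0.
  have i0 : (\int[lam]_x f x r = (r `^ (p - 1))%:E * \int[lam]_x (G (r *: x) * cauchy x)%:E)%E.
    rewrite -ge0_integralZl_EFin ?powR_ge0//.
    - by apply: eq_integral => x _; rewrite /f wE -EFinM mulrA.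
    - by move=> x _; rewrite lee_fin mulr_ge0.
    - apply/measurable_EFinP; apply: measurable_funM; last exact: measurable_cauchy.
      by apply: (measurableT_comp mG); exact: measurable_rVZ.
  have mGr : measurable_fun setT (fun x : 'rV[R]_n => G (r *: x)).
    by apply: (measurableT_comp mG); exact: measurable_rVZ.
  have mGc : measurable_fun setT (fun x : 'rV[R]_n => G (r *: x) * cauchy x).
    by apply: measurable_funM => //; exact: measurable_cauchy.
  rewrite i0; have [r1|r1] := leP r 1.
    apply: (@le_trans _ _ ((A * pi ^+ n)%:E * (\1_D r * (\1_(`]0%R, 1%R] : set R) r * r `^ (p - 1)))%:E)%E); last first.
      by rewrite /k leeDl// -EFinM lee_fin !mulr_ge0 ?powR_ge0 ?indicE.
    rewrite !indicE !mem_set/= ?in_itv/= ?r0 ?r1// !mul1r muleC.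
    rewrite lee_wpmul2r ?lee_fin ?powR_ge0// EFinM -integral_cauchy -ge0_integralZl_EFin//; last 2 first.
    - by move=> x _; rewrite lee_fin.
    - by apply/measurable_EFinP; exact: measurable_cauchy.
    apply: ge0_le_integral => //.
    - by move=> x _; rewrite lee_fin mulr_ge0.
    - exact/measurable_EFinP.
    - by apply/measurable_EFinP; apply: measurable_funM => //; exact: measurable_cauchy.
    - by move=> x _; rewrite -EFinM lee_fin ler_wpM2r.
  apply: (@le_trans _ _ (B%:E * (\1_(`[1%R, +oo[ : set R) r * r `^ (p - n%:R - 1))%:E)%E); last first.
    by rewrite /k leeDr// -EFinM lee_fin !mulr_ge0 ?powR_ge0 ?indicE.
  rewrite indicE mem_set/= ?in_itv/= ?(ltW r1)// mul1r.
  apply: (@le_trans _ _ ((r `^ (p - 1))%:E * \int[lam]_x (G (r *: x + 0))%:E)%E).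
    rewrite lee_wpmul2l ?lee_fin ?powR_ge0//; apply: ge0_le_integral => //.
    - by move=> x _; rewrite lee_fin mulr_ge0.
    - exact/measurable_EFinP.
    - by under eq_fun do rewrite addr0; exact/measurable_EFinP.
    - by move=> x _; rewrite addr0 lee_fin ler_piMr// cauchy_le1.
  rewrite (ge0_integral_rV_affine (f := EFin \o G) 0 (lt0r_neq0 r0))//; last exact/measurable_EFinP.
  rewrite [X in (_ * (_ * X))%E]BE -!EFinM lee_fin gtr0_norm// mulrA mulrC ler_wpM2l//.
  rewrite -powR_invn ?(ltW r0)// -powRD; last by apply/implyP => _; exact: lt0r_neq0.
  by rewrite (_ : p - 1 - n%:R = p - n%:R - 1)//; ring.
rewrite /k ge0_integralD//; last 4 first.
- by move=> r _; rewrite -EFinM lee_fin !mulr_ge0 ?powR_ge0 ?indicE.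
- by apply: emeasurable_funM => //; exact/measurable_EFinP.
- by move=> r _; rewrite -EFinM lee_fin !mulr_ge0 ?powR_ge0 ?indicE.
- by apply: emeasurable_funM => //; exact/measurable_EFinP.
rewrite !ge0_integralZl_EFin// ?mulr_ge0//; last 4 first.
- by move=> r _; rewrite lee_fin mulr_ge0 ?powR_ge0 ?indicE.
- exact/measurable_EFinP.
- by move=> r _; rewrite lee_fin !mulr_ge0 ?powR_ge0 ?indicE.
- exact/measurable_EFinP.
rewrite -integral_half_line integral01_powR//.
have q0 : 0 < n%:R - p by rewrite subr_gt0.
have -> : (\int[mu]_r (\1_(`[1%R, +oo[ : set R) r * r `^ (p - n%:R - 1))%:E = (n%:R - p)^-1%:E)%E.
  rewrite -(integral1y_powR q0) [RHS]integral_mkcond; apply: eq_integral => r _.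
  rewrite patchE indicE opprB.
  by case: (r \in `[1, +oo[%classic); rewrite ?mul1r ?mul0r.
by rewrite -!EFinM -EFinD ltry.
Qed.

Lemma integrable_mellin_cauchy : lam.-integrable setT (fun x => mellin p G x * (cauchy x)%:E)%E.
Proof.
apply/integrableP; split.
  apply: emeasurable_funM; first exact: measurable_mellin.
  by apply/measurable_EFinP; exact: measurable_cauchy.
under eq_integral do rewrite gee0_abs ?mule_ge0 ?mellin_ge0 ?lee_fin ?(ltW (cauchy_gt0 _))//.
exact: mellin_cauchy_lty.
Qed.

Lemma integrable_mellin_mul (u : 'rV[R]_n -> R) c : measurable_fun setT u ->
  (forall x, `|u x| <= c * cauchy x) ->
  lam.-integrable setT (fun x => mellin p G x * (u x)%:E)%E.
Proof.
move=> mu uc; apply: (le_integrable measurableT _ _ (integrableZl measurableT c integrable_mellin_cauchy)).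
  by apply: emeasurable_funM; [exact: measurable_mellin|exact/measurable_EFinP].
move=> x _; rewrite !abseM (gee0_abs (mellin_ge0 p x G0)) muleCA.
rewrite lee_wpmul2l ?mellin_ge0// -abseM -EFinM /= lee_fin.
by rewrite (le_trans (uc x))// ler_norm.
Qed.

End integrability.
End mellin.

(** The integral may be [+oo] and [c] negative, which occurs along rays where a radial integral
    diverges. *)
Lemma ge0_integral_mulr d (T : measurableType d) (R : realType)
    (m : {measure set T -> \bar R}) (a : T -> R) (c : R) :
  measurable_fun setT a -> (forall t, 0 <= a t) ->
  (\int[m]_t (a t * c)%:E = (\int[m]_t (a t)%:E) * c%:E)%E.
Proof.
have pos (b : R) : measurable_fun setT a -> (forall t, 0 <= a t) -> 0 <= b ->
    (\int[m]_t (a t * b)%:E = (\int[m]_t (a t)%:E) * b%:E)%E.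
  move=> ma a0 b0; rewrite -ge0_integralZr ?lee_fin//; first exact/measurable_EFinP.
  by move=> t _; rewrite lee_fin.
move=> ma a0; have [c0|c0] := leP 0 c; first exact: pos.
rewrite -[c]opprK; under eq_integral do rewrite mulrN EFinN.
rewrite integral_ge0N; last by move=> t _; rewrite lee_fin mulr_ge0// oppr_ge0 ltW.
by rewrite pos ?oppr_ge0 ?(ltW c0)// -muleN -EFinN.
Qed.

(** As [K] is nonnegative, integrating [|K x y * v x|] in [y] gives the norm of the outer integrand,
    so the assumed integrability is exactly that of the double integral. *)
Lemma Fubini_mulr d1 d2 (T1 : measurableType d1) (T2 : measurableType d2) (R : realType)
    (m1 : {sigma_finite_measure set T1 -> \bar R})
    (m2 : {sigma_finite_measure set T2 -> \bar R}) (K : T1 -> T2 -> R) (v : T1 -> R) :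
  measurable_fun setT (fun z : T1 * T2 => K z.1 z.2) -> (forall x y, 0 <= K x y) ->
  measurable_fun setT v ->
  m1.-integrable setT (fun x => (\int[m2]_y (K x y)%:E) * (v x)%:E)%E ->
  (\int[m1]_x ((\int[m2]_y (K x y)%:E) * (v x)%:E) =
   \int[m2]_y \int[m1]_x (K x y * v x)%:E)%E.
Proof.
move=> mK K0 mv iKv.
have mK1 x : measurable_fun setT (K x) by exact: (measurable_fun_pair2 x mK).
have mKv : measurable_fun setT (fun z : T1 * T2 => K z.1 z.2 * v z.1).
  by apply: measurable_funM => //; exact: measurableT_comp.
have iprod : (m1 \x m2)%E.-integrable setT (fun z : T1 * T2 => (K z.1 z.2 * v z.1)%:E).
  apply/integrable12ltyP; first exact/measurable_EFinP.
  have /integrableP[_] := iKv; congr (_ < _)%E; apply: eq_integral => x _.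
  rewrite abseM gee0_abs; last by apply: integral_ge0 => y _; rewrite lee_fin.
  rewrite -ge0_integral_mulr//; apply: eq_integral => y _ /=.
  by rewrite normrM ger0_norm.
rewrite -(Fubini iprod); apply: eq_integral => x _.
by rewrite -ge0_integral_mulr.
Qed.

(** * Duality of radial integrals from a pairing at each scale *)

Section mellin_duality.
Context {R : realType} (n : nat).
Local Notation mu := (@lebesgue_measure R).
Local Notation lam := (lebesgue_rV R n).
Variables (p : R) (G H u U : 'rV[R]_n -> R) (A B c : R).
Hypotheses (p_gt0 : 0 < p) (p_ltn : p < n%:R).
Hypotheses (mG : measurable_fun setT G) (G0 : forall x, 0 <= G x) (GA : forall x, G x <= A)
  (iG : lam.-integrable setT (EFin \o G)).
Hypotheses (mH : measurable_fun setT H) (H0 : forall x, 0 <= H x) (HB : forall x, H x <= B)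
  (iH : lam.-integrable setT (EFin \o H)).
Hypotheses (mu : measurable_fun setT u) (uc : forall x, `|u x| <= c * cauchy x).
Hypotheses (mU : measurable_fun setT U) (Uc : forall x, `|U x| <= c * cauchy x).
Hypothesis pairing : forall s, 0 < s ->
  \int[lam]_x (G (s^-1 *: x) * U x) = s ^+ n * \int[lam]_y (H (s *: y) * u y).

Let integrable_dilate_mul (F v : 'rV[R]_n -> R) (b s : R) :
  measurable_fun setT F -> (forall x, 0 <= F x) -> (forall x, F x <= b) ->
  measurable_fun setT v -> (forall x, `|v x| <= c * cauchy x) ->
  lam.-integrable setT (fun x => (F (s *: x) * v x)%:E).
Proof.
move=> mF F0 Fb mv vc.
apply: (le_integrable measurableT _ _ (integrableZl measurableT (b * c) (@integrable_cauchy R n))).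
  apply/measurable_EFinP; apply: measurable_funM => //.
  by apply: (measurableT_comp mF); exact: measurable_rVZ.
move=> x _ /=; rewrite lee_fin normrM (ger0_norm (F0 _)) -mulrA normrM.
rewrite ler_pM// (le_trans _ (ler_norm _))//.
Qed.

(** After [mellin_inv] and Fubini on both sides, [pairing] is applied under the integral in [s]. Its
    factor [s ^+ n] turns s^(-p-1) into s^(n-p-1), the density of exponent [n - p]. *)
Lemma mellin_duality :
  (\int[lam]_x (mellin p G x * (U x)%:E) = \int[lam]_y (mellin (n%:R - p) H y * (u y)%:E))%E.
Proof.
have q_gt0 : 0 < n%:R - p by rewrite subr_gt0.
have q_ltn : n%:R - p < n%:R by rewrite ltrBlDr ltrDl.
have iGU := integrable_mellin_mul p_gt0 p_ltn mG G0 GA iG mU Uc.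
have iHu := integrable_mellin_mul q_gt0 q_ltn mH H0 HB iH mu uc.
pose K1 (x : 'rV[R]_n) (s : measurableTypeR R) := power_density (- p) s * G (s^-1 *: x).
pose K2 (x : 'rV[R]_n) (s : measurableTypeR R) := power_density (n%:R - p) s * H (s *: x).
have mK1 : measurable_fun setT (fun z : 'rV[R]_n * measurableTypeR R => K1 z.1 z.2).
  apply: measurable_funM.
    by apply: (measurableT_comp (measurable_power_density _)).
  apply: (measurableT_comp mG); apply: measurable_rV_scale => //.
  exact: (measurableT_comp measurable_invr).
have mK2 : measurable_fun setT (fun z : 'rV[R]_n * measurableTypeR R => K2 z.1 z.2).
  exact: measurable_mellin_kernel.
have K10 x s : 0 <= K1 x s by rewrite mulr_ge0// power_density_ge0.
have K20 x s : 0 <= K2 x s by rewrite mulr_ge0// power_density_ge0.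
have E1 : mellin p G = (fun x => \int[@lebesgue_measure R]_s (K1 x s)%:E)%E.
  by apply/funext => x; rewrite mellin_inv.
have E2 : mellin (n%:R - p) H = (fun x => \int[@lebesgue_measure R]_s (K2 x s)%:E)%E.
  by apply/funext => x; rewrite mellinE.
rewrite E1 in iGU *; rewrite E2 in iHu *.
rewrite (Fubini_mulr mK1 K10 mU iGU) (Fubini_mulr mK2 K20 mu iHu).
apply: eq_integral => s _.
have iG' := integrable_dilate_mul s^-1 mG G0 GA mU Uc.
have iH' := integrable_dilate_mul s mH H0 HB mu uc.
rewrite /K1 /K2; under eq_integral do rewrite -mulrA EFinM.
under [RHS]eq_integral do rewrite -mulrA EFinM.
rewrite !integralZl//.
have [s0|s0] := ltP 0 s; last first.
  rewrite /power_density indicE memNset ?mul0r ?mul0e//=.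
  by rewrite in_itv/= andbT; apply/negP; rewrite -leNgt.
have := pairing s0; rewrite /Rintegral.
move: (integrable_fin_num measurableT iG') (integrable_fin_num measurableT iH').
case: (\int[lam]_x (G (s^-1 *: x) * U x)%:E)%E => // a _.
case: (\int[lam]_y (H (s *: y) * u y)%:E)%E => // b _ /= ->.
rewrite -!EFinM mulrA; congr (_ * _)%:E.
rewrite /power_density -mulrA; congr (_ * _).
rewrite -powR_mulrn ?(ltW s0)// -powRD; last by apply/implyP => _; exact: lt0r_neq0.
by congr (_ `^ _); ring.
Qed.

End mellin_duality.

(** * Multiplication formula at one scale, and integrability of a nonnegative transform *)

Section transform_pairing.
Context {R : realType} (n : nat).
Local Notation lam := (lebesgue_rV R n).
Variables (g : 'rV[R]_n -> R) (c A : R).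
Hypotheses (mg : measurable_fun setT g) (gc : forall x, `|g x| <= c * cauchy x)
  (gN : forall x, g (- x) = g x).

Let icW (b : R) : lam.-integrable setT (EFin \o (fun x => b * cauchy x)).
Proof. exact: (integrableZl measurableT b (@integrable_cauchy R n)). Qed.

Let ig : lam.-integrable setT (EFin \o g).
Proof.
apply: (le_integrable measurableT _ _ (icW c)); first exact/measurable_EFinP.
by move=> x _ /=; rewrite lee_fin (le_trans (gc x))// ler_norm.
Qed.

(** Fubini moves the cosine onto [g]; substituting [x = s z] in the inner integral yields [s ^+ n]
    and the frequency [s y]. *)
Lemma cosT_pairing (u : 'rV[R]_n -> R) (b s : R) : 0 < s -> measurable_fun setT u ->
  (forall x, `|u x| <= b * cauchy x) ->
  \int[lam]_x (g (s^-1 *: x) * cosT u x) = s ^+ n * \int[lam]_y (cosT g (s *: y) * u y).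
Proof.
move=> s0 mu uc; have sV0 : s^-1 != 0 by rewrite invr_eq0 gt_eqF.
have igs : lam.-integrable setT (EFin \o (fun x => `|g (s^-1 *: x)|)).
  have := integrable_rV_affine 0 sV0 (integrable_norm ig).
  by apply: eq_integrable => // x _ /=; rewrite addr0.
have iu : lam.-integrable setT (EFin \o u).
  apply: (le_integrable measurableT _ _ (icW b)); first exact/measurable_EFinP.
  by move=> x _ /=; rewrite lee_fin (le_trans (uc x))// ler_norm.
have mgs : measurable_fun setT (fun x : 'rV[R]_n => g (s^-1 *: x)).
  by apply: (measurableT_comp mg); exact: measurable_rVZ.
pose F (x y : 'rV[R]_n) := g (s^-1 *: x) * (cos (dotp x y) * u y).
have mF : measurable_fun setT (fun w : 'rV[R]_n * 'rV[R]_n => F w.1 w.2).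
  apply: measurable_funM; first exact: (measurableT_comp mgs).
  apply: measurable_funM; last exact: measurableT_comp.
  by apply: (measurableT_comp measurable_cos); exact: measurable_dotp.
transitivity (\int[lam]_x \int[lam]_y F x y).
  apply: eq_Rintegral => x _; rewrite -RintegralZl//.
  by apply: integrable_bddM => //; [exact: measurable_cos_dotp|move=> y; exact: cos_max].
rewrite (Rfubini mF igs (icW b)); last first.
  move=> x y; rewrite normrM ler_pM// normrM (le_trans _ (uc y))//.
  by rewrite ler_piMl// cos_max.
rewrite -RintegralZl//; last first.
  have [C hC] : exists C, forall x, `|cosT g x| <= C.
    exists (\int[lam]_y `|g y|) => x.
    have iF : lam.-integrable setT (EFin \o (fun y => cos (dotp x y) * g y)).
      by apply: integrable_bddM => //; [exact: measurable_cos_dotp|move=> y; exact: cos_max].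
    apply: (le_trans (le_normr_Rintegral measurableT iF)).
    apply: le_Rintegral => //; [exact: (integrable_norm iF)|exact: (integrable_norm ig)|].
    by move=> y _; rewrite normrM ler_piMl// cos_max.
  apply: (le_integrable measurableT _ _ (integrableZl measurableT C iu)).
    apply/measurable_EFinP; apply: measurable_funM => //.
    apply: (measurableT_comp (measurable_cosT mg)); exact: measurable_rVZ.
  move=> y _ /=; rewrite lee_fin !normrM ler_wpM2r//.
  by rewrite (le_trans (hC _))// ler_norm.
apply: eq_Rintegral => y _; rewrite mulrA.
have mcg : measurable_fun setT (fun z => cos (dotp (s *: y) z) * g z).
  by apply: measurable_funM => //; exact: measurable_cos_dotp.
have := Rintegral_rV_affine 0 sV0 mcg.
rewrite gtr0_norm ?invr_gt0// exprVn invrK => E.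
rewrite /cosT -E -RintegralZr//; last first.
  apply: integrable_bddM.
  - under eq_fun do rewrite addr0.
    apply: (measurableT_comp (measurable_cos_dotp _)); exact: measurable_rVZ.
  - by move=> z; exact: cos_max.
  - have := integrable_rV_affine 0 sV0 ig.
    by apply: eq_integrable.
apply: eq_Rintegral => x _; rewrite /F addr0.
have -> : dotp (s *: y) (s^-1 *: x) = dotp x y.
  by rewrite dotpZr dotpZl mulrA mulVf ?gt_eqF// mul1r dotpC.
by rewrite mulrCA mulrA.
Qed.

Hypotheses (g0 : forall x, 0 <= g x) (gA : forall x, g x <= A).
Hypothesis Cg0 : forall x, 0 <= cosT g x.

Lemma cosT_le x : cosT g x <= \int[lam]_y g y.
Proof.
apply: le_Rintegral => //.
- by apply: integrable_bddM => //; [exact: measurable_cos_dotp|move=> y; exact: cos_max].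
- by move=> y _; rewrite ler_piMl// cos_le1.
Qed.

(* The Abel means against laplace (e x) are bounded uniformly in e because the
   Poisson-type kernel cosT laplace is nonnegative of total mass (2 pi)^n. *)
Lemma integrable_cosT : lam.-integrable setT (EFin \o cosT g).
Proof.
have mC : measurable_fun setT (cosT g) := measurable_cosT mg.
apply/integrableP; split; first exact/measurable_EFinP.
under eq_integral do rewrite /= (ger0_norm (Cg0 _)).
pose e (k : nat) : R := k.+1%:R^-1.
have e0 k : 0 < e k by rewrite invr_gt0.
pose f k (x : 'rV[R]_n) := (cosT g x * laplace (e k *: x))%:E.
have mf k : measurable_fun setT (f k).
  apply/measurable_EFinP; apply: measurable_funM => //.
  apply: (measurableT_comp (@measurable_laplace R n)); exact: measurable_rVZ.
have f0 k x : (0 <= f k x)%E by rewrite lee_fin mulr_ge0// ltW// laplace_gt0.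
have fcvg x : f k x @[k --> \oo] --> (cosT g x)%:E.
  apply: cvg_EFin; first exact: nearW.
  rewrite -[X in _ --> X]mulr1; apply: cvgMr; exact: laplace_cvg1.
have bound k : (\int[lam]_x f k x <= (A * (2 * pi) ^+ n)%:E)%E.
  pose F (x z : 'rV[R]_n) := laplace (e k *: x) * (cos (dotp x z) * g z).
  have mF : measurable_fun setT (fun w : 'rV[R]_n * 'rV[R]_n => F w.1 w.2).
    apply: measurable_funM.
      apply: (measurableT_comp (@measurable_laplace R n)).
      by apply: (measurableT_comp (measurable_rVZ _)).
    apply: measurable_funM; last exact: measurableT_comp.
    by apply: (measurableT_comp measurable_cos); exact: measurable_dotp.
  have ifk : lam.-integrable setT (f k).
    have ib := integrableZl measurableT (\int[lam]_y g y) (integrable_laplaceZ n (e0 k)).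
    apply: (le_integrable measurableT _ _ ib) => // x _ /=; rewrite lee_fin !normrM ler_wpM2r//.
    by rewrite (ger0_norm (Cg0 _)) (le_trans (cosT_le x))// ler_norm.
  rewrite -[X in (X <= _)%E](fineK (integrable_fin_num measurableT ifk)) lee_fin.
  rewrite [leLHS](_ : _ = \int[lam]_x \int[lam]_z F x z); last first.
    apply: eq_Rintegral => x _; rewrite RintegralZl//; first exact: mulrC.
    by apply: integrable_bddM => //; [exact: measurable_cos_dotp|move=> y; exact: cos_max].
  rewrite (Rfubini mF (integrable_laplaceZ n (e0 k)) (icW c)); last first.
    move=> x z; rewrite normrM ler_pM// ?normrM//.
      by rewrite ger0_norm// ltW// laplace_gt0.
    by rewrite (le_trans _ (gc z))// ler_piMl// cos_max.
  have eV0 : (e k)^-1 != 0 by rewrite invr_eq0 gt_eqF.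
  pose P (z : 'rV[R]_n) := (e k) ^- n * (2 ^+ n * cauchy ((e k)^-1 *: z)).
  have P0 z : 0 <= P z.
    by rewrite mulr_ge0 ?invr_ge0 ?exprn_ge0 ?(ltW (e0 k))// mulr_ge0 ?exprn_ge0// ltW// cauchy_gt0.
  have iP : lam.-integrable setT (EFin \o P).
    have := integrable_rV_affine 0 eV0 (icW (2 ^+ n)).
    move=> /(integrableZl measurableT ((e k) ^- n)).
    by apply: eq_integrable => // z _ /=; rewrite addr0 EFinM.
  have intP : \int[lam]_z P z = (2 * pi) ^+ n.
    rewrite /P RintegralZl//; last first.
      have := integrable_rV_affine 0 eV0 (icW (2 ^+ n)).
      by apply: eq_integrable => // z _ /=; rewrite addr0.
    have mW : measurable_fun setT (fun z : 'rV[R]_n => 2 ^+ n * cauchy z).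
      by apply: measurable_funM => //; exact: measurable_cauchy.
    have := Rintegral_rV_affine 0 eV0 mW.
    under eq_Rintegral do rewrite addr0.
    move=> ->; have en0 : e k ^+ n != 0 by rewrite expf_neq0// gt_eqF.
    rewrite gtr0_norm ?invr_gt0// (exprVn (e k)) (invrK (e k ^+ n)) mulrA (mulVf en0) mul1r.
    rewrite RintegralZl//; last exact: integrable_cauchy.
    by rewrite /Rintegral integral_cauchy exprMn.
  have inner z : \int[lam]_x F x z = g z * P z.
    rewrite /P -cosT_laplaceZ// -RintegralZl//.
      by apply: eq_Rintegral => x _; rewrite /F (dotpC z); ring.
    apply: integrable_bddM; first exact: measurable_cos_dotp.
      by move=> x; exact: cos_max.
    exact: integrable_laplaceZ.
  under eq_Rintegral do rewrite inner.
  have iAP : lam.-integrable setT (EFin \o (fun z => A * P z)) := integrableZl measurableT A iP.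
  rewrite -intP -RintegralZl//; apply: le_Rintegral => //.
    apply: (le_integrable measurableT _ _ iAP).
      apply/measurable_EFinP; apply: measurable_funM => //.
      by have /measurable_int/measurable_EFinP := iP.
    move=> z _ /=; rewrite lee_fin !normrM ler_wpM2r//.
    by rewrite (ger0_norm (g0 z)) (le_trans (gA z))// ler_norm.
  by move=> z _; rewrite ler_wpM2r.
(* Fatou's lemma removes the damping: the integrands converge pointwise to [cosT g] while their
   integrals stay below [A * (2 * pi) ^+ n]. *)
have := @fatou _ _ _ lam _ measurableT f mf (fun k x _ => f0 k x).
rewrite [X in (X <= _)%E -> _](_ : _ = \int[lam]_x (cosT g x)%:E)%E; last first.
  apply: eq_integral => x _; rewrite is_cvg_limn_einfE; last by apply/cvg_ex; eexists; exact: fcvg.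
  by apply/cvg_lim => //; exact: fcvg.
move=> /le_lt_trans; apply.
apply: (@le_lt_trans _ _ (A * (2 * pi) ^+ n)%:E); last exact: ltry.
rewrite limn_einf_lim; apply: lime_le; first exact: is_cvg_einfs.
apply: nearW => k; apply: (le_trans _ (bound k)).
by apply: ereal_inf_lbound; exists k => /=.
Qed.

(** The multiplication formula at scale [s^-1] with [cosT u] in place of [u] creates a double
    transform, which inversion evaluates. Since [g] is even, the even part of [u] may be replaced by
    [u] under the integral. *)
Lemma cosT_pairing_inv (u : 'rV[R]_n -> R) (b s : R) : 0 < s -> continuous u ->
  (forall x, `|u x| <= b * cauchy x) -> (forall x, `|cosT u x| <= b * cauchy x) ->
  \int[lam]_x (cosT g (s^-1 *: x) * cosT u x) =
  s ^+ n * \int[lam]_y ((2 * pi) ^+ n * g (s *: y) * u y).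
Proof.
move=> s0 cu uc Cuc; have mu := continuous_measurable_rV cu.
have sV0 : 0 < s^-1 by rewrite invr_gt0.
have := cosT_pairing sV0 (measurable_cosT mu) Cuc; rewrite invrK => E.
have -> : \int[lam]_x (cosT g (s^-1 *: x) * cosT u x) =
    s ^+ n * \int[lam]_x (g (s *: x) * cosT (cosT u) x).
  by rewrite E mulrA -exprMn divff ?gt_eqF// expr1n mul1r.
congr (_ * _); under eq_Rintegral do rewrite (fourier_inversion cu uc Cuc).
have mgs : measurable_fun setT (fun x : 'rV[R]_n => g (s *: x)).
  by apply: (measurableT_comp mg); exact: measurable_rVZ.
have mgu (v : 'rV[R]_n -> R) : measurable_fun setT v -> measurable_fun setT (fun x : 'rV[R]_n => g (s *: x) * v x).
  exact: measurable_funM.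
have igu (v : 'rV[R]_n -> R) : measurable_fun setT v -> (forall x, `|v x| <= b * cauchy x) ->
    lam.-integrable setT (EFin \o (fun x : 'rV[R]_n => g (s *: x) * v x)).
  move=> mv vb; apply: (le_integrable measurableT _ _ (icW (A * b))).
    by apply/measurable_EFinP; exact: mgu.
  move=> x _ /=; rewrite lee_fin (le_trans _ (ler_norm _))// normrM (ger0_norm (g0 _)) -mulrA.
  by rewrite ler_pM.
have mun : measurable_fun setT (fun x : 'rV[R]_n => u (- x)).
  rewrite (_ : (fun x => _) = u \o (fun x : 'rV[R]_n => -1 *: x)).
    exact: (measurableT_comp mu (measurable_rVZ _)).
  by apply/funext => x /=; rewrite scaleN1r.
have cauchyN (x : 'rV[R]_n) : cauchy (- x) = cauchy x.
  by apply: eq_bigr => i _; rewrite /cauchy1 mxE sqrrN.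
have i1 := igu u mu uc.
have i2 : lam.-integrable setT (EFin \o (fun x : 'rV[R]_n => g (s *: x) * u (- x))).
  by apply: igu => // x; rewrite -cauchyN.
have n10 : -1 != 0 :> R by rewrite oppr_eq0 oner_eq0.
have sym : \int[lam]_x (g (s *: x) * u (- x)) = \int[lam]_x (g (s *: x) * u x).
  have := Rintegral_rV_affine 0 n10 (mgu _ mu).
  rewrite normrN1 expr1n invr1 mul1r => <-; apply: eq_Rintegral => x _.
  by rewrite addr0 scaleN1r scalerN gN.
transitivity (\int[lam]_x ((2 * pi) ^+ n / 2 * (g (s *: x) * u x + g (s *: x) * u (- x)))).
  by apply: eq_Rintegral => x _; ring.
rewrite RintegralZl//; last exact: (integrableD measurableT i1 i2).
rewrite RintegralD// sym.
under [RHS]eq_Rintegral do rewrite -mulrA.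
by rewrite [RHS]RintegralZl//; field.
Qed.

End transform_pairing.

(** * Covariograms *)

Section convex_bodies.
Context {R : realType} (n : nat).
Local Notation lam := (lebesgue_rV R n).
Variable K : set 'rV[R]_n.
Hypothesis hK : convex_body K.

Let cK : compact K. Proof. by case: hK. Qed.

Lemma body_closed : closed K.
Proof. by apply: compact_closed => //; exact: norm_hausdorff. Qed.

Lemma body_measurable : measurable K.
Proof.
rewrite -[K]setCK; apply: measurableC; apply: open_measurable_rV.
exact: closed_openC body_closed.
Qed.

Lemma body_bounded : exists2 M : R, 0 < M & forall x, K x -> forall i, `|x ord0 i| <= M.
Proof.
have [M [_ HM]] := compact_bounded cK.
exists (Num.max 1 (M + 1)); first by rewrite lt_max ltr01.
move=> x Kx i; apply: (@le_trans _ _ `|x|).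
  rewrite [leRHS]mx_normrE; exact: (le_bigmax _ (fun ij => `|x ij.1 ij.2|) (ord0, i)).
by rewrite (HM (Num.max 1 (M + 1)))// lt_max ltrDl ltr01 orbT.
Qed.

Lemma body_interior : exists x0 : 'rV[R]_n, exists2 e : R, 0 < e & ball x0 e `<=` K.
Proof.
have [_ _ [x0]] := hK; rewrite /interior => /nbhs_ballP[e /= e0 eK].
by exists x0, e.
Qed.

Lemma body_lty : (lam K < +oo)%E.
Proof.
have [M M0 KM] := body_bounded.
pose B : set 'rV[R]_n := [set x | forall i, (`[- M, M]%classic : set R) (x ord0 i)].
have BE : lam B = (\prod_(i < n) (M *+ 2)%:E)%E.
  rewrite (lebesgue_rV_box (A := fun _ => `[- M, M]%classic)); last by move=> i; exact: measurable_itv.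
  apply: eq_bigr => i _; rewrite lebesgue_measure_itv/= lte_fin gtrN// -EFinB.
  by rewrite opprK mulr2n.
have mB : measurable B.
  rewrite (_ : B = \bigcap_(i in [set: 'I_n])
      ((fun x : 'rV[R]_n => x ord0 i) @^-1` (`[- M, M]%classic : set R))); last first.
    by apply/seteqP; split => x h i //=; [move=> _; exact: h|exact: (h i I)].
  apply: fin_bigcap_measurable => // i _; rewrite -[X in measurable X]setTI.
  by apply: measurable_coor => //; exact: measurable_itv.
apply: (@le_lt_trans _ _ (lam B)).
  apply: le_measure; rewrite ?inE//; first exact: body_measurable.
  by move=> x Kx i /=; rewrite in_itv/= -ler_norml; exact: KM.
by rewrite BE prodEFin ltry.
Qed.

Lemma body_gt0 : (0 < lam K)%E.
Proof.
have [x0 [e e0 eK]] := body_interior.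
pose B : set 'rV[R]_n := [set x | forall i, (`]x0 ord0 i - e, x0 ord0 i + e[%classic : set R) (x ord0 i)].
have BE : lam B = (\prod_(i < n) (e *+ 2)%:E)%E.
  rewrite (lebesgue_rV_box (A := fun i => `]x0 ord0 i - e, x0 ord0 i + e[%classic)); last first.
    by move=> i; exact: measurable_itv.
  apply: eq_bigr => i _; rewrite lebesgue_measure_itv/= lte_fin ifT; last by lra.
  by rewrite -EFinB; congr EFin; ring.
have mB : measurable B.
  rewrite (_ : B = \bigcap_(i in [set: 'I_n]) ((fun x : 'rV[R]_n => x ord0 i) @^-1`
      (`]x0 ord0 i - e, x0 ord0 i + e[%classic : set R))); last first.
    by apply/seteqP; split => x h i //=; [move=> _; exact: h|exact: (h i I)].
  apply: fin_bigcap_measurable => // i _; rewrite -[X in measurable X]setTI.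
  by apply: measurable_coor => //; exact: measurable_itv.
apply: (@lt_le_trans _ _ (lam B)).
  by rewrite BE prodEFin lte_fin prodr_gt0// => i _; rewrite pmulrn_lgt0.
apply: le_measure; rewrite ?inE//; first exact: body_measurable.
move=> x Bx; apply: eK; split=> // i j; rewrite (ord1 i) -[0]/(ord0 : 'I_1) /ball/=.
have := Bx j; rewrite /= in_itv/= => /andP[h1 h2]; rewrite ltr_norml.
by move: h1 h2; move: (x0 ord0 j) (x ord0 j) => a b h1 h2; apply/andP; split; lra.
Qed.

Lemma volumeE : lam K = (volume K)%:E.
Proof. by rewrite /volume fineK// ge0_fin_numE ?body_lty. Qed.

Lemma volume_gt0 : 0 < volume K.
Proof. by rewrite -lte_fin -volumeE body_gt0. Qed.

Definition body_indic (x : 'rV[R]_n) : R := \1_K x.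
Local Notation chi := body_indic.

Lemma measurable_body_indic : measurable_fun setT chi.
Proof. by apply: measurable_indic; exact: body_measurable. Qed.

Lemma body_indic01 x : 0 <= chi x <= 1.
Proof. by rewrite /chi indicE; case: (x \in K); rewrite /= ?lexx ?ler01. Qed.

Lemma integrable_body_indic : lam.-integrable setT (EFin \o chi).
Proof.
apply/integrableP; split; first by apply/measurable_EFinP; exact: measurable_body_indic.
under eq_integral => x _ do rewrite /= ger0_norm ?(andP (body_indic01 x)).1//.
by rewrite integral_indic// ?setIT ?body_lty//; exact: body_measurable.
Qed.

Lemma measurable_subr (x : 'rV[R]_n) : measurable_fun setT (fun y : 'rV[R]_n => y - x).
Proof. by apply: measurable_rV_add. Qed.

Lemma covariogramE x : covariogram K x = \int[lam]_y (chi y * chi (y - x)).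
Proof.
rewrite /covariogram /volume /Rintegral; congr fine.
have -> : [set y + x | y in K] = (fun z => z - x) @^-1` K.
  apply/seteqP; split => [_ [y Ky <-]|z Kz] /=; first by rewrite addrK.
  by exists (z - x) => //; rewrite subrK.
have mKx : measurable ((fun z : 'rV[R]_n => z - x) @^-1` K).
  rewrite -[X in measurable X]setTI; apply: measurable_subr => //; exact: body_measurable.
rewrite -[X in lam X]setIT -integral_indic//; last exact: measurableI body_measurable mKx.
apply: eq_integral => y _; congr EFin; rewrite indicI /=; congr (_ * _).
Qed.

Lemma covariogram_ge0 x : 0 <= covariogram K x.
Proof. by rewrite /covariogram /volume fine_ge0. Qed.

Let mchi2 : measurable_fun setT (fun z : 'rV[R]_n * 'rV[R]_n => chi z.2 * chi (z.2 - z.1)).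
Proof.
apply: measurable_funM; first exact: (measurableT_comp measurable_body_indic).
apply: (measurableT_comp measurable_body_indic).
have -> : (fun z : 'rV[R]_n * 'rV[R]_n => z.2 - z.1) = (fun z => z.2 + (-1) *: z.1).
  by apply/funext => z; rewrite scaleN1r.
by apply: measurable_rV_add => //; apply: measurable_rV_scale.
Qed.

Lemma measurable_covariogram : measurable_fun setT (covariogram K).
Proof.
rewrite (_ : covariogram K = fun x => \int[lam]_y (chi y * chi (y - x))); last first.
  by apply/funext => x; rewrite covariogramE.
exact: (measurable_Rintegral1 _ (f := fun x y : 'rV[R]_n => chi y * chi (y - x))).
Qed.

Lemma integrable_covariogram_kernel x : lam.-integrable setT (fun y => (chi y * chi (y - x))%:E).
Proof.
apply: (le_integrable measurableT _ _ integrable_body_indic).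
  by apply/measurable_EFinP; exact: (measurable_fun_pair2 x mchi2).
move=> y _ /=; rewrite lee_fin normrM ler_piMr//.
by rewrite ger0_norm ?(andP (body_indic01 _)).1// (andP (body_indic01 _)).2.
Qed.

Lemma Rintegral_body_indic : \int[lam]_y chi y = volume K.
Proof.
rewrite /Rintegral integral_indic//; last exact: body_measurable.
by rewrite setIT.
Qed.

Lemma covariogram_le x : covariogram K x <= volume K.
Proof.
rewrite covariogramE -Rintegral_body_indic; apply: le_Rintegral => //.
- exact: integrable_covariogram_kernel.
- exact: integrable_body_indic.
- move=> y _; rewrite ler_piMr ?(andP (body_indic01 _)).1//.
  exact: (andP (body_indic01 _)).2.
Qed.

Lemma covariogramN x : covariogram K (- x) = covariogram K x.
Proof.
have mm := measurable_fun_pair2 (- x) mchi2.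
rewrite !covariogramE -[RHS]mul1r.
have := Rintegral_rV_affine (- x) (oner_neq0 R) mm.
rewrite normr1 expr1n invr1 mul1r => <-; rewrite mul1r.
by apply: eq_Rintegral => y _ /=; rewrite scale1r opprK subrK mulrC.
Qed.

Lemma covariogram_support : exists2 M : R, 0 < M &
  forall x y, chi y * chi (y - x) != 0 -> forall i, `|x ord0 i| <= M.
Proof.
have [M M0 KM] := body_bounded; exists (M + M); first exact: addr_gt0.
have chi_neq0 x : chi x != 0 -> K x.
  by rewrite /body_indic indicE; case: (boolP (x \in K)) => [/set_mem//|_]; rewrite eqxx.
move=> x y; rewrite mulf_eq0 negb_or => /andP[/chi_neq0 Ky /chi_neq0 Kyx] i.
have -> : x ord0 i = y ord0 i - (y - x) ord0 i by rewrite !mxE opprB addrC subrK.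
by rewrite (le_trans (ler_normB _ _))// lerD// KM.
Qed.

(** Where the kernel is nonzero all coordinates of [x] are at most [M], so [cauchy x] is at least
    [(1 + M ^+ 2) ^- n]. Keeping [chi y] on the right gives the product majorant that Fubini
    requires. *)
Lemma covariogram_kernel_le : exists2 c, 0 <= c &
  forall x y, chi y * chi (y - x) <= c * cauchy x * chi y.
Proof.
have [M M0 KM] := covariogram_support.
exists ((1 + M ^+ 2) ^+ n); first by rewrite exprn_ge0// addr_ge0// sqr_ge0.
move=> x y; have y0 := (andP (body_indic01 y)).1.
have [->|/KM xM] := eqVneq (chi y * chi (y - x)) 0.
  by rewrite mulr_ge0// mulr_ge0 ?exprn_ge0 ?addr_ge0 ?sqr_ge0// ltW// cauchy_gt0.
rewrite mulrC ler_wpM2r// (le_trans (andP (body_indic01 _)).2)//.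
have -> : (1 + M ^+ 2) ^+ n = \prod_(i < n) (1 + M ^+ 2) by rewrite prodr_const card_ord.
rewrite /cauchy /prod_rV -big_split/= [leLHS](_ : 1 = \prod_(i < n) 1); last by rewrite big1.
apply: ler_prod => i _; rewrite ler01/= /cauchy1 ler_pdivlMr ?ltr_pwDl ?sqr_ge0// mul1r lerD2l.
by rewrite -[x ord0 i ^+ 2]real_normK ?num_real// ler_pXn2r ?nnegrE// ltW.
Qed.

Lemma covariogram_bound : exists c, forall x, `|covariogram K x| <= c * cauchy x.
Proof.
have [c c0 hc] := covariogram_kernel_le; exists (c * volume K) => x.
rewrite ger0_norm ?covariogram_ge0// covariogramE mulrAC -Rintegral_body_indic.
rewrite -RintegralZl//; last exact: integrable_body_indic.
apply: le_Rintegral => //; first exact: integrable_covariogram_kernel.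
exact: (integrableZl measurableT _ integrable_body_indic).
Qed.

(** The Wiener-Khinchin identity in real form. After Fubini, replacing [x] by [y - x] separates the
    two indicators, and the addition formula for [cos (xi.(y - x))] produces the two squares. *)
Lemma cosT_covariogram xi : cosT (covariogram K) xi = cosT chi xi ^+ 2 + sinT chi xi ^+ 2.
Proof.
have [c c0 hc] := covariogram_kernel_le.
pose F (x y : 'rV[R]_n) := cos (dotp xi x) * (chi y * chi (y - x)).
have mF : measurable_fun setT (fun w : 'rV[R]_n * 'rV[R]_n => F w.1 w.2).
  by apply: measurable_funM => //; apply: (measurableT_comp (measurable_cos_dotp xi)).
have icW : lam.-integrable setT (EFin \o (fun x => c * cauchy x)).
  exact: (integrableZl measurableT c (@integrable_cauchy R n)).
have ichi := integrable_body_indic.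
have mchi := measurable_body_indic.
have ic w : lam.-integrable setT (EFin \o (fun y => cos (dotp w y) * chi y)).
  by apply: integrable_bddM => //; [exact: measurable_cos_dotp|move=> y; exact: cos_max].
have is_ w : lam.-integrable setT (EFin \o (fun y => sin (dotp w y) * chi y)).
  by apply: integrable_bddM => //; [exact: measurable_sin_dotp|move=> y; exact: sin_max].
transitivity (\int[lam]_x \int[lam]_y F x y).
  apply: eq_Rintegral => x _; rewrite covariogramE RintegralZl//.
  exact: integrable_covariogram_kernel.
rewrite (Rfubini mF icW ichi); last first.
  move=> x y; have k0 : 0 <= chi y * chi (y - x) by rewrite mulr_ge0// (andP (body_indic01 _)).1.
  by rewrite /F normrM (ger0_norm k0) (le_trans _ (hc x y))// ler_piMl// cos_max.
have inner y : \int[lam]_x F x y =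
    chi y * (cos (dotp xi y) * cosT chi xi + sin (dotp xi y) * sinT chi xi).
  have mFy := measurable_fun_pair1 y mF.
  have n10 : -1 != 0 :> R by rewrite oppr_eq0 oner_eq0.
  have := Rintegral_rV_affine y n10 mFy.
  rewrite normrN1 expr1n invr1 mul1r => <-.
  transitivity (\int[lam]_x (chi y * (cos (dotp xi y) * (cos (dotp xi x) * chi x) +
      sin (dotp xi y) * (sin (dotp xi x) * chi x)))).
    apply: eq_Rintegral => x _; rewrite /F/= scaleN1r opprD opprK addrCA subrr addr0.
    by rewrite dotpDr dotpNr cosD cosN sinN; ring.
  have i1 := integrableZl measurableT (cos (dotp xi y)) (ic xi).
  have i2 := integrableZl measurableT (sin (dotp xi y)) (is_ xi).
  rewrite RintegralZl//; last exact: (integrableD measurableT i1 i2).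
  by rewrite RintegralD// RintegralZl// RintegralZl.
under eq_Rintegral do rewrite inner.
transitivity (\int[lam]_y (cosT chi xi * (cos (dotp xi y) * chi y) +
    sinT chi xi * (sin (dotp xi y) * chi y))).
  by apply: eq_Rintegral => y _; ring.
have i1 := integrableZl measurableT (cosT chi xi) (ic xi).
have i2 := integrableZl measurableT (sinT chi xi) (is_ xi).
by rewrite RintegralD// RintegralZl// RintegralZl// -!expr2.
Qed.

Lemma cosT_covariogram_ge0 xi : 0 <= cosT (covariogram K) xi.
Proof. by rewrite cosT_covariogram addr_ge0// sqr_ge0. Qed.

Lemma normc_fourier_indic xi :
  Normc.normc (fourier (fun x => (\1_K x)%:C%C) xi) ^+ 2 = cosT (covariogram K) xi.
Proof.
rewrite cosT_covariogram /fourier /cintegral/= sqr_sqrtr ?addr_ge0 ?sqr_ge0//.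
congr (_ ^+ 2 + _).
  by apply: eq_Rintegral => x _; rewrite /= mulr0 subr0 dotpC.
rewrite -[RHS]sqrrN; congr (_ ^+ 2).
rewrite -mulN1r -RintegralZl//.
  by apply: eq_Rintegral => x _; rewrite /= mulr0 add0r mulN1r mulNr dotpC.
apply: integrable_bddM; first exact: measurable_sin_dotp.
  by move=> y; exact: sin_max.
exact: integrable_body_indic.
Qed.

Lemma convexP (t : R) x y : 0 <= t <= 1 -> K x -> K y -> K (t *: x + (1 - t) *: y).
Proof.
move=> /andP[t0 t1] Kx Ky; have [_ cvK _] := hK.
have := cvK x y (Itv01 t0 t1); rewrite !inE; exact.
Qed.

(** Contracting K by [t < 1] towards an interior point lands in the interior, so [t ^+ n] times the
    measure of K is at most that of its interior. Letting [t] tend to 1 makes the two measures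
    equal. *)
Lemma body_boundary_null : lam (K `\` interior K) = 0%E.
Proof.
have mi : measurable (interior K) by apply: open_measurable_rV; exact: open_interior.
have iK : interior K `<=` K by exact: interior_subset.
have [z0 [e e0 eK]] := body_interior.
have shrink (t : R) : 0 < t < 1 -> ((t ^+ n)%:E * lam K <= lam (interior K))%E.
  move=> /andP[t0 t1]; have tV0 : t^-1 != 0 by rewrite invr_eq0 gt_eqF.
  have mE : measurable_fun setT (fun x : 'rV[R]_n => (\1_K x)%:E : \bar R).
    by apply/measurable_EFinP; exact: measurable_body_indic.
  have E0 x : (0 <= (\1_K x)%:E :> \bar R)%E by rewrite lee_fin indicE.
  have := ge0_integral_rV_affine (- (t^-1 * (1 - t)) *: z0) tV0 mE E0.
  have -> : (\int[lam]_x (\1_K x)%:E = lam K)%E.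
    by rewrite integral_indic ?setIT//; exact: body_measurable.
  rewrite gtr0_norm ?invr_gt0// exprVn invrK => <-.
  rewrite -[leRHS](_ : \int[lam]_x (\1_(interior K) x)%:E = _)%E; last first.
    by rewrite integral_indic// setIT.
  apply: ge0_le_integral => //.
  - apply/measurable_EFinP; apply: (measurableT_comp measurable_body_indic).
    exact: measurable_rV_affine.
  - by apply/measurable_EFinP; exact: measurable_indic.
  move=> y _; rewrite lee_fin !indicE ler_nat; case: (boolP (_ \in K)) => //.
  rewrite inE => Kx; rewrite mem_set//.
  set x := _ + _ in Kx.
  have yE : y = t *: x + (1 - t) *: z0.
    rewrite /x scalerDr !scalerA divff ?gt_eqF// scale1r mulrN mulrA divff ?gt_eqF// mul1r.
    by rewrite scaleNr subrK.
  clearbody x; have t1' : 0 < 1 - t by rewrite subr_gt0.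
  (* With [x] fixed, moving [y] amounts to moving [z0] by [(1 - t)^-1] times as much, which stays in
     the ball of radius [e] inside K. *)
  rewrite /interior; apply/nbhs_ballP; exists ((1 - t) * e); first exact: mulr_gt0.
  move=> y' [_ yy']; pose z := z0 + (1 - t)^-1 *: (y' - y).
  have -> : y' = t *: x + (1 - t) *: z.
    rewrite /z scalerDr scalerA divff ?gt_eqF// scale1r addrA -yE addrC subrK//.
  apply: convexP => //; first by rewrite !ltW.
  apply: eK; split=> // i j; have := yy' i j; rewrite (ord1 i) /ball/= !mxE => h.
  rewrite opprD addrA subrr add0r normrN normrM gtr0_norm ?invr_gt0//.
  by rewrite ltr_pdivrMl// distrC.
have leKi : (lam K <= lam (interior K))%E.
  have fi : lam (interior K) \is a fin_num.
    rewrite ge0_fin_numE//; apply: le_lt_trans body_lty.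
    by apply: le_measure; rewrite ?inE//; exact: body_measurable.
  rewrite volumeE -(fineK fi) lee_fin.
  (* The index [k + 2] keeps [1 - 1 / (k + 2)] positive at [k = 0], as [shrink] requires. *)
  have cv : ((1 - k.+2%:R^-1) ^+ n * volume K) @[k --> \oo] --> volume K.
    rewrite -[X in _ --> X]mul1r; apply: cvgMl.
    rewrite [X in _ --> X](_ : _ = (1 - 0) ^+ n); last by rewrite subr0 expr1n.
    apply: (@cvg_comp _ _ _ (fun k : nat => 1 - k.+2%:R^-1 : R) (fun t : R => t ^+ n) _
      (nbhs (1 - 0 : R))); last exact: exprn_continuous.
    apply: cvgB; first exact: cvg_cst.
    by have := @cvg_harmonic R; rewrite -(cvg_shiftS (@harmonic R)).
  apply: (cvgr_to_le cv); apply: nearW => k.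
  have := shrink (1 - k.+2%:R^-1); rewrite volumeE -(fineK fi) -EFinM lee_fin; apply.
  by rewrite subr_gt0 invf_lt1// ltr1n/= ltrBlDr ltrDl invr_gt0.
rewrite measureD//; [|exact: body_measurable|exact: body_lty].
have -> : K `&` interior K = interior K by apply/setIidPr.
have KiE : lam (interior K) = lam K.
  apply/eqP; rewrite eq_le leKi andbT.
  by apply: le_measure; rewrite ?inE//; exact: body_measurable.
transitivity (lam K - lam K)%E; first by congr (_ - _)%E; exact: KiE.
by rewrite volumeE subee.
Qed.

(** Dominated convergence under the indicator of K, the discontinuities lying on a null set because
    the boundary of a convex body is null. *)
Lemma covariogram_seq_cvg (x_ : nat -> 'rV[R]_n) x : x_ @ \oo --> x ->
  covariogram K (x_ k) @[k --> \oo] --> covariogram K x.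
Proof.
move=> xx; rewrite covariogramE; under eq_fun do rewrite covariogramE.
apply: (@Rintegral_dominated_cvg _ _ _ _ _ _ chi).
- by move=> k; exact: (measurable_fun_pair2 (x_ k) mchi2).
- exact: (measurable_fun_pair2 x mchi2).
- have mi : measurable (K `\` interior K).
    apply: measurableD; first exact: body_measurable.
    by apply: open_measurable_rV; exact: open_interior.
  (* The exceptional set is the translate by [x] of the boundary part. Off it, [y - x] is interior
     to K or in its open complement, so the indicators at [y - x_ k] are eventually constant. *)
  exists ((fun y => 1 *: y + - x) @^-1` (K `\` interior K)); split.
  + by rewrite -[X in measurable X]setTI; apply: measurable_rV_affine.
  + have m1 : measurable_fun setT (fun z : 'rV[R]_n => (\1_(K `\` interior K) z)%:E : \bar R).
      by apply/measurable_EFinP; exact: measurable_indic.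
    have p0 (z : 'rV[R]_n) : (0 <= (\1_(K `\` interior K) z)%:E :> \bar R)%E by rewrite lee_fin indicE.
    have := ge0_integral_rV_affine (- x) (oner_neq0 R) m1 p0.
    have -> : (\int[lam]_z (\1_(K `\` interior K) z)%:E = 0)%E.
      by rewrite integral_indic// setIT; exact: body_boundary_null.
    rewrite mule0 => H; rewrite -H.
    transitivity (\int[lam]_y (\1_((fun y : 'rV[R]_n => 1 *: y - x) @^-1` (K `\` interior K)) y)%:E)%E.
      rewrite integral_indic ?setIT//.
      by rewrite -[X in measurable X]setTI; apply: measurable_rV_affine.
    by apply: eq_integral.
  + move=> y; apply: contra_notP => /= yN.
    have yx : (y - x_ k) @[k --> \oo] --> y - x by apply: cvgB => //; exact: cvg_cst.
    have [Kyx|Kyx] := pselect (K (y - x)).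
      have iyx : nbhs (y - x) K.
        by apply: contrapT => h; apply: yN; rewrite scale1r; split.
      apply: cvg_near_cst; have hk : \forall k \near \oo, K (y - x_ k) by exact: (yx _ iyx).
      apply: filterS hk => k Kk.
      by rewrite /body_indic !indicE (mem_set Kk) (mem_set Kyx).
    have nyx : nbhs (y - x) (~` K).
      by apply: open_nbhs_nbhs; split => //; exact: closed_openC body_closed.
    apply: cvg_near_cst; have hk : \forall k \near \oo, ~ K (y - x_ k) by exact: (yx _ nyx).
    apply: filterS hk => k Kk.
    by rewrite /body_indic !indicE (memNset Kk) (memNset Kyx).
- exact: integrable_body_indic.
- move=> k y; rewrite normrM ger0_norm ?(andP (body_indic01 _)).1//.
  rewrite ler_piMr ?(andP (body_indic01 _)).1// ger0_norm ?(andP (body_indic01 _)).1//.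
  exact: (andP (body_indic01 _)).2.
Qed.

Lemma covariogram0 : covariogram K 0 = volume K.
Proof.
rewrite covariogramE -Rintegral_body_indic; apply: eq_Rintegral => y _.
by rewrite subr0 /body_indic indicE; case: (y \in K); rewrite ?mul1r ?mul0r.
Qed.

Lemma covariogram_eq0 : exists2 M : R, 0 < M &
  forall (x : 'rV[R]_n) i, M < `|x ord0 i| -> covariogram K x = 0.
Proof.
have [M M0 KM] := covariogram_support; exists M => // x i xM.
rewrite covariogramE (_ : (fun y => _) = cst 0) ?Rintegral_cst// ?mul0r//.
apply/funext => y /=; apply/eqP; apply: contraT => /KM /(_ i).
by rewrite leNgt xM.
Qed.

End convex_bodies.

Section sequential_continuity.
Context {R : realType} (n : nat).

(** Continuity is tested on sequences because dominated convergence provides limits along sequences;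
    a failure at radii [1 / (k + 1)] supplies the offending one. *)
Lemma within_continuous_seq (A : set 'rV[R]_n) (f : 'rV[R]_n -> R) :
  (forall (x_ : nat -> 'rV[R]_n) x, A x -> (forall k, A (x_ k)) -> x_ @ \oo --> x ->
     f (x_ k) @[k --> \oo] --> f x) ->
  {within A, continuous f}.
Proof.
move=> H; apply/subspace_continuousP => x Ax; apply/cvgrPdist_lt => e e0.
apply: contrapT => N.
have P k : exists y : 'rV[R]_n, [/\ ball x k.+1%:R^-1 y, A y & e <= `|f x - f y|].
  apply: contrapT => h; apply: N; apply/nbhs_ballP; exists k.+1%:R^-1 => /=.
    by rewrite invr_gt0.
  move=> y xy Ay; rewrite ltNge; apply/negP => ey; apply: h; by exists y.
have /choice[x_ Px] := P.
have xx : x_ @ \oo --> x.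
  apply/cvg_ballP => d d0.
  have hd : \forall k \near \oo, (k.+1%:R^-1 : R) < d.
    exact: (near_infty_natSinv_lt (PosNum d0)).
  apply: filterS hd => k kd; have [+ _ _] := Px k.
  by apply: le_ball; exact: ltW.
have Ax_ k : A (x_ k) by have [] := Px k.
have := H x_ x Ax Ax_ xx; move/cvgrPdist_lt => /(_ e e0) [k _ /(_ k (leqnn k))].
by have [_ _ ek] := Px k; rewrite /= ltNge ek.
Qed.

End sequential_continuity.

(** * Tempered functions and star-shaped sets *)

Lemma ae_eq_integrable d (T : measurableType d) (R : realType) (m : {measure set T -> \bar R})
    (f g : T -> \bar R) : measurable_fun setT f ->
  ae_eq m setT f g -> m.-integrable setT g -> m.-integrable setT f.
Proof.
move=> mf fg /integrableP[mg glt]; apply/integrableP; split => //.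
rewrite (le_lt_trans _ glt)// le_eqVlt; apply/orP; left; apply/eqP.
apply: ae_eq_integral => //; [exact: measurableT_comp|exact: measurableT_comp|].
by apply: filterS fg => x fgx Dx; rewrite fgx.
Qed.

Section tempered.
Context {R : realType} (n : nat).
Local Notation lam := (lebesgue_rV R n).
Implicit Types (F : 'rV[R]_n -> \bar R) (v w : 'rV[R]_n -> R).

Lemma measurable_schwartz v : schwartz_real v -> measurable_fun setT v.
Proof. by move=> /schwartz_continuous; exact: continuous_measurable_rV. Qed.

Lemma measurable_weight N : measurable_fun setT (fun x : 'rV[R]_n => (1 + enorm x) ^- N).
Proof.
have me : measurable_fun setT (fun x : 'rV[R]_n => enorm x).
  apply: (measurableT_comp (f := fun t : R => Num.sqrt t)).
    by apply: continuous_measurable_fun; exact: sqrt_continuous.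
  by apply: measurable_dotp.
apply: (measurableT_comp measurable_invr); apply: measurable_funX.
exact: measurable_funD.
Qed.

Lemma weight_gt0 N (x : 'rV[R]_n) : 0 < (1 + enorm x) ^- N.
Proof. by rewrite invr_gt0 exprn_gt0// ltr_pwDl// enorm_ge0. Qed.

Lemma measurable_tempered_fun F : tempered_fun F -> measurable_fun setT F.
Proof.
move=> [N /measurable_int mF].
rewrite (_ : F = fun x => (F x * ((1 + enorm x) ^- N)%:E * ((1 + enorm x) ^- N)^-1%:E)%E).
  apply: emeasurable_funM => //; apply/measurable_EFinP.
  by apply: (measurableT_comp measurable_invr); exact: measurable_weight.
apply/funext => x; rewrite -muleA -EFinM divff ?mule1//.
by rewrite gt_eqF// weight_gt0.
Qed.

(** The weight is strictly positive, so an infinite value of [F] makes the integrable product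
    infinite too. *)
Lemma tempered_fun_fin_num F : tempered_fun F -> {ae lam, forall x, F x \is a fin_num}.
Proof.
move=> [N iF]; have := integrable_ae measurableT iF.
apply: filterS => x /(_ Logic.I).
case: (F x) => [r| |]//; rewrite ?gt0_mulye ?gt0_mulNye// lte_fin weight_gt0//.
Qed.

(** Finiteness almost everywhere turns the extended-real pairing of [distr_of] into a real integral,
    where linearity is at hand. *)
Lemma tempered_fun_integral F v : tempered_fun F -> measurable_fun setT v ->
  fine (\int[lam]_x (F x * (v x)%:E))%E = \int[lam]_x (fine (F x) * v x).
Proof.
move=> tF mv; have mF := measurable_tempered_fun tF.
rewrite /Rintegral; congr fine; apply: ae_eq_integral => //.
- by apply: emeasurable_funM => //; exact/measurable_EFinP.
- apply/measurable_EFinP; apply: measurable_funM => //.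
  exact: (measurableT_comp (fine_measurable measurableT)).
- by move: (tempered_fun_fin_num tF); apply: filterS => x /fineK {1}<- _.
Qed.

Lemma schwartz_weight v N : schwartz_real v -> exists c, forall x, `|v x| <= c * (1 + enorm x) ^- N.
Proof.
move=> [_ /(_ [::] N)[c hc]]; exists c => x.
by rewrite ler_pdivlMr ?exprn_gt0 ?ltr_pwDl ?enorm_ge0// mulrC; exact: hc.
Qed.

Lemma integrable_tempered_fun F N :
  lam.-integrable setT (fun x => F x * ((1 + enorm x) ^- N)%:E)%E ->
  lam.-integrable setT (fun x => (`|fine (F x)| * (1 + enorm x) ^- N)%:E).
Proof.
move=> iF; have tF : tempered_fun F by exists N.
apply: (ae_eq_integrable _ _ (integrable_abse iF)).
- apply/measurable_EFinP; apply: measurable_funM; last exact: measurable_weight.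
  apply: measurableT_comp => //.
  exact: (measurableT_comp (fine_measurable measurableT) (measurable_tempered_fun tF)).
- move: (tempered_fun_fin_num tF); apply: filterS => x /fineK Fx _ /=.
  by rewrite -[in RHS]Fx -EFinM /= normrM (gtr0_norm (weight_gt0 _ _)).
Qed.

Lemma schwartz_integrable_tempered F v : tempered_fun F -> schwartz_real v ->
  lam.-integrable setT (fun x => (fine (F x) * v x)%:E).
Proof.
move=> tF sv; have [N /integrable_tempered_fun iF] := tF.
have [c hc] := schwartz_weight N sv.
have mv := measurable_schwartz sv.
apply: (le_integrable measurableT _ _ (integrableZl measurableT c iF)).
  apply/measurable_EFinP; apply: measurable_funM => //.
  exact: (measurableT_comp (fine_measurable measurableT) (measurable_tempered_fun tF)).
move=> x _ /=; rewrite lee_fin (le_trans _ (ler_norm _))// normrM mulrCA.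
by rewrite ler_wpM2l.
Qed.

Lemma Rintegral_linear (f u v w : 'rV[R]_n -> R) (a b : R) :
  lam.-integrable setT (fun x => (f x * u x)%:E) ->
  lam.-integrable setT (fun x => (f x * v x)%:E) ->
  lam.-integrable setT (fun x => (f x * w x)%:E) ->
  \int[lam]_x (f x * (a * u x + b * v x + w x)) =
  a * \int[lam]_x (f x * u x) + b * \int[lam]_x (f x * v x) + \int[lam]_x (f x * w x).
Proof.
move=> iu iv iw.
have iau := integrableZl measurableT a iu; have ibv := integrableZl measurableT b iv.
have iab := integrableD measurableT iau ibv.
rewrite -!RintegralZl// -[in RHS]RintegralD// -[RHS]RintegralD//.
by apply: eq_Rintegral => x _; ring.
Qed.

Lemma distr_ofE F (phi : 'rV[R]_n -> R[i]) : tempered_fun F ->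
  measurable_fun setT (fun x => complex.Re (phi x)) ->
  measurable_fun setT (fun x => complex.Im (phi x)) ->
  distr_of F phi = (\int[lam]_x (fine (F x) * complex.Re (phi x)) +i*
                    \int[lam]_x (fine (F x) * complex.Im (phi x)))%C.
Proof. by move=> tF mu mv; rewrite /distr_of !tempered_fun_integral. Qed.

Lemma normc_le (a b : R) : Normc.normc (a +i* b)%C <= `|a| + `|b|.
Proof.
rewrite /= -[leRHS]ger0_norm ?addr_ge0// -sqrtr_sqr ler_wsqrtr// sqrrD !real_normK ?num_real//.
by rewrite lerD2r lerDl mulrn_wge0// mulr_ge0.
Qed.

Lemma tempered_distr_of F : tempered_fun F -> tempered_distribution (distr_of F).
Proof.
move=> tF; have mS := @measurable_schwartz.
have iS v (sv : schwartz_real v) := schwartz_integrable_tempered tF sv.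
have dE phi : schwartz phi -> _ := fun sphi => distr_ofE tF (mS _ sphi.1) (mS _ sphi.2).
split => [[a b] phi psi sphi spsi|].
  have [[su sv] [su' sv']] := (sphi, spsi).
  have ReE x : complex.Re ((a +i* b)%C * phi x + psi x) =
      a * complex.Re (phi x) + (- b) * complex.Im (phi x) + complex.Re (psi x).
    by case: (phi x) (psi x) => [? ?] [? ?] /=; ring.
  have ImE x : complex.Im ((a +i* b)%C * phi x + psi x) =
      a * complex.Im (phi x) + b * complex.Re (phi x) + complex.Im (psi x).
    by case: (phi x) (psi x) => [? ?] [? ?] /=; ring.
  have mD (c d : R) (u v w : 'rV[R]_n -> R) : schwartz_real u -> schwartz_real v -> schwartz_real w ->
      measurable_fun setT (fun x => c * u x + d * v x + w x).
    move=> /mS mu /mS mv /mS mw; apply: measurable_funD => //.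
    by apply: measurable_funD; apply: measurable_funM.
  rewrite distr_ofE//.
  - under eq_Rintegral do rewrite ReE.
    under [X in (_ +i* X)%C]eq_Rintegral do rewrite ImE.
    rewrite !Rintegral_linear ?iS// !dE//.
    by apply/eqP; rewrite eq_complex /=; apply/andP; split; apply/eqP; ring.
  - by apply: (eq_measurable_fun _ _ (mD a (- b) _ _ _ su sv su')) => x _; rewrite ReE.
  - by apply: (eq_measurable_fun _ _ (mD a b _ _ _ sv su sv')) => x _; rewrite ImE.
have [N /integrable_tempered_fun iF] := tF.
pose I := \int[lam]_x (`|fine (F x)| * (1 + enorm x) ^- N).
(* The underived seminorm with weight [N], the growth order of [F], suffices for the bound. Real and
   imaginary parts contribute [I] each. *)
exists N, (2 * I) => phi B sphi hB; rewrite dE//.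
have bound v : schwartz_real v -> (forall x, (1 + enorm x) ^+ N * `|v x| <= B) ->
    `|\int[lam]_x (fine (F x) * v x)| <= I * B.
  move=> sv vB; apply: (le_trans (le_normr_Rintegral measurableT (iS _ sv))).
  rewrite mulrC -RintegralZl//; apply: le_Rintegral => //.
  - exact: integrable_norm (iS _ sv).
  - exact: (integrableZl measurableT B iF).
  - move=> x _; rewrite normrM mulrCA ler_wpM2l// ler_pdivlMr; first by rewrite mulrC.
    by rewrite exprn_gt0// ltr_pwDl// enorm_ge0.
have wB x := hB [::] x (leq0n N).
have w0 (x : 'rV[R]_n) : 0 <= (1 + enorm x) ^+ N by rewrite exprn_ge0// addr_ge0// enorm_ge0.
apply: (le_trans (normc_le _ _)); rewrite mulrC mulrA mulrDr mulr1 mulrDl; apply: lerD.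
  rewrite mulrC; apply: bound; first exact: sphi.1.
  by move=> x; apply: (le_trans _ (wB x)); rewrite (ler_wpM2l (w0 x))//= lerDl.
rewrite mulrC; apply: bound; first exact: sphi.2.
by move=> x; apply: (le_trans _ (wB x)); rewrite (ler_wpM2l (w0 x))//= lerDr.
Qed.

End tempered.

Section mellin_bodies.
Context {R : realType} (n : nat).
Local Notation lam := (lebesgue_rV R n).
Implicit Types (G H : 'rV[R]_n -> R) (p c : R).

Lemma mellinZr p G (a : R) x : 0 < a -> measurable_fun setT G -> (forall x, 0 <= G x) ->
  mellin p G (a *: x) = ((a `^ (- p))%:E * mellin p G x)%E.
Proof.
move=> a0 mG G0; rewrite !mellinE.
pose f (r : measurableTypeR R) := (power_density p r * G (r *: x))%:E.
have mf : measurable_fun setT f.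
  by apply/measurable_EFinP; exact: (measurable_fun_pair2 x (measurable_mellin_kernel p mG)).
have f0 r : (0 <= f r)%E by rewrite lee_fin mulr_ge0// power_density_ge0.
have := ge0_integral_affine 0 (lt0r_neq0 a0) mf f0; rewrite gtr0_norm// => H.
transitivity ((a `^ (1 - p))%:E * \int[@lebesgue_measure R]_r f (a * r + 0)%R)%E; last first.
  rewrite H muleA -EFinM; congr (_%:E * _)%E.
  rewrite -[a^-1]powR_inv1 ?(ltW a0)// -powRD; last by apply/implyP => _; exact: lt0r_neq0.
  by congr (_ `^ _); ring.
rewrite -ge0_integralZl_EFin ?powR_ge0//; last first.
  by apply: (measurableT_comp mf); exact: measurable_affine.
apply: eq_integral => r _; rewrite /f addr0 -EFinM scalerA; congr EFin.
rewrite [r * a]mulrC mulrA; congr (_ * _); rewrite /power_density.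
have -> : \1_(`]0, +oo[%classic : set R) (a * r) = \1_(`]0, +oo[%classic : set R) r :> R.
  by rewrite !indicE !mem_setE !in_itv/= !andbT pmulr_rgt0.
rewrite mulrCA; have [r0|r0] := ltP 0 r; last first.
  by rewrite indicE memNset ?mul0r//= in_itv/= andbT; apply/negP; rewrite -leNgt.
congr (_ * _); rewrite powRM ?(ltW a0) ?(ltW r0)// mulrA -powRD; last first.
  by apply/implyP => _; exact: lt0r_neq0.
by rewrite (_ : 1 - p + (p - 1) = 0) ?powRr0 ?mul1r//; ring.
Qed.

(** Common form of both mean bodies: [c = p / volume K], with [G] the covariogram for R_p K and its
    cosine transform for F_p K. A free [c] also describes their dilates. *)
Definition mellin_body c p G : set 'rV[R]_n :=
  star_of_radial (fun theta => (c%:E * mellin p G theta) `^ p^-1)%E.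

Lemma enorm_gt0 (x : 'rV[R]_n) : x != 0 -> 0 < enorm x.
Proof.
move=> x0; rewrite lt_neqAle enorm_ge0 andbT eq_sym.
by apply: contra x0 => /eqP/enorm_eq0 ->.
Qed.

Lemma enorm0 : enorm (0 : 'rV[R]_n) = 0.
Proof. by rewrite /enorm /dotp big1 ?sqrtr0// => i _; rewrite mxE mul0r. Qed.

(** [mellin p G] is homogeneous of degree [- p], which matches the homogeneous extension of the
    radial function off the sphere. *)
Lemma radial_pow_mellin c p G x : 0 < p -> 0 <= c -> measurable_fun setT G ->
  (forall x, 0 <= G x) -> x != 0 ->
  radial_pow (mellin_body c p G) p x = (c%:E * mellin p G x)%E.
Proof.
move=> p0 c0 mG G0 x0; have ex0 := enorm_gt0 x0.
rewrite /radial_pow /mellin_body radial_star_of_radial//; last by move=> y; exact: poweR_ge0.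
rewrite poweRM ?poweR_ge0 ?lee_fin ?invr_ge0 ?(ltW ex0)//.
rewrite -poweRrM mulVf ?gt_eqF// poweRe1 ?mule_ge0 ?lee_fin ?mellin_ge0//.
rewrite mellinZr ?invr_gt0// poweR_EFin muleCA muleA muleA -!EFinM.
rewrite -mulrA -powRD; last by apply/implyP => _; rewrite invr_eq0; exact: lt0r_neq0.
by rewrite subrr powRr0 mulr1.
Qed.

Lemma radial_pow0 M p : p != 0 -> radial_pow M p (0 : 'rV[R]_n) = 0%E.
Proof. by move=> p0; rewrite /radial_pow /radial enorm0 invr0 mul0e poweR0r. Qed.

Lemma star_of_radial_star_shaped (rho : 'rV[R]_n -> \bar R) : star_shaped (star_of_radial rho).
Proof.
split=> [|x t]; first by left.
move=> [->|xr] /andP[t0 t1]; first by left; rewrite scaler0.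
have [->|tn0] := eqVneq t 0; first by left; rewrite scale0r.
right; rewrite enormZ ger0_norm//.
have -> : (t * enorm x)^-1 *: (t *: x) = (enorm x)^-1 *: x.
  by rewrite scalerA invfM mulrAC mulVf ?mul1r.
by apply: (le_trans _ xr); rewrite lee_fin ler_piMl// enorm_ge0.
Qed.

Lemma enormN (x : 'rV[R]_n) : enorm (- x) = enorm x.
Proof. by rewrite -scaleN1r enormZ normrN1 mul1r. Qed.

Lemma star_of_radial_symmetric (rho : 'rV[R]_n -> \bar R) :
  (forall x, rho (- x) = rho x) -> origin_symmetric (star_of_radial rho).
Proof.
move=> rhoN x [->|xr]; first by left; rewrite oppr0.
by right; rewrite enormN scalerN rhoN.
Qed.

Lemma mellin_body_symmetric c p G : (forall x, G (- x) = G x) ->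
  origin_symmetric (mellin_body c p G).
Proof. by move=> GN; apply: star_of_radial_symmetric => x; rewrite mellinN. Qed.

Lemma dilate_star_of_radial (a : R) (rho : 'rV[R]_n -> \bar R) : 0 < a ->
  dilate a (star_of_radial rho) = star_of_radial (fun x => a%:E * rho x)%E.
Proof.
move=> a0; have an0 := lt0r_neq0 a0; have aV0 : 0 < a^-1 by rewrite invr_gt0.
have key (b : R) (f : 'rV[R]_n -> \bar R) x : 0 < b -> star_of_radial f x ->
    star_of_radial (fun y => b%:E * f y)%E (b *: x).
  move=> b0 [->|xr]; first by left; rewrite scaler0.
  right; rewrite enormZ gtr0_norm// scalerA invfM mulrAC mulVf ?lt0r_neq0// mul1r.
  by rewrite EFinM lee_wpmul2l// lee_fin ltW.
apply/seteqP; split => [_ [x xr <-]|y yr]; first exact: key.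
exists (a^-1 *: y); last by rewrite scalerA divff// scale1r.
have := key _ _ _ aV0 yr; rewrite /star_of_radial/= => -[->|h]; first by left.
by right; move: h; rewrite muleA -EFinM mulVf// mul1e.
Qed.

Lemma dilate_mellin_body (a c p : R) G : 0 < a -> 0 <= c -> 0 < p -> (forall x, 0 <= G x) ->
  dilate a (mellin_body c p G) = mellin_body (a `^ p * c) p G.
Proof.
move=> a0 c0 p0 G0; rewrite /mellin_body dilate_star_of_radial//; congr star_of_radial.
apply/funext => x; rewrite EFinM -muleA [RHS]poweRM ?mule_ge0 ?lee_fin ?powR_ge0 ?mellin_ge0//.
by rewrite poweR_EFin -powRrM divff ?gt_eqF// powRr1// ltW.
Qed.

Lemma lebesgue_rV_set0 : (0 < n)%N -> lam [set 0 : 'rV[R]_n] = 0%E.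
Proof.
move=> n0; transitivity
  (lam [set x : 'rV[R]_n | forall i, ([set 0] : set (measurableTypeR R)) (x ord0 i)]).
  congr (lam _); apply/seteqP; split => [x -> i|x h] /=; first by rewrite mxE.
  by apply/rowP => i; rewrite -[0]/(ord0 : 'I_1) h mxE.
rewrite (lebesgue_rV_box (A := fun=> [set 0])).
  by case: n n0 => // m _; rewrite big_ord_recl lebesgue_measure_set1 mul0e.
by move=> i; exact: measurable_set1.
Qed.

Lemma measurable_rV_set0 : measurable [set 0 : 'rV[R]_n].
Proof.
rewrite (_ : [set 0] = \bigcap_(i in [set: 'I_n]) ((fun x : 'rV[R]_n => x ord0 i) @^-1`
    ([set 0] : set (measurableTypeR R)))); last first.
  apply/seteqP; split => [x -> i|x h] /=; first by rewrite mxE.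
  by apply/rowP => i; rewrite -[0]/(ord0 : 'I_1) (h i I) mxE.
apply: fin_bigcap_measurable => // i _; rewrite -[X in measurable X]setTI.
by apply: measurable_coor => //; exact: measurable_set1.
Qed.

Lemma measurable_radial_pow_mellin c p G : 0 < p -> 0 <= c -> measurable_fun setT G ->
  (forall x, 0 <= G x) -> measurable_fun setT (radial_pow (mellin_body c p G) p).
Proof.
move=> p0 c0 mG G0.
rewrite (_ : radial_pow _ _ = fun x => if x == 0 then 0%E else (c%:E * mellin p G x)%E); last first.
  apply/funext => x; case: eqVneq => [->|x0]; last exact: radial_pow_mellin.
  by rewrite radial_pow0// gt_eqF.
apply: measurable_fun_ifT.
- apply: (measurable_fun_bool true).
  rewrite setTI (_ : _ @^-1` _ = [set 0]); first exact: measurable_rV_set0.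
  by apply/seteqP; split => x /= /eqP.
- exact: measurable_cst.
- by apply: emeasurable_funM => //; exact: measurable_mellin.
Qed.

(** The two sides can differ only at the origin, where [radial] has a conventional value; a point is
    null in positive dimension. *)
Lemma ae_radial_pow_mellin c p G : (0 < n)%N -> 0 < p -> 0 <= c -> measurable_fun setT G ->
  (forall x, 0 <= G x) -> forall v : 'rV[R]_n -> R,
  ae_eq lam setT (fun x => radial_pow (mellin_body c p G) p x * (v x)%:E)%E
    (fun x => c%:E * (mellin p G x * (v x)%:E))%E.
Proof.
move=> n0 p0 c0 mG G0 v; exists [set 0]; split.
- exact: measurable_rV_set0.
- exact: lebesgue_rV_set0.
- move=> x; apply: contra_notP => /= x0 _.
  by rewrite radial_pow_mellin ?muleA//; apply/eqP.
Qed.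

Section admissible.
Variables (G : 'rV[R]_n -> R) (A : R).
Hypotheses (mG : measurable_fun setT G) (G0 : forall x, 0 <= G x) (GA : forall x, G x <= A)
  (iG : lam.-integrable setT (EFin \o G)).
Variables (c p : R).
Hypotheses (c0 : 0 <= c) (p_gt0 : 0 < p) (p_ltn : p < n%:R).

Let n0 : (0 < n)%N.
Proof. by rewrite -(ltr0n R) (lt_trans p_gt0). Qed.

Lemma integral_radial_pow_mellin (v : 'rV[R]_n -> R) b : measurable_fun setT v ->
  (forall x, `|v x| <= b * cauchy x) ->
  fine (\int[lam]_x (radial_pow (mellin_body c p G) p x * (v x)%:E))%E =
  c * fine (\int[lam]_x (mellin p G x * (v x)%:E))%E.
Proof.
move=> mv vb; have aeE := ae_radial_pow_mellin n0 p_gt0 c0 mG G0 v.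
have iM := integrable_mellin_mul p_gt0 p_ltn mG G0 GA iG mv vb.
rewrite (ae_eq_integral _ _ _ _ _ aeE)//.
- by rewrite integralZl// -[in RHS](fineK (integrable_fin_num measurableT iM)) fineM// integrable_fin_num.
- apply: emeasurable_funM; last exact/measurable_EFinP.
  exact: measurable_radial_pow_mellin.
- apply: emeasurable_funM => //; apply: emeasurable_funM; last exact/measurable_EFinP.
  exact: measurable_mellin.
Qed.

Lemma tempered_radial_pow_mellin : tempered_fun (radial_pow (mellin_body c p G) p).
Proof.
(* By [cauchy_ge], the weight of order [2 n] lies below [cauchy], against which [mellin] is
   integrable. *)
exists (2 * n)%N; have mw := @measurable_weight R n (2 * n).
have wb (x : 'rV[R]_n) : `|(1 + enorm x) ^- (2 * n)| <= 1 * cauchy x.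
  by rewrite mul1r ger0_norm ?cauchy_ge// ltW// weight_gt0.
have iM := integrable_mellin_mul p_gt0 p_ltn mG G0 GA iG mw wb.
apply: (ae_eq_integrable _ _ (integrableZl measurableT c iM)).
- apply: emeasurable_funM; last exact/measurable_EFinP.
  exact: measurable_radial_pow_mellin.
- exact: ae_radial_pow_mellin.
Qed.

End admissible.
End mellin_bodies.


(** * Distributional Fourier transforms of radial powers *)

Section transform_of_mellin_bodies.
Context {R : realType} (n : nat).
Local Notation lam := (lebesgue_rV R n).
Variables (G H : 'rV[R]_n -> R) (A B k p c c' d : R).
Hypotheses (mG : measurable_fun setT G) (G0 : forall x, 0 <= G x) (GA : forall x, G x <= A)
  (iG : lam.-integrable setT (EFin \o G)) (GN : forall x, G (- x) = G x).
Hypotheses (mH : measurable_fun setT H) (H0 : forall x, 0 <= H x) (HB : forall x, H x <= B)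
  (iH : lam.-integrable setT (EFin \o H)).
Hypotheses (k0 : 0 <= k) (p_gt0 : 0 < p) (p_ltn : p < n%:R).
Hypothesis pairing : forall u s, schwartz_real u -> 0 < s ->
  \int[lam]_x (G (s^-1 *: x) * cosT u x) = s ^+ n * \int[lam]_y (k * H (s *: y) * u y).
Hypotheses (c0 : 0 <= c) (c'0 : 0 <= c') (dE : c * k = d * c').

Let F := radial_pow (mellin_body c p G) p.
Let F' := radial_pow (mellin_body c' (n%:R - p) H) (n%:R - p).

Let q_gt0 : 0 < n%:R - p. Proof. by rewrite subr_gt0. Qed.
Let q_ltn : n%:R - p < n%:R. Proof. by rewrite gtrBl. Qed.

Let tF : tempered_fun F. Proof. exact: (tempered_radial_pow_mellin mG G0 GA iG). Qed.

(** Duality is applied to [G] and [k * H], and [k] leaves the Mellin integral linearly. The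
    resulting factor [c * k] is rewritten as [d * c'] to absorb the normalisation of the second
    body. *)
Lemma integral_mellin_cosT u : schwartz_real u ->
  fine (\int[lam]_x (F x * (cosT u x)%:E))%E = d * fine (\int[lam]_x (F' x * (u x)%:E))%E.
Proof.
move=> su; have mu := measurable_schwartz su.
have [a ua] := schwartz_bound su; have [b ub] := schwartz_transform_decay su.
pose e := Num.max a b.
have ue x : `|u x| <= e * cauchy x.
  by rewrite (le_trans (ua x))// ler_wpM2r ?le_max ?lexx// ltW// cauchy_gt0.
have Ue x : `|cosT u x| <= e * cauchy x.
  by rewrite (le_trans (ub x).1)// ler_wpM2r ?le_max ?lexx ?orbT// ltW// cauchy_gt0.
have mU := measurable_cosT mu.
rewrite (integral_radial_pow_mellin mG G0 GA iG c0 p_gt0 p_ltn mU Ue).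
rewrite (integral_radial_pow_mellin mH H0 HB iH c'0 q_gt0 q_ltn mu ue) mulrA -dE -mulrA.
congr (_ * _).
have mkH : measurable_fun setT (fun x => k * H x) by exact: measurable_funM.
have kH0 x : 0 <= k * H x by rewrite mulr_ge0.
have kHB x : k * H x <= k * B by rewrite ler_wpM2l.
have ikH : lam.-integrable setT (EFin \o (fun x => k * H x)) := integrableZl measurableT k iH.
rewrite (mellin_duality p_gt0 p_ltn mG G0 GA iG mkH kH0 kHB ikH mu ue mU Ue (fun s => pairing su)).
have kE x : mellin (n%:R - p) (fun x => k * H x) x = (k%:E * mellin (n%:R - p) H x)%E.
  rewrite !mellinE -ge0_integralZl_EFin//; first by apply: eq_integral => r _; rewrite -EFinM mulrCA.
  - by move=> r _; rewrite lee_fin mulr_ge0// power_density_ge0.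
  - by apply/measurable_EFinP; exact: (measurable_fun_pair2 x (measurable_mellin_kernel _ mH)).
under eq_integral do rewrite kE -muleA.
have iM := integrable_mellin_mul q_gt0 q_ltn mH H0 HB iH mu ue.
by rewrite integralZl// -[in RHS](fineK (integrable_fin_num measurableT iM)) fineM// integrable_fin_num.
Qed.

(** [mellin p G] is even and a sine transform is odd, so the pairing integrates an odd function. *)
Lemma integral_mellin_sinT u : schwartz_real u -> fine (\int[lam]_x (F x * (sinT u x)%:E))%E = 0.
Proof.
move=> su; have mu := measurable_schwartz su.
have [b ub] := schwartz_transform_decay su.
have Ub x := (ub x).2; have mU := measurable_sinT mu.
rewrite (integral_radial_pow_mellin mG G0 GA iG c0 p_gt0 p_ltn mU Ub) fine_integral_odd ?mulr0//.
- by apply: emeasurable_funM; [exact: measurable_mellin|exact/measurable_EFinP].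
- move=> x; rewrite mellinN// -muleN -EFinN; congr (_ * _%:E)%E.
  rewrite /sinT -mulN1r -RintegralZl//.
    by apply: eq_Rintegral => y _; rewrite dotpC dotpNr sinN dotpC mulN1r mulNr.
  apply: integrable_bddM; first exact: measurable_sin_dotp.
    by move=> y; exact: sin_max.
  exact: schwartz_integrable.
Qed.

Lemma integrable_mellin_transform (v : 'rV[R]_n -> R) b : measurable_fun setT v ->
  (forall x, `|v x| <= b * cauchy x) -> lam.-integrable setT (fun x => (fine (F x) * v x)%:E).
Proof.
move=> mv vb; have iM := integrable_mellin_mul p_gt0 p_ltn mG G0 GA iG mv vb.
have mF := measurable_tempered_fun tF.
have n0 : (0 < n)%N by rewrite -(ltr0n R) (lt_trans p_gt0).
apply: (ae_eq_integrable _ _ (integrableZl measurableT c iM)).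
  apply/measurable_EFinP; apply: measurable_funM => //.
  exact: (measurableT_comp (fine_measurable measurableT) mF).
have := ae_radial_pow_mellin n0 p_gt0 c0 mG G0 v.
move: (tempered_fun_fin_num tF); apply: filterS2 => x /fineK Fx + Dx => /(_ Dx) <-.
by rewrite EFinM Fx.
Qed.

Lemma Re_fourier (phi : 'rV[R]_n -> R[i]) y : schwartz phi ->
  complex.Re (fourier phi y) =
  cosT (fun x => complex.Re (phi x)) y + sinT (fun x => complex.Im (phi x)) y.
Proof.
move=> [su sv]; rewrite /= -RintegralD//.
- apply: eq_Rintegral => x _; rewrite (dotpC y); case: (phi x) => a b /=; ring.
- apply: integrable_bddM; [exact: measurable_cos_dotp|by move=> z; exact: cos_max|].
  exact: schwartz_integrable.
- apply: integrable_bddM; [exact: measurable_sin_dotp|by move=> z; exact: sin_max|].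
  exact: schwartz_integrable.
Qed.

Lemma Im_fourier (phi : 'rV[R]_n -> R[i]) y : schwartz phi ->
  complex.Im (fourier phi y) =
  cosT (fun x => complex.Im (phi x)) y - sinT (fun x => complex.Re (phi x)) y.
Proof.
move=> [su sv]; rewrite /= -RintegralB//.
- apply: eq_Rintegral => x _; rewrite (dotpC y); case: (phi x) => a b /=; ring.
- apply: integrable_bddM; [exact: measurable_cos_dotp|by move=> z; exact: cos_max|].
  exact: schwartz_integrable.
- apply: integrable_bddM; [exact: measurable_sin_dotp|by move=> z; exact: sin_max|].
  exact: schwartz_integrable.
Qed.

(** Real and imaginary parts of the transformed test function are each one cosine transform plus or
    minus one sine transform. The sine pairings vanish and the cosine pairings are given by
    duality. *)
Lemma fourier_radial_pow_mellin :
  distr_eq (distr_fourier (distr_of F)) (distr_scale d (distr_of F')).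
Proof.
move=> phi sphi; have [su sv] := sphi.
have [mu mv] := (measurable_schwartz su, measurable_schwartz sv).
have mcT (w : 'rV[R]_n -> R) : schwartz_real w -> measurable_fun setT (cosT w).
  by move=> sw; exact: (measurable_cosT (measurable_schwartz sw)).
have msT (w : 'rV[R]_n -> R) : schwartz_real w -> measurable_fun setT (sinT w).
  by move=> sw; exact: (measurable_sinT (measurable_schwartz sw)).
have icT (w : 'rV[R]_n -> R) : schwartz_real w -> lam.-integrable setT (fun x => (fine (F x) * cosT w x)%:E).
  move=> sw; have [b wb] := schwartz_transform_decay sw.
  by have := integrable_mellin_transform (mcT _ sw) (fun x => (wb x).1).
have isT (w : 'rV[R]_n -> R) : schwartz_real w -> lam.-integrable setT (fun x => (fine (F x) * sinT w x)%:E).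
  move=> sw; have [b wb] := schwartz_transform_decay sw.
  by have := integrable_mellin_transform (msT _ sw) (fun x => (wb x).2).
rewrite /distr_fourier (distr_ofE tF).
- rewrite /distr_scale /distr_of -[in RHS]/(complex.Re (phi _)).
  have E1 := tempered_fun_integral tF (mcT _ su).
  rewrite integral_mellin_cosT// in E1.
  have E2 := tempered_fun_integral tF (mcT _ sv).
  rewrite integral_mellin_cosT// in E2.
  have E3 := tempered_fun_integral tF (msT _ su).
  rewrite integral_mellin_sinT// in E3.
  have E4 := tempered_fun_integral tF (msT _ sv).
  rewrite integral_mellin_sinT// in E4.
  under eq_Rintegral do rewrite Re_fourier// mulrDr.
  under [X in (_ +i* X)%C]eq_Rintegral do rewrite Im_fourier// mulrBr.
  rewrite RintegralD ?RintegralB ?icT ?isT// -E1 -E2 -E3 -E4.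
  by apply/eqP; rewrite eq_complex /=; apply/andP; split; apply/eqP; ring.
- rewrite [X in measurable_fun _ X](_ : _ = cosT (fun x => complex.Re (phi x)) \+ sinT (fun x => complex.Im (phi x))); last first.
    by apply/funext => y; rewrite Re_fourier.
  by apply: measurable_funD; [exact: mcT|exact: msT].
- rewrite [X in measurable_fun _ X](_ : _ = cosT (fun x => complex.Im (phi x)) \- sinT (fun x => complex.Re (phi x))); last first.
    by apply/funext => y; rewrite Im_fourier.
  by apply: measurable_funB; [exact: mcT|exact: msT].
Qed.

Lemma positive_definite_mellin : 0 <= d -> positive_definite (distr_of F).
Proof.
move=> d0; split=> [|phi sphi phi0]; first exact: tempered_distr_of.
rewrite fourier_radial_pow_mellin// /distr_scale.
have Re0 x : 0 <= complex.Re (phi x) by have := phi0 x; case: (phi x) => a b; rewrite lecE => /andP[].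
have Im0 x : complex.Im (phi x) = 0 by have := phi0 x; case: (phi x) => a b; rewrite lecE /= => /andP[/eqP].
rewrite mulr_ge0//; first by rewrite lecE /= eqxx.
rewrite lecE /=; apply/andP; split.
  by under eq_integral do rewrite Im0 mule0; rewrite integral0.
apply: fine_ge0; apply: integral_ge0 => x _.
by rewrite mule_ge0 ?lee_fin ?Re0// poweR_ge0.
Qed.

Lemma intersection_star_mellin : (forall x, H (- x) = H x) ->
  (n%:R - p) / (p * (2 * pi) `^ (n%:R - p)) * d = 1 ->
  intersection_star (n%:R - p) (mellin_body c p G) (mellin_body c' (n%:R - p) H).
Proof.
move=> HN kd; have nqE : n%:R - (n%:R - p) = p by ring.
split; rewrite ?nqE//.
- by split; [exact: star_of_radial_star_shaped|exact: mellin_body_symmetric].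
- by split; [exact: star_of_radial_star_shaped|exact: mellin_body_symmetric].
- exact: (tempered_radial_pow_mellin mH H0 HB iH).
- move=> phi sphi; rewrite {1}/distr_scale fourier_radial_pow_mellin// /distr_scale.
  by rewrite mulrA -rmorphM /= kd mul1r.
Qed.

End transform_of_mellin_bodies.

(** * Mean bodies as Mellin bodies, and regularity of the radial mean body *)

Section mean_bodies.
Context {R : realType} (n : nat).
Local Notation lam := (lebesgue_rV R n).
Variable K : set 'rV[R]_n.
Hypothesis hK : convex_body K.

Lemma radial_mean_bodyE p : radial_mean_body p K =
  mellin_body (p / volume K) p (covariogram K).
Proof.
rewrite /radial_mean_body /mellin_body; congr star_of_radial; apply/funext => x.
congr (_ `^ _)%E; rewrite EFinM -muleA; congr (_ * _)%E.
rewrite /mellin !integral_half_line.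
have V0 := volume_gt0 hK.
rewrite -ge0_integralZl_EFin ?invr_ge0 ?(ltW V0)//.
- by apply: eq_integral => r _; rewrite -EFinM; congr EFin; ring.
- by move=> r _; rewrite lee_fin !mulr_ge0 ?powR_ge0 ?covariogram_ge0// indicE.
- have := measurable_fun_pair2 x (measurable_mellin_kernel p (measurable_covariogram hK)).
  move=> /measurable_EFinP; apply: eq_measurable_fun => r _ /=.
  by rewrite /power_density; congr EFin; ring.
Qed.

Lemma fourier_mean_bodyE p : fourier_mean_body p K =
  mellin_body (p / volume K) p (cosT (covariogram K)).
Proof.
rewrite /fourier_mean_body /mellin_body; congr star_of_radial; apply/funext => x.
congr ((_ * _) `^ _)%E; apply: eq_integral => r _.
by rewrite normc_fourier_indic.
Qed.

Section sphere.
Local Notation leb := (@lebesgue_measure R).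
Local Notation g := (covariogram K).
Variable p : R.
Hypothesis p_gt0 : 0 < p.

(** Otherwise the squared norm would be at most [n / (n + 1)^2], which is below 1. Rays in unit
    directions therefore leave a coordinate box after a uniform length. *)
Lemma enorm1_coord_gt (x : 'rV[R]_n) : enorm x = 1 -> exists i, n.+1%:R^-1 < `|x ord0 i|.
Proof.
move=> x1; apply: contrapT => /forallNP h.
have : dotp x x = 1 by rewrite -[LHS]sqr_sqrtr ?sumr_ge0// -?/(enorm x) ?x1 ?expr1n// => i _; rewrite -expr2 sqr_ge0.
suff : dotp x x <= n%:R / n.+1%:R ^+ 2.
  move=> + E; rewrite E ler_pdivlMr ?exprn_gt0// mul1r expr2 -natrM ler_nat mulSn.
  by rewrite leqNgt => /negP; apply; rewrite (leq_trans (ltnSn n))// leq_addr.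
apply: (@le_trans _ _ (\sum_(i < n) n.+1%:R ^- 2)).
  apply: ler_sum => i _; rewrite -expr2 -real_normK ?num_real// -exprVn lerXn2r ?nnegrE ?invr_ge0//.
  by rewrite leNgt; apply/negP/h.
by rewrite sumr_const card_ord mulr_natl.
Qed.

(** One majorant serves all unit directions: the covariogram is at most [volume K], and along a unit
    ray it vanishes beyond [L = (n + 1) * M], where some coordinate exceeds [M]. *)
Lemma radial_kernel_bound : exists2 a : measurableTypeR R -> R,
  leb.-integrable setT (EFin \o a) &
  forall x, enorm x = 1 -> forall r, `|power_density p r * g (r *: x)| <= a r.
Proof.
have [M M0 hM] := covariogram_eq0 hK; pose L := n.+1%:R * M.
have L0 : 0 < L by rewrite mulr_gt0.
pose b (r : measurableTypeR R) := \1_(`]0%R, 1%R] : set R) r * r `^ (p - 1).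
have mb : measurable_fun setT b.
  apply: measurable_funM; last exact: measurable_powR.
  by apply: measurable_indic; exact: measurable_itv.
have b0 r : 0 <= b r by rewrite mulr_ge0 ?powR_ge0.
have ib : (\int[leb]_r (b r)%:E = (p^-1)%:E)%E.
  rewrite -(integral01_powR p_gt0) integral_half_line; apply: eq_integral => r _.
  congr EFin; rewrite /b [RHS]mulrA; congr (_ * _); rewrite !indicE !mem_setE !in_itv/=.
  by rewrite andbT -natrM mulnb; case: (0 < r).
have ibL : leb.-integrable setT (fun r => (b (L^-1 * r + 0))%:E).
  have LV0 : L^-1 != 0 by rewrite invr_eq0 gt_eqF.
  have mbL : measurable_fun setT (fun r => (b (L^-1 * r + 0))%:E).
    by apply/measurable_EFinP; apply: (measurableT_comp mb); exact: measurable_affine.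
  apply/integrableP; split => //.
  have mbE : measurable_fun setT (EFin \o b) by exact/measurable_EFinP.
  have bE0 r : (0 <= (EFin \o b) r)%E by rewrite lee_fin.
  have bL := ge0_integral_affine 0 LV0 mbE bE0.
  apply: (@le_lt_trans _ _ (\int[leb]_r (EFin \o b) (L^-1 * r + 0)%R)%E).
    by under eq_integral do rewrite gee0_abs ?lee_fin//.
  by rewrite bL ib -EFinM ltry.
(* This is [volume K] times r^(p-1) on []0, L]], written through [b (r / L)] so that integrability
   follows from the unit interval by scaling. *)
exists (fun r => volume K * L `^ (p - 1) * b (L^-1 * r + 0)); first exact: (integrableZl measurableT _ ibL).
move=> x x1 r; rewrite addr0.
have a0 : 0 <= volume K * L `^ (p - 1) * b (L^-1 * r).
  by rewrite !mulr_ge0 ?powR_ge0// ltW// volume_gt0.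
rewrite ger0_norm ?mulr_ge0 ?power_density_ge0 ?covariogram_ge0//.
have [r0|r0] := leP r 0.
  by rewrite /power_density indicE memNset ?mul0r//= in_itv/= andbT; apply/negP; rewrite -leNgt.
have [rL|rL] := leP r L; last first.
  have [i xi] := enorm1_coord_gt x1; rewrite (hM _ i) ?mulr0//.
  rewrite mxE normrM gtr0_norm// -[M]mul1r.
  rewrite -[1](@mulfV _ n.+1%:R)// mulrAC -/L ltr_pM// ?invr_ge0// ltW//.
have -> : b (L^-1 * r) = (L^-1) `^ (p - 1) * r `^ (p - 1).
  rewrite /b indicE mem_set ?mul1r ?powRM ?invr_ge0 ?ltW//=.
  by rewrite in_itv/= mulr_gt0 ?invr_gt0//= mulrC ler_pdivrMr// mul1r.
rewrite mulrA -[volume K * _ * _]mulrA -powRM ?invr_ge0 ?(ltW L0)// mulfV ?gt_eqF// powR1 mulr1.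
rewrite mulrC ler_pM ?covariogram_ge0 ?power_density_ge0 ?covariogram_le//.
rewrite /power_density indicE; case: (_ \in _); rewrite ?mul1r// mul0r.
  exact: powR_ge0.
exact: powR_ge0.
Qed.


Let F (x : 'rV[R]_n) (r : measurableTypeR R) := power_density p r * g (r *: x).

Let mF x : measurable_fun setT (F x).
Proof. exact: (measurable_fun_pair2 x (measurable_mellin_kernel p (measurable_covariogram hK))). Qed.

Let F0 x r : 0 <= F x r.
Proof. by rewrite mulr_ge0 ?power_density_ge0 ?covariogram_ge0. Qed.

Let iF x : enorm x = 1 -> leb.-integrable setT (EFin \o F x).
Proof.
move=> x1; have [a ia aF] := radial_kernel_bound.
apply: (le_integrable measurableT _ _ ia); first exact/measurable_EFinP.
by move=> r _ /=; rewrite lee_fin (le_trans (aF x x1 r))// ler_norm.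
Qed.

Lemma mellin_covariogramE x : enorm x = 1 ->
  mellin p g x = (\int[leb]_r (power_density p r * g (r *: x)))%:E.
Proof.
move=> x1; rewrite mellinE /Rintegral fineK//.
exact: (integrable_fin_num measurableT (iF x1)).
Qed.

(** A zero integral would make the integrand vanish almost everywhere, hence at points [r k] tending
    to 0 since every []0, 1 / (k + 1)[] has positive measure. Continuity would then force the
    covariogram to vanish at 0, where it equals [volume K]. *)
Lemma mellin_covariogram_gt0 x : enorm x = 1 ->
  0 < \int[leb]_r (power_density p r * g (r *: x)).
Proof.
move=> x1; rewrite lt_neqAle; apply/andP; split; last by apply: Rintegral_ge0 => r _; exact: F0.
apply/negP => /eqP E.
have int0 : (\int[leb]_r `|(EFin \o F x) r| = 0)%E.
  under eq_integral do rewrite gee0_abs ?lee_fin//.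
  by have := mellin_covariogramE x1; rewrite -E mellinE.
have mFE : measurable_fun setT (EFin \o F x) by exact/measurable_EFinP.
have [N [mN N0 hN]] := iffLR (ae_eq_integral_abs _ measurableT mFE) int0.
have /choice[r hr] : forall k, exists r : R, 0 < r < k.+1%:R^-1 /\ F x r = 0.
  move=> k; apply: contrapT => /forallNP h.
  have sub : (`]0%R, k.+1%:R^-1[ : set (measurableTypeR R)) `<=` N.
    move=> r rk; apply: hN => /= Fr; apply: (h r); split; last by have [] := Fr Logic.I.
    by move: rk; rewrite /= in_itv.
  have le0 : (leb (`]0%R, (k.+1%:R^-1)%R[%classic : set R) <= 0)%E.
    rewrite -[X in (_ <= X)%E]N0.
    exact: (le_measure leb (mem_set (measurable_itv _)) (mem_set mN) sub).
  move: le0; rewrite lebesgue_measure_itv/= lte_fin invr_gt0 ltr0n/= oppr0 adde0.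
  by rewrite lee_fin leNgt invr_gt0 ltr0n.
have cr : r k @[k --> \oo] --> (0 : R).
  apply: (squeeze_cvgr _ (cvg_cst 0) cvg_invS); apply: nearW => k.
  by have [/andP[r0 rk] _] := hr k; rewrite !ltW.
have crx : r k *: x @[k --> \oo] --> (0 : 'rV[R]_n) by rewrite -(scale0r x); exact: cvgZl.
have := covariogram_seq_cvg hK crx; rewrite covariogram0//.
rewrite (_ : (fun k => _) = cst 0); last first.
  apply/funext => k; have [/andP[r0 _] Fr] := hr k; apply/eqP.
  move: Fr => /eqP; rewrite mulf_eq0 => /orP[|//]; rewrite mulf_eq0 => /orP[|].
    by rewrite indicE mem_set ?oner_eq0//= in_itv/= r0.
  by rewrite gt_eqF// powR_gt0.
move=> /cvg_lim; rewrite lim_cst// => V0.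
by have := volume_gt0 hK; rewrite -V0 ?ltxx.
Qed.

Lemma mellin_covariogram_cvg (x_ : nat -> 'rV[R]_n) x : enorm x = 1 ->
  (forall k, enorm (x_ k) = 1) -> x_ @ \oo --> x ->
  \int[leb]_r (power_density p r * g (r *: x_ k)) @[k --> \oo] -->
  \int[leb]_r (power_density p r * g (r *: x)).
Proof.
move=> x1 x_1 xx; have [a ia aF] := radial_kernel_bound.
apply: (@Rintegral_dominated_cvg _ _ _ _ _ _ a) => //; last by move=> k r; exact: aF.
- by move=> k; exact: mF.
- exact: mF.
apply: aeW => r; apply: cvgMr; apply: covariogram_seq_cvg => //.
exact: cvgZr.
Qed.

(** On the unit sphere the radial function is a power of a finite, positive integral that depends
    continuously on the direction; positivity makes the real power continuous there. *)
Lemma star_body_radial_mean_body : star_body (radial_mean_body p K).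
Proof.
rewrite radial_mean_bodyE; have V0 := volume_gt0 hK.
have c0 : 0 < p / volume K by rewrite divr_gt0.
pose m x := \int[leb]_r (power_density p r * g (r *: x)).
have radE x : enorm x = 1 -> radial (mellin_body (p / volume K) p g) x =
    ((p / volume K * m x) `^ p^-1)%:E.
  move=> x1; have x0 : x != 0.
    by apply/eqP => x0; move: x1; rewrite x0 enorm0 => /eqP; rewrite eq_sym oner_eq0.
  rewrite radial_star_of_radial//; last by move=> y; exact: poweR_ge0.
  by rewrite x1 invr1 scale1r mul1e mellin_covariogramE// -EFinM poweR_EFin.
have m0 x : enorm x = 1 -> 0 < p / volume K * m x.
  by move=> x1; rewrite mulr_gt0//; exact: mellin_covariogram_gt0.
split; first exact: star_of_radial_star_shaped.
  by move=> x x1; rewrite radE// ltry lte_fin powR_gt0// m0.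
apply: within_continuous_seq => x_ x x1 x_1 xx.
rewrite [X in X @ \oo --> _](_ : _ = fun k => (p / volume K * m (x_ k)) `^ p^-1); last first.
  by apply/funext => k; rewrite (radE _ (x_1 k)).
have cm : p / volume K * m (x_ k) @[k --> \oo] --> p / volume K * m x.
  by apply: cvgMr; exact: mellin_covariogram_cvg.
rewrite radE//; apply: (cvg_comp _ (fun t : R => t `^ p^-1) cm).
have [dm _] := is_derive1_powR p^-1 (m0 x x1).
by move: dm => /derivable1_diffP/differentiable_continuous; apply.
Qed.

End sphere.
End mean_bodies.

(** * The covariogram and its transform as a dual pair *)

Section covariogram_transform.
Context {R : realType} (n : nat).
Local Notation lam := (lebesgue_rV R n).
Variable K : set 'rV[R]_n.
Hypothesis hK : convex_body K.
Local Notation g := (covariogram K).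
Local Notation h := (cosT g).

Lemma integrable_covariogram : lam.-integrable setT (EFin \o g).
Proof.
have [c gc] := covariogram_bound hK.
apply: (le_integrable measurableT _ _ (integrableZl measurableT c (@integrable_cauchy R n))).
  by apply/measurable_EFinP; exact: measurable_covariogram.
by move=> x _ /=; rewrite lee_fin (le_trans (gc x))// ler_norm.
Qed.

Lemma cosT_covariogramN x : h (- x) = h x.
Proof. by apply: eq_Rintegral => y _; rewrite dotpC dotpNr cosN dotpC. Qed.

Lemma cosT_covariogram_le x : h x <= \int[lam]_y g y.
Proof.
have [c gc] := covariogram_bound hK.
by apply: (cosT_le (measurable_covariogram hK) gc); exact: covariogram_ge0.
Qed.

Lemma integrable_cosT_covariogram : lam.-integrable setT (EFin \o h).
Proof.
have [c gc] := covariogram_bound hK.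
apply: (integrable_cosT (measurable_covariogram hK) gc (A := volume K)).
- exact: covariogram_ge0.
- exact: covariogram_le.
- exact: cosT_covariogram_ge0.
Qed.

(** The factor 1 gives the shape of the abstract [pairing] hypothesis with [k = 1]; the reverse
    pairing has [k = (2 * pi) ^+ n]. *)
Lemma covariogram_pairing u s : schwartz_real u -> 0 < s ->
  \int[lam]_x (g (s^-1 *: x) * cosT u x) = s ^+ n * \int[lam]_y (1 * h (s *: y) * u y).
Proof.
move=> su s0; have [c gc] := covariogram_bound hK; have [b ub] := schwartz_bound su.
under [in RHS]eq_Rintegral do rewrite mul1r.
exact: (cosT_pairing (measurable_covariogram hK) gc s0 (measurable_schwartz su) ub).
Qed.

Lemma cosT_covariogram_pairing u s : schwartz_real u -> 0 < s ->
  \int[lam]_x (h (s^-1 *: x) * cosT u x) =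
  s ^+ n * \int[lam]_y ((2 * pi) ^+ n * g (s *: y) * u y).
Proof.
move=> su s0; have [c gc] := covariogram_bound hK.
have [a ua] := schwartz_bound su; have [b ub] := schwartz_transform_decay su.
pose e := Num.max a b.
have ue x : `|u x| <= e * cauchy x.
  by rewrite (le_trans (ua x))// ler_wpM2r ?le_max ?lexx// ltW// cauchy_gt0.
have Ue x : `|cosT u x| <= e * cauchy x.
  by rewrite (le_trans (ub x).1)// ler_wpM2r ?le_max ?lexx ?orbT// ltW// cauchy_gt0.
apply: (cosT_pairing_inv (measurable_covariogram hK) gc (covariogramN hK) (A := volume K)
  _ _ s0 (schwartz_continuous su) ue Ue).
- exact: covariogram_ge0.
- exact: covariogram_le.
Qed.

Lemma measurable_cosT_covariogram : measurable_fun setT h.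
Proof. exact: measurable_cosT (measurable_covariogram hK). Qed.

End covariogram_transform.

Theorem theorem4 (R : realType) (n : nat) (K : set 'rV[R]_n) (p : R)
    (hK : convex_body K) (p_gt0 : 0 < p) (p_ltn : p < n%:R) :
  let q : R := n%:R - p in
  [/\ [/\ tempered_fun (radial_pow (radial_mean_body p K) p),
          tempered_fun (radial_pow (fourier_mean_body q K) q),
          tempered_fun (radial_pow (fourier_mean_body p K) p) &
          tempered_fun (radial_pow (radial_mean_body q K) q)],
      distr_eq
        (distr_fourier (distr_of (radial_pow (radial_mean_body p K) p)))
        (distr_scale (p / q)
           (distr_of (radial_pow (fourier_mean_body q K) q))),
      distr_eq
        (distr_fourier (distr_of (radial_pow (fourier_mean_body p K) p)))
        (distr_scale (p * (2 * pi) ^+ n / q)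
           (distr_of (radial_pow (radial_mean_body q K) q))),
      [/\ positive_definite (distr_of (radial_pow (radial_mean_body p K) p)),
          is_intersection_body p (radial_mean_body p K) &
          exists2 L, intersection_star p (fourier_mean_body q K) L &
            radial_mean_body p K = dilate ((2 * pi) `^ ((p - n%:R) / p)) L] &
      [/\ positive_definite (distr_of (radial_pow (fourier_mean_body p K) p)),
          is_intersection_star p (fourier_mean_body p K) &
          exists2 L, intersection_star p (radial_mean_body q K) L &
            fourier_mean_body p K = dilate (2 * pi) L]].
Proof.
move=> q; have q_gt0 : 0 < q by rewrite subr_gt0.
have q_ltn : q < n%:R by rewrite gtrBl.
have nqE : n%:R - q = p by rewrite /q; ring.
have V0 := volume_gt0 hK.
pose tau : R := 2 * pi; have tau0 : 0 < tau by rewrite mulr_gt0// pi_gt0.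
have taup0 : 0 < tau `^ p by rewrite powR_gt0.
have taunE : tau ^+ n = tau `^ p * tau `^ q.
  by rewrite -powRD ?(addrC p) ?subrK ?powR_mulrn ?(ltW tau0)//; apply/implyP => _; exact: lt0r_neq0.
have mg := measurable_covariogram hK; have mh := measurable_cosT_covariogram hK.
have g0 x := covariogram_ge0 K x; have h0 x := cosT_covariogram_ge0 hK x.
have gV := covariogram_le hK; have hI := cosT_covariogram_le hK.
have ig := integrable_covariogram hK; have ih := integrable_cosT_covariogram hK.
have gN := covariogramN hK; have hN := @cosT_covariogramN R n K.
have Pg := covariogram_pairing hK; have Ph := cosT_covariogram_pairing hK.
have cp0 : 0 <= p / volume K by rewrite ltW// divr_gt0.
have cq0 : 0 <= q / volume K by rewrite ltW// divr_gt0.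
have tau_n0 : 0 <= tau ^+ n by rewrite exprn_ge0 ?ltW.
have pqE : p / volume K * 1 = p / q * (q / volume K) by field; rewrite !gt_eqF.
have pqE' : p / volume K * tau ^+ n = p * tau ^+ n / q * (q / volume K) by field; rewrite !gt_eqF.
have body := star_body_radial_mean_body hK p_gt0.
rewrite !(radial_mean_bodyE hK) !(fourier_mean_bodyE hK) in body *.
have tg c r : 0 <= c -> 0 < r -> r < n%:R -> tempered_fun (radial_pow (mellin_body c r (covariogram K)) r).
  by move=> *; exact: (tempered_radial_pow_mellin mg g0 gV ig).
have th c r : 0 <= c -> 0 < r -> r < n%:R -> tempered_fun (radial_pow (mellin_body c r (cosT (covariogram K))) r).
  by move=> *; exact: (tempered_radial_pow_mellin mh h0 hI ih).
(* The normalising constant of [I_p]; the transform must carry its inverse [d]. *)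
pose kappa := p / (q * tau `^ p); have kappa0 : 0 < kappa by rewrite divr_gt0 ?mulr_gt0.
pose d := kappa^-1; have kd : kappa * d = 1 by rewrite mulfV ?gt_eqF.
(* Free constants let the same fact serve twice: to find a source for a prescribed image, and the
   image of a prescribed source. *)
have gstar c c' : 0 <= c -> 0 <= c' -> c * kappa = c' ->
    intersection_star p (mellin_body c q (covariogram K)) (mellin_body c' p (cosT (covariogram K))).
  move=> c0 c'0 cE; have dE : c * 1 = d * c' by rewrite mulr1 -cE mulrCA mulVf ?mulr1// gt_eqF.
  have := intersection_star_mellin mg g0 gV ig gN mh h0 hI ih ler01 q_gt0 q_ltn Pg c0 _ (c' := c') (d := d).
  by rewrite nqE; apply.
have hstar c c' : 0 <= c -> 0 <= c' -> c * tau ^+ n * kappa = c' ->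
    intersection_star p (mellin_body c q (cosT (covariogram K))) (mellin_body c' p (covariogram K)).
  move=> c0 c'0 cE; have dE : c * tau ^+ n = d * c' by rewrite -cE mulrCA mulVf ?mulr1// gt_eqF.
  have := intersection_star_mellin mh h0 hI ih hN mg g0 gV ig tau_n0 q_gt0 q_ltn Ph c0 _ (c' := c') (d := d).
  by rewrite nqE; apply.
split.
- by split; [exact: tg|exact: th|exact: th|exact: tg].
- exact: (fourier_radial_pow_mellin mg g0 gV ig gN mh h0 hI ih ler01 p_gt0 p_ltn Pg cp0 cq0 pqE).
- exact: (fourier_radial_pow_mellin mh h0 hI ih hN mg g0 gV ig tau_n0 p_gt0 p_ltn Ph cp0 cq0 pqE').
- split.
  + exact: (positive_definite_mellin mg g0 gV ig gN mh h0 hI ih ler01 p_gt0 p_ltn Pg cp0 cq0 pqE (divr_ge0 (ltW p_gt0) (ltW q_gt0))).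
  (* The constant solves [c * tau ^+ n * kappa = p / volume K]; the source is a rescaled F_q K. *)
  + split => //; exists (mellin_body (p / volume K / (tau ^+ n * kappa)) q (cosT (covariogram K))).
    apply: hstar => //; first by rewrite divr_ge0// mulr_ge0// ltW.
    by rewrite -mulrA divfK// mulf_neq0// gt_eqF// exprn_gt0.
  + have c0 : 0 <= q / volume K * tau ^+ n * kappa by apply: mulr_ge0; [exact: mulr_ge0|exact: ltW].
    exists (mellin_body (q / volume K * tau ^+ n * kappa) p (covariogram K)); first exact: hstar.
    rewrite dilate_mellin_body ?powR_gt0//; congr mellin_body.
    rewrite -powRrM divfK ?gt_eqF// (_ : p - n%:R = - q); last by rewrite /q; ring.
    rewrite powRN -/tau taunE /kappa; field.
    by rewrite !gt_eqF// powR_gt0.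
- split.
  + apply: (positive_definite_mellin mh h0 hI ih hN mg g0 gV ig tau_n0 p_gt0 p_ltn Ph cp0 cq0 pqE').
    by rewrite divr_ge0 ?mulr_ge0// ltW.
  (* The constant solves [c * kappa = p / volume K], so the source is a rescaled R_q K. *)
  + exists (mellin_body (p / volume K / kappa) q (covariogram K)).
    apply: gstar => //; first by rewrite divr_ge0// ltW.
    by rewrite divfK// gt_eqF.
  + have c0 : 0 <= q / volume K * kappa by rewrite mulr_ge0// ltW.
    exists (mellin_body (q / volume K * kappa) p (cosT (covariogram K))); first exact: gstar.
    rewrite dilate_mellin_body//; congr mellin_body.
    rewrite -/tau /kappa; field.
    by rewrite !gt_eqF.
Qed.
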